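(* Let $N\ge1$ and let $\xi(\tau)=\{\xi^{(n)}_k(\tau)\}_{1\le k\le n\le N}$, $\tau\ge0$, be the Gaussian process defined in the context. For any $0<T_0<T_1$, the limit $$\zeta^{(n)}_k(T)=\lim_{L\to\infty}L^{-1/2}\xi^{(n)}_k(LT)$$ exists (as convergence in law of continuous processes on $[T_0,T_1]$, jointly for $1\le k\le n\le N$), and $\zeta(T)=\{\zeta^{(n)}_k(T):1\le k\le n\le N\}$ satisfies the system of SDEs $$d\zeta^{(n)}_k(T)=\sum_{(k',n')}A(T)_{(k,n),(k',n')}\,\zeta^{(n')}_{k'}(T)\,dT+dW^{(n)}_k(T),$$ where $W^{(n)}_k(T)$, $1\le k\le n\le N$, are independent standard Brownian motions and the matrix $A(T)$ has as its only non-zero entries $$A(T)_{(k,n),(k,n)}=\frac{-n+1}{T},\qquad A(T)_{(k,n),(k-1,n-1)}=\frac{k-1}{T},\qquad A(T)_{(k,n),(k,n-1)}=\frac{n-k}{T}.$$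
   Context: All $a_i=1$. Deterministic functions: for $1\le k\le n\le N$ and $\tau>0$, $y^{(n)}_k(\tau)=e^{-x^{(n)}_k(\tau)}$, where the $x^{(n)}_k(\tau)$ are determined by $e^{-(x^{(n)}_n(\tau)+\cdots+x^{(n)}_{n-r+1}(\tau))}=\oint\mathfrak{F}(n,r,\vec z)\,d\vec z$, $1\le r\le n$, with $$\mathfrak{F}(n,r,\vec z)=\frac{(-1)^{\frac{r(r+1)}2}\prod_{1\le k<\ell\le r}(z_k-z_\ell)^2}{(2\pi\mathrm{i})^r\,r!\prod_{k=1}^r(z_k)^r}\prod_{k=1}^r\frac{e^{-z_k\tau}}{(1-z_k)^n}$$ and counterclockwise loops enclosing $1$ but not $0$; conventions: $y^{(n)}_k=1$ for $k>n$, $y^{(n)}_k=0$ for $k\le0$. The process $\xi$: it is the continuous centered Gaussian process, started from $\xi(0)=0$, solving (arguments $\tau$ suppressed; $\xi^{(n)}_k=0$ for $k>n$) $$d\xi^{(n)}_k=-a^{(n)}_k(\xi^{(n)}_k-\xi^{(n-1)}_{k-1})d\tau+b^{(n)}_k(\xi^{(n)}_k-\xi^{(n)}_{k+1})d\tau-c^{(n)}_k(\xi^{(n)}_k-\xi^{(n-1)}_k)d\tau+\sigma^{(n)}_kdW^{(n)}_k,$$ with $W^{(n)}_k$ independent standard Brownian motions, $$\sigma^{(n)}_k=\sqrt{\frac{\Big(1-\frac{y^{(n-1)}_{k-1}}{y^{(n)}_k}\Big)\Big(1-\frac{y^{(n)}_k}{y^{(n)}_{k+1}}\Big)}{1-\frac{y^{(n)}_k}{y^{(n-1)}_k}}},\quad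 a^{(n)}_k=\frac{y^{(n-1)}_{k-1}}{y^{(n)}_k}\frac{1-\frac{y^{(n)}_k}{y^{(n)}_{k+1}}}{1-\frac{y^{(n)}_k}{y^{(n-1)}_k}},$$ $$b^{(n)}_k=\frac{y^{(n)}_k}{y^{(n)}_{k+1}}\frac{1-\frac{y^{(n-1)}_{k-1}}{y^{(n)}_k}}{1-\frac{y^{(n)}_k}{y^{(n-1)}_k}},\quad c^{(n)}_k=\frac{y^{(n)}_k}{y^{(n-1)}_k}\frac{\Big(1-\frac{y^{(n-1)}_{k-1}}{y^{(n)}_k}\Big)\Big(1-\frac{y^{(n)}_k}{y^{(n)}_{k+1}}\Big)}{\Big(1-\frac{y^{(n)}_k}{y^{(n-1)}_k}\Big)^2}.$$ (For $k=n$ the $b$ and $c$ drift terms cancel.) At each fixed $\tau>0$ its covariance is, for $n_1\ge n_2$ and $1\le r_i\le n_i$, $$\mathrm{Cov}\Big(\sum_{j=n_1-r_1+1}^{n_1}\xi^{(n_1)}_j(\tau);\sum_{j=n_2-r_2+1}^{n_2}\xi^{(n_2)}_j(\tau)\Big)=\frac{\oint\oint\Big(-\sum_{k=1}^{r_1}\sum_{\ell=1}^{r_2}\frac{z_{1,k}}{z_{1,k}-z_{2,\ell}}\Big)\mathfrak{F}(n_1,r_1,\vec z_1)\mathfrak{F}(n_2,r_2,\vec z_2)\,d\vec z_1d\vec z_2}{\oint\mathfrak{F}(n_1,r_1,\vec z_1)d\vec z_1\oint\mathfrak{F}(n_2,r_2,\vec z_2)d\vec z_2},$$ with the $z_1$-contours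 enclosing the $z_2$-contours, all enclosing $1$ but not $0$. *)

(* Defs.v *)
(* MathComp / MathComp-Analysis *)
From HB Require Import structures.
From mathcomp Require Import all_boot all_order all_algebra.
From mathcomp Require Import complex.
From mathcomp Require Import all_classical all_reals all_analysis.

Set Implicit Arguments.
Unset Strict Implicit.
Unset Printing Implicit Defensive.

Import Order.TTheory GRing.Theory Num.Theory.
Import numFieldNormedType.Exports.

Local Open Scope classical_set_scope.
Local Open Scope complex_scope.
Local Open Scope ring_scope.

Section ContourIntegrals.
Context {R : realType}.
Local Notation C := (complex R).

Definition cexp (z : C) : C :=
  (expR (complex.Re z))%:C *
  (cos (complex.Im z) +i* sin (complex.Im z)).

(* Counterclockwise contour integral over the circle of radius rho centred
   at 1; it encloses 1 but not 0 exactly when 0 < rho < 1. *)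
Definition circle_integral (rho : R) (f : C -> C) : C :=
  let e (theta : R) : C := cexp (0 +i* theta) in
  let g (theta : R) : C := f (1 + rho%:C * e theta) * ('i%C * rho%:C * e theta) in
  (\int[lebesgue_measure]_(theta in `[0, 2 * pi]) complex.Re (g theta)) +i*
  (\int[lebesgue_measure]_(theta in `[0, 2 * pi]) complex.Im (g theta)).

(* r-fold iterated integral; f receives the r variables as a sequence. *)
Fixpoint contour_integral (rho : R) (r : nat) (f : seq C -> C) : C :=
  if r is r'.+1
  then circle_integral rho
         (fun z => contour_integral rho r' (fun zs => f (z :: zs)))
  else f [::].

Definition frakF (n r : nat) (tau : R) (z : seq C) : C :=
  (-1) ^+ (r * r.+1)./2 *
  (\prod_(l < r) \prod_(k < r | (k < l)%N) (z`_k - z`_l) ^+ 2) /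
  ((2 * pi%:C * 'i%C) ^+ r * r`!%:R * \prod_(k < r) z`_k ^+ r) *
  \prod_(k < r) (cexp (- (z`_k * tau%:C)) / (1 - z`_k) ^+ n).

Definition determines_x (N : nat) (rho : R) (x : nat -> nat -> R -> R) : Prop :=
  forall (n r : nat) (tau : R), (1 <= r <= n)%N -> (n <= N)%N -> 0 < tau ->
    (expR (- \sum_((n - r).+1 <= k < n.+1) x n k tau))%:C =
    contour_integral rho r (frakF n r tau).

(* The z1-contour (radius rho1) must enclose the z2-contour (radius rho2). *)
Definition cov_formula (rho1 rho2 : R) (n1 r1 n2 r2 : nat) (tau : R) : C :=
  contour_integral rho1 r1 (fun z1 => contour_integral rho2 r2 (fun z2 =>
    (- \sum_(k < r1) \sum_(l < r2) z1`_k / (z1`_k - z2`_l)) *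
    frakF n1 r1 tau z1 * frakF n2 r2 tau z2)) /
  (contour_integral rho1 r1 (frakF n1 r1 tau) *
   contour_integral rho2 r2 (frakF n2 r2 tau)).

End ContourIntegrals.

(* Indices (k, n) with 1 <= k <= n <= N. *)
Definition tri (N : nat) : Type :=
  {p : 'I_N.+1 * 'I_N.+1 | (1 <= p.1 <= p.2)%N}.

Definition kpos (N : nat) (i : tri N) : nat := (val i).1.
Definition level (N : nat) (i : tri N) : nat := (val i).2.

(* f^(n)_k, with value 0 when (k, n) is not an index of the array. *)
Definition entry {R : realType} (N : nat) (f : tri N -> R) (n k : nat) : R :=
  \sum_(i : tri N | (level i == n) && (kpos i == k)) f i.

Section Coefficients.
Context {R : realType}.
Variable x : nat -> nat -> R -> R.

Definition yy (n k : nat) (tau : R) : R :=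
  if k == 0%N then 0 else if (n < k)%N then 1 else expR (- x n k tau).

(* For 1 <= k <= n, so that the truncated predecessors are exact. *)
Definition ratio_diag (n k : nat) (tau : R) := yy n.-1 k.-1 tau / yy n k tau.
Definition ratio_next (n k : nat) (tau : R) := yy n k tau / yy n k.+1 tau.
Definition ratio_below (n k : nat) (tau : R) := yy n k tau / yy n.-1 k tau.

Definition coef_sigma (n k : nat) (tau : R) : R :=
  Num.sqrt ((1 - ratio_diag n k tau) * (1 - ratio_next n k tau) /
            (1 - ratio_below n k tau)).
Definition coef_a (n k : nat) (tau : R) : R :=
  ratio_diag n k tau *
  ((1 - ratio_next n k tau) / (1 - ratio_below n k tau)).
Definition coef_b (n k : nat) (tau : R) : R :=
  ratio_next n k tau *
  ((1 - ratio_diag n k tau) / (1 - ratio_below n k tau)).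
Definition coef_c (n k : nat) (tau : R) : R :=
  ratio_below n k tau *
  ((1 - ratio_diag n k tau) * (1 - ratio_next n k tau) /
   (1 - ratio_below n k tau) ^+ 2).

Definition xi_drift (N : nat) (v : tri N -> R) (i : tri N) (tau : R) : R :=
  let n := level i in let k := kpos i in
  - coef_a n k tau * (entry v n k - entry v n.-1 k.-1)
  + coef_b n k tau * (entry v n k - entry v n k.+1)
  - coef_c n k tau * (entry v n k - entry v n.-1 k).

End Coefficients.

Section Processes.
Context {R : realType} {d : measure_display} {Omega : measurableType d}.
Variable P : probability Omega R.

Definition filtration (F : R -> set (set Omega)) : Prop :=
  [/\ forall t, 0 <= t -> sigma_algebra [set: Omega] (F t),
      forall t, 0 <= t -> F t `<=` measurable &
      forall s t, 0 <= s -> s <= t -> F s `<=` F t].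

Definition measurable_wrt (G : set (set Omega)) (X : Omega -> R) : Prop :=
  forall B : set R, measurable B -> G (X @^-1` B).

(* The last clause says at once that, for s < t, the increments
   W_i(t) - W_i(s) are jointly independent of F(s), independent of each other,
   and normal of variance t - s (normal_prob takes the standard deviation). *)
Definition brownian_motions (I : finType) (F : R -> set (set Omega))
    (W : I -> R -> Omega -> R) : Prop :=
  [/\ filtration F,
      forall i t, 0 <= t -> measurable_wrt (F t) (W i t),
      forall i w, W i 0 w = 0,
      forall i w, {within `[0, +oo[, continuous (fun t => W i t w)} &
      forall s t : R, 0 <= s -> s < t ->
        forall (A : set Omega) (B : I -> set R),
          F s A -> (forall i, measurable (B i)) ->
          (P (A `&` \bigcap_(i in [set: I])
                      ((fun w => (W i t w - W i s w)%R) @^-1` B i)) =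
           P A * \prod_(i : I) normal_prob 0%R (Num.sqrt (t - s)%R) (B i))%E].

(* X is the stochastic integral of sigma dW over [s, t], for a deterministic
   integrand sigma continuous on [s, t]: X is the L^2-limit of the left-point
   Riemann sums. *)
Definition is_wiener_integral (W : R -> Omega -> R) (sigma : R -> R) (s t : R)
    (X : Omega -> R) : Prop :=
  let p (m j : nat) : R := s + (t - s) * (j%:R / m%:R) in
  ('E_P[fun w =>
       ((X w - \sum_(j < m.+1)
                 sigma (p m.+1 j) * (W (p m.+1 j.+1) w - W (p m.+1 j) w)) ^+ 2)%R])%E
    @[m --> \oo] --> 0%E.

(* X is an F-adapted solution on D of
     dX_i = drift (X(t)) i t dt + sigma i t dW_i,
   in integrated form. *)
Definition solves_sde (I : finType) (F : R -> set (set Omega))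
    (W : I -> R -> Omega -> R) (D : set R)
    (drift : (I -> R) -> I -> R -> R) (sigma : I -> R -> R)
    (X : I -> R -> Omega -> R) : Prop :=
  (forall i t, D t -> measurable_wrt (F t) (X i t)) /\
  (forall i s t, D s -> D t -> s < t ->
    is_wiener_integral (W i) (sigma i) s t
      (fun w => X i t w - X i s w -
         \int[lebesgue_measure]_(u in `[s, t]) drift (X ^~ u ^~ w) i u)).

(* The Dirac mass is the degenerate case: normal_prob is not a point mass at
   standard deviation 0. *)
Definition centered_gaussian (X : Omega -> R) : Prop :=
  measurable_fun setT X /\
  exists2 s : R, 0 <= s & forall B : set R, measurable B ->
    P (X @^-1` B) = if s == 0 then \d_(0 : R) B else normal_prob 0 s B.

Definition centered_gaussian_process (I : finType) (D : set R)
    (X : I -> R -> Omega -> R) : Prop :=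
  forall (m : nat) (c : 'I_m -> R) (i : 'I_m -> I) (t : 'I_m -> R),
    (forall j, D (t j)) ->
    centered_gaussian (fun w => \sum_(j < m) c j * X (i j) (t j) w).

(* Partial sum of xi^(n)_j over n - r + 1 <= j <= n. *)
Definition top_sum (N : nat) (xi : tri N -> R -> Omega -> R) (n r : nat)
    (tau : R) (w : Omega) : R :=
  \sum_((n - r).+1 <= j < n.+1) entry (xi ^~ tau ^~ w) n j.

(* The coefficients of the equation are singular at 0, whence the open
   half-line; covariances of Gaussian variables are finite, so that fine loses
   nothing. *)
Definition xi_process (N : nat) (x : nat -> nat -> R -> R) (rho1 rho2 : R)
    (F : R -> set (set Omega)) (W xi : tri N -> R -> Omega -> R) : Prop :=
  [/\ (forall i w, xi i 0 w = 0) /\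
      (forall i w, {within `[0, +oo[, continuous (fun t => xi i t w)}),
      centered_gaussian_process `[0, +oo[ xi,
      brownian_motions F W,
      solves_sde F W `]0, +oo[ (fun v i tau => xi_drift x v i tau)
        (fun i => coef_sigma x (level i) (kpos i)) xi &
      forall (n1 r1 n2 r2 : nat) (tau : R),
        (n2 <= n1 <= N)%N -> (1 <= r1 <= n1)%N -> (1 <= r2 <= n2)%N ->
        0 < tau ->
        (fine (covariance P (top_sum xi n1 r1 tau) (top_sum xi n2 r2 tau)))%:C =
        cov_formula rho1 rho2 n1 r1 n2 r2 tau].

End Processes.

(* Z L converges in law to Zlim as L -> +oo, as continuous processes on
   [T0, T1]: expectations of bounded continuous functionals of the path
   converge, paths being given the topology of uniform convergence on
   [T0, T1]. *)
Definition cvg_in_law_paths {R : realType} (I : finType) (T0 T1 : R)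
    {d : measure_display} {Omega : measurableType d} (P : probability Omega R)
    (Z : R -> I -> R -> Omega -> R)
    {d' : measure_display} {Omega' : measurableType d'}
    (P' : probability Omega' R) (Zlim : I -> R -> Omega' -> R) : Prop :=
  forall Phi : {uniform` `[T0, T1] -> {ptws I -> R}} -> R,
    {within [set f : {uniform` `[T0, T1] -> {ptws I -> R}} |
               {within `[T0, T1], continuous (f : R -> {ptws I -> R})}],
       continuous Phi} ->
    (exists M : R, forall f, `|Phi f| <= M) ->
    ('E_P[fun w => Phi (fun t i => Z L i t w)])%E @[L --> +oo]
      --> ('E_P'[fun w => Phi (fun t i => Zlim i t w)])%E.

Definition A_matrix {R : realType} (N : nat) (T : R) (i j : tri N) : R :=
  let k := kpos i in let n := level i in
  let k' := kpos j in let n' := level j in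
  if (k' == k) && (n' == n) then (- n%:R + 1) / T
  else if (k' == k.-1) && (n' == n.-1) then (k%:R - 1) / T
  else if (k' == k) && (n' == n.-1) then (n%:R - k%:R) / T
  else 0.

(* Main.v *)
Require Import Defs.
From HB Require Import structures.
From mathcomp Require Import all_boot all_order all_algebra.
From mathcomp Require Import complex perm.
From mathcomp Require Import all_classical all_reals all_analysis measurable_realfun.
From mathcomp Require Import ring lra zify.

Set Implicit Arguments.
Unset Strict Implicit.
Unset Printing Implicit Defensive.

Import Order.TTheory GRing.Theory Num.Theory.
Import numFieldNormedType.Exports.

Local Open Scope classical_set_scope.
Local Open Scope ring_scope.


(** The process [zeta] is built on the probability space of [xi], from the same Brownian motions:
    it is the solution, started from 0 at time 0, of the limit equation driven by [W].

    Coefficients. With z = 1 + w, expanding the square of the Vandermonde determinant turns the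
    r-fold integral, up to a sign and a power of exp(-t), into the Hankel determinant of the
    residues at w = 0 of w^(i+j-n) (1+w)^-r exp(-w t) ([contour_integral_frakF]). These residues are polynomials in t,
    and their leading terms form the determinant of the numbers 1 / (n-1-i-j)! up to signs, which
    is a Vandermonde determinant in disguise ([det_inv_fact]). Hence y^(n)_k(t) equals
    exp(-t) t^(2k-n-1) ((n-k)!/(k-1)! + O(1/t)), so that a = (k-1)/t + O(t^-2), b = O(t^-2),
    c = (n-k)/t + O(t^-2) and sigma = 1 + O(1/t), with a and c nonnegative for large t
    ([coef_asym], [coef_boundsP]).

    The limit equation. Its drift at level n involves the levels n and n-1 only, so that variation
    of constants solves it level by level ([lim_sol]). The solution is a linear function of the
    driving path, bounded for the uniform norm ([lim_sol_bound]), and commutes with the change of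
    time scale ([lim_sol_scale]). By Brownian scaling, L^(-1/2) zeta(L T) therefore has the law of
    zeta(T) as a process ([path_lip_expectation]).

    Comparison. As [xi] and [zeta] have the same noise, their difference obeys a linear equation
    forced by the difference of the drifts at [zeta], of relative order 1/t, and by the stochastic
    integral of sigma - 1, which is uniformly small past a large time t0 by Kolmogorov's
    inequality ([wiener_max_ineq], [forcing_small]). As a and c are nonnegative, the drift of xi
    does not push its largest component away, up to terms of order t^-2; a barrier argument then
    bounds the difference on [t0, t] by a constant plus a small multiple of sqrt t
    ([xi_comparison]). So L^(-1/2) (xi(L T) - zeta(L T)) tends to 0 in probability, uniformly on
    [T0, T1] ([xi_close_zeta]).

    Laws. A bounded continuous functional Phi of paths is, on continuous paths, the increasing
    limit of its Lipschitz minorants ([minorant_cvg]). For a Lipschitz functional, closeness in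
    probability and scaling give the limit of the expectations; hence the lower limit of the
    expectation of Phi at the rescaled xi is at least its expectation at zeta
    ([expectation_ge]). The same for - Phi gives the convergence. *)

(** * Riemann sums and derivatives *)

Section RealAnalysis.
Context {R : realType}.
Implicit Types (f g : R -> R) (a b c d e t L x : R) (A : set R).
Local Notation mu := (@lebesgue_measure R).

Lemma within_continuous_epsP A f : {within A, continuous f} <->
  forall x, A x -> forall e, 0 < e ->
    exists2 d, 0 < d & forall y, A y -> `|x - y| < d -> `|f x - f y| < e.
Proof.
split=> [/subspace_continuousP cf x Ax e e0|cf].
  move: (cf x Ax) => /cvgrPdist_lt /(_ e e0); rewrite near_withinE /=.
  by move=> -[d /= d0 dP]; exists d => // y Ay xy; apply: dP.
apply/subspace_continuousP => x Ax; apply/cvgrPdist_lt => e e0.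
have [d d0 dP] := cf x Ax e e0; rewrite near_withinE /=.
by exists d => //= y xy Ay; apply: dP.
Qed.

(** Heine-Cantor: the segment is compact. *)
Lemma within_unif_continuous f a b : {within `[a, b], continuous f} ->
  forall e, 0 < e -> exists2 d, 0 < d & forall x y,
    x \in `[a, b] -> y \in `[a, b] -> `|x - y| < d -> `|f x - f y| < e.
Proof.
move=> /within_continuous_epsP cf e e0.
have := @segment_compact R a b => /compact_near_coveringP.
move=> /near_covering_withinP /(_ R (0^'+)
  (fun d x => forall y, y \in `[a, b] -> `|x - y| < d -> `|f x - f y| < e)) H.
have [] := H _ _.
  move=> x abx; have [d d0 dP] := cf x abx _ (divr_gt0 e0 (ltr0Sn R 1)).
  exists (ball x (d / 2), [set d' | 0 < d' < d / 2]) => /=.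
    split; first by apply: nbhsx_ballx; rewrite divr_gt0.
    by near=> d' => /=; apply/andP; split; near: d' => //;
      [exact: nbhs_right_gt|apply: nbhs_right_lt; rewrite divr_gt0].
  move=> -[x' d'] /= [xx' /andP[d'0 d'd]] abx' y aby x'y.
  rewrite (splitr e) -(subrKA (f x)); apply: le_lt_trans (ler_normD _ _) _.
  rewrite ltrD//.
    by rewrite distrC; apply: dP => //; apply: lt_trans xx' _; lra.
  apply: dP => //; rewrite -(subrKA x'); apply: le_lt_trans (ler_normD _ _) _.
  by rewrite (splitr d) ltrD//; apply: lt_trans d'd.
move=> d /= d0 dP; exists (d / 2); first by rewrite divr_gt0.
move=> x y abx aby xy; apply: (dP (d / 2)) => //=.
  by rewrite /ball_ /= sub0r normrN gtr0_norm ?divr_gt0//; lra.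
by rewrite divr_gt0.
Unshelve. all: end_near. Qed.

Lemma within_continuous_integrable f a b : {within `[a, b], continuous f} ->
  mu.-integrable `[a, b] (EFin \o f).
Proof.
by move=> cf; apply: continuous_compact_integrable => //; exact: segment_compact.
Qed.

Lemma Rintegral_within_split f a b c : a <= b -> b <= c ->
  {within `[a, c], continuous f} ->
  \int[mu]_(x in `[a, c]) f x =
  \int[mu]_(x in `[a, b]) f x + \int[mu]_(x in `[b, c]) f x.
Proof.
move=> ab bc cf; have int_f := within_continuous_integrable cf.
rewrite -(@Rintegral_itv_obnd_cbnd _ b (BRight c) f); last first.
  apply: integrableS int_f => //; apply: subset_itv => //.
rewrite -(@Rintegral_itvB _ _ (BLeft a) (BRight c) b)//.
by rewrite addrC subrK.
Qed.

Lemma Rintegral_cst_itv a b c : a <= b -> \int[mu]_(x in `[a, b]) c = c * (b - a).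
Proof.
move=> ab; rewrite (Rintegral_cst _ _ c)//= lebesgue_measure_itv /= lte_fin.
by case: ltgtP ab => // -> _; rewrite subrr.
Qed.

Lemma Rintegral_near_cst f a b c e : a <= b -> {within `[a, b], continuous f} ->
  (forall x, x \in `[a, b] -> `|f x - c| <= e) ->
  `|\int[mu]_(x in `[a, b]) f x - c * (b - a)| <= e * (b - a).
Proof.
move=> ab cf fe.
have int_f := within_continuous_integrable cf.
have icst k : mu.-integrable `[a, b] (EFin \o cst (k : R)).
  by apply/within_continuous_integrable/continuous_subspaceT => x; exact: cvg_cst.
have Ecst k : (k * (b - a) = \int[mu]_(x in `[a, b]) (cst k x))%R.
  by rewrite Rintegral_cst_itv.
have cB : {within `[a, b], continuous (fun t => f t - cst c t)}.
  by move=> x; apply: cvgB (cf x) _; exact: cvg_cst.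
rewrite !Ecst -RintegralB//.
apply: le_trans (le_normr_Rintegral _ _) _ => //.
  exact/within_continuous_integrable.
apply: le_Rintegral => //.
by apply: within_continuous_integrable => x; exact: cvg_norm (cB x).
Qed.

Lemma itv_subset_continuous f a b c d : {within `[a, b], continuous f} ->
  a <= c -> d <= b -> {within `[c, d], continuous f}.
Proof.
move=> cf ac db; apply: continuous_subspaceW cf.
by apply: subset_itv; rewrite bnd_simp.
Qed.

(** The argument [m] is the number of cells, so that lemmas on a genuine subdivision speak of
    [m.+1]. *)
Definition mesh a b (m j : nat) : R := a + (b - a) * (j%:R / m%:R).

Lemma mesh0 a b m : mesh a b m 0 = a.
Proof. by rewrite /mesh mul0r mulr0 addr0. Qed.

Lemma meshn a b m : mesh a b m.+1 m.+1 = b.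
Proof. by rewrite /mesh divff ?pnatr_eq0// mulr1 addrC subrK. Qed.

Lemma le_mesh a b m i j : a <= b -> (i <= j)%N -> mesh a b m i <= mesh a b m j.
Proof.
move=> ab ij; rewrite lerD2l ler_wpM2l ?subr_ge0//.
by rewrite ler_wpM2r ?invr_ge0// ler_nat.
Qed.

Lemma mesh_itv a b m j : a <= b -> (j <= m.+1)%N -> mesh a b m.+1 j \in `[a, b].
Proof.
by move=> ab jm; rewrite in_itv/= -{1}(mesh0 a b m.+1) -{4}(meshn a b m) !le_mesh.
Qed.

Lemma meshS a b m j : mesh a b m.+1 j.+1 - mesh a b m.+1 j = (b - a) / m.+1%:R.
Proof.
rewrite /mesh -natr1; have : m.+1%:R != 0 :> R by rewrite pnatr_eq0.
by rewrite natr1 => ?; field; rewrite addrC natr1.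
Qed.

Lemma near_mesh_lt a b d : 0 < d -> \forall m \near \oo, (b - a) / m.+1%:R < d.
Proof.
move=> d0; near=> m; rewrite ltr_pdivrMr// mulrC -ltr_pdivrMr//.
apply: lt_le_trans (_ : m%:R <= _); last by rewrite ler_nat.
by near: m; exact: nbhs_infty_gtr.
Unshelve. all: end_near. Qed.

Lemma Rintegral_mesh f a b m : a <= b -> {within `[a, b], continuous f} ->
  \int[mu]_(x in `[a, b]) f x = \sum_(j < m.+1)
    \int[mu]_(x in `[mesh a b m.+1 j, mesh a b m.+1 j.+1]) f x.
Proof.
move=> ab cf; have H j : (j <= m.+1)%N ->
  \int[mu]_(x in `[a, mesh a b m.+1 j]) f x = \sum_(i < j)
    \int[mu]_(x in `[mesh a b m.+1 i, mesh a b m.+1 i.+1]) f x.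
  elim: j => [_|j IH jm]; first by rewrite big_ord0 mesh0 set_itv1 Rintegral_set1.
  rewrite big_ord_recr/= -IH 1?ltnW// -Rintegral_within_split ?le_mesh//.
    by move/(mesh_itv ab): (ltnW jm); rewrite in_itv => /andP[].
  apply: itv_subset_continuous cf _ _ => //.
  by move/(mesh_itv ab): jm; rewrite in_itv => /andP[].
by rewrite -{1}(meshn a b m) H.
Qed.

Lemma riemann_sum_cvg f a b : a <= b -> {within `[a, b], continuous f} ->
  \sum_(j < m.+1) f (mesh a b m.+1 j) * ((b - a) / m.+1%:R) @[m --> \oo]
    --> \int[mu]_(x in `[a, b]) f x.
Proof.
move=> ab cf; apply/cvgrPdist_le => e e0.
have e'0 : 0 < e / (b - a + 1) by rewrite divr_gt0// ltr_wpDl// subr_ge0.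
have [d d0 dP] := within_unif_continuous cf e'0.
near=> m; rewrite (Rintegral_mesh m ab cf) -sumrB.
apply: le_trans (ler_norm_sum _ _ _) _.
apply: le_trans (_ : \sum_(j < m.+1) (e / (b - a + 1) * ((b - a) / m.+1%:R)) <= _).
  apply: ler_sum => j _; rewrite -!(meshS a b m j).
  have i1 := mesh_itv ab (ltnW (ltn_ord j)); have i2 := mesh_itv ab (ltn_ord j).
  have le12 := le_mesh m.+1 ab (leqnSn j).
  apply: Rintegral_near_cst => //.
    by apply: itv_subset_continuous cf _ _; move: i1 i2; rewrite !in_itv => /andP[? ?] /andP[].
  move=> x; rewrite in_itv/= => /andP[x1 x2]; apply/ltW/dP => //.
    move: i1 i2; rewrite !in_itv/= => /andP[y1 y2] /andP[y3 y4].
    by rewrite (le_trans y1)//= (le_trans x2).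
  rewrite ger0_norm ?subr_ge0//; apply: le_lt_trans (lerB x2 (lexx _)) _.
  by rewrite meshS; near: m; exact: near_mesh_lt.
rewrite sumr_const card_ord -mulrnAr -mulr_natr divfK ?pnatr_eq0//.
rewrite mulrAC ler_pdivrMr; last by rewrite ltr_wpDl// subr_ge0.
by rewrite ler_wpM2l ?(ltW e0)// -subr_ge0; lra.
Unshelve. all: end_near. Qed.

(** The change of variable carries the Riemann sums of one side to those of the other. *)
Lemma Rintegral_scale f b L : 0 < L -> 0 <= b ->
  {within `[0, L * b], continuous f} ->
  \int[mu]_(x in `[0, L * b]) f x = L * \int[mu]_(x in `[0, b]) f (L * x).
Proof.
move=> L0 b0 cf.
have Lb0 : 0 <= L * b by rewrite mulr_ge0// ltW.
have cfL : {within `[0, b], continuous (fun x => f (L * x))}.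
  apply/within_continuous_epsP => x xb e e0.
  have LP y : `[0, b]%classic y -> `[0, L * b]%classic (L * y).
    by rewrite /= !in_itv/= => /andP[? ?]; rewrite mulr_ge0 ?(ltW L0)//= ler_pM2l.
  move/within_continuous_epsP : cf => /(_ _ (LP _ xb) _ e0)[d d0 dP].
  exists (d / L); first by rewrite divr_gt0.
  move=> y yb xy; apply: dP; first exact: LP.
  by rewrite -mulrBr normrM gtr0_norm// mulrC -ltr_pdivlMr.
have /(cvg_lim (@Rhausdorff R)) <- := riemann_sum_cvg Lb0 cf.
apply: cvg_lim; first exact: Rhausdorff.
rewrite [X in X @ _](_ : _ = fun m => L * \sum_(j < m.+1)
   f (L * mesh 0 b m.+1 j) * ((b - 0) / m.+1%:R)); last first.
  apply/funext => m; rewrite big_distrr/=; apply: eq_bigr => j _.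
  rewrite /mesh !add0r !subr0 !mulrA; congr (_ * _).
  by rewrite [L * f _]mulrC.
by apply: cvgM; [exact: cvg_cst|exact: riemann_sum_cvg].
Qed.

Lemma pw_is_deriveD f g (x df dg : R) : is_derive x 1 f df -> is_derive x 1 g dg ->
  is_derive x 1 (fun t => f t + g t) (df + dg).
Proof. exact: is_deriveD. Qed.

Lemma pw_is_deriveB f g (x df dg : R) : is_derive x 1 f df -> is_derive x 1 g dg ->
  is_derive x 1 (fun t => f t - g t) (df - dg).
Proof. exact: is_deriveB. Qed.

Lemma pw_is_deriveM f g (x df dg : R) : is_derive x 1 f df -> is_derive x 1 g dg ->
  is_derive x 1 (fun t => f t * g t) (df * g x + f x * dg).
Proof.
by move=> d1 d2; apply: (is_derive_eq (is_deriveM d1 d2)); rewrite addrC mulrC.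
Qed.

Lemma pw_is_deriveZ k f (x df : R) : is_derive x 1 f df ->
  is_derive x 1 (fun t => k * f t) (k * df).
Proof. exact: is_deriveZ. Qed.

Lemma pw_is_deriveX n (x : R) : is_derive x 1 (fun t => t ^+ n) (n%:R * x ^+ n.-1).
Proof.
rewrite (_ : (fun t => t ^+ n) = id ^+ n); last by apply/funext => t; rewrite exprfctE.
by apply: is_derive_eq; rewrite /GRing.scale/= mulr1.
Qed.

Lemma is_derive_continuous f (x df : R) : is_derive x 1 f df -> {for x, continuous f}.
Proof. by move=> d; apply/differentiable_continuous/derivable1_diffP; case: d. Qed.

End RealAnalysis.

(** * Contour integrals *)

Section CircleMean.
Context {R : realType}.
Local Notation C := (complex R).
Local Notation mu := (@lebesgue_measure R).
Local Notation normc := (@ComplexField.Normc.normc R).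
Implicit Types (g h : R -> C) (z w : C) (t b : R).
Local Open Scope complex_scope.

Lemma ReD z w : complex.Re (z + w) = complex.Re z + complex.Re w.
Proof. by case: z w => [a b] [c d]. Qed.
Lemma ImD z w : complex.Im (z + w) = complex.Im z + complex.Im w.
Proof. by case: z w => [a b] [c d]. Qed.
Lemma ReM z w : complex.Re (z * w) =
  complex.Re z * complex.Re w - complex.Im z * complex.Im w.
Proof. by case: z w => [a b] [c d]. Qed.
Lemma ImM z w : complex.Im (z * w) =
  complex.Re z * complex.Im w + complex.Im z * complex.Re w.
Proof. by case: z w => [a b] [c d] /=; rewrite addrC; congr (_ + _); rewrite mulrC. Qed.

Lemma complex_eq z w : complex.Re z = complex.Re w ->
  complex.Im z = complex.Im w -> z = w.
Proof. by case: z w => [a b] [c d] /= -> ->. Qed.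

(** A contour integral is made of the integrals of the real and of the imaginary part. *)
Definition ccontinuous g :=
  continuous (fun t => complex.Re (g t)) /\ continuous (fun t => complex.Im (g t)).

Lemma ccontinuous_cst z : ccontinuous (fun=> z).
Proof. by split=> t; exact: cvg_cst. Qed.

Lemma ccontinuousD g h : ccontinuous g -> ccontinuous h ->
  ccontinuous (fun t => g t + h t).
Proof.
move=> [g1 g2] [h1 h2]; split=> t.
  by under eq_fun do rewrite ReD; exact: continuousD (g1 t) (h1 t).
by under eq_fun do rewrite ImD; exact: continuousD (g2 t) (h2 t).
Qed.

Lemma ccontinuousM g h : ccontinuous g -> ccontinuous h ->
  ccontinuous (fun t => g t * h t).
Proof.
move=> [g1 g2] [h1 h2]; split=> t.
  under eq_fun do rewrite ReM.
  exact: continuousB (continuousM (g1 t) (h1 t)) (continuousM (g2 t) (h2 t)).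
under eq_fun do rewrite ImM.
exact: continuousD (continuousM (g1 t) (h2 t)) (continuousM (g2 t) (h1 t)).
Qed.

Lemma ccontinuousX g k : ccontinuous g -> ccontinuous (fun t => g t ^+ k).
Proof.
move=> cg; elim: k => [|k IH]; first exact: ccontinuous_cst.
by under eq_fun do rewrite exprS; exact: ccontinuousM.
Qed.

Lemma ccontinuousN g : ccontinuous g -> ccontinuous (fun t => - g t).
Proof.
move=> cg; under eq_fun do rewrite -mulN1r.
by apply: ccontinuousM => //; exact: ccontinuous_cst.
Qed.

Lemma ccontinuous_sum (I : finType) (F : I -> R -> C) :
  (forall i, ccontinuous (F i)) -> ccontinuous (fun t => \sum_i F i t).
Proof.
move=> cF; elim: (index_enum I) => [|i s IH].
  by under eq_fun do rewrite big_nil; exact: ccontinuous_cst.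
by under eq_fun do rewrite big_cons; exact: ccontinuousD.
Qed.

Lemma ccontinuousV g : (forall t, g t != 0) -> ccontinuous g ->
  ccontinuous (fun t => (g t)^-1).
Proof.
move=> g0 [c1 c2].
have n0 t : complex.Re (g t) ^+ 2 + complex.Im (g t) ^+ 2 != 0.
  move: (g0 t); case: (g t) => a b /= ; rewrite eq_complex /= => ab.
  by rewrite paddr_eq0 ?sqr_ge0// !sqrf_eq0.
have c3 : continuous (fun t => (complex.Re (g t) ^+ 2 + complex.Im (g t) ^+ 2)^-1).
  move=> t; apply: (cvgV (n0 t)).
  exact: cvgD (cvgM (c1 t) (c1 t)) (cvgM (c2 t) (c2 t)).
have E t : (g t)^-1 = (complex.Re (g t) * (complex.Re (g t) ^+ 2 + complex.Im (g t) ^+ 2)^-1)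
   +i* (- (complex.Im (g t) * (complex.Re (g t) ^+ 2 + complex.Im (g t) ^+ 2)^-1)).
  by case: (g t).
split=> t; under eq_fun do rewrite E /=.
  exact: continuousM (c1 t) (c3 t).
exact: continuousN (continuousM (c2 t) (c3 t)).
Qed.

Definition mean (g : R -> C) : C :=
  (\int[mu]_(t in `[0, 2 * pi]) complex.Re (g t)) +i*
  (\int[mu]_(t in `[0, 2 * pi]) complex.Im (g t)).

Let pi2_ge0 : 0 <= 2 * pi :> R.
Proof. by rewrite mulr_ge0// pi_ge0. Qed.

Let integ (f : R -> R) : continuous f -> mu.-integrable `[0, 2 * pi] (EFin \o f).
Proof. by move=> cf; apply/within_continuous_integrable/continuous_subspaceT. Qed.

Lemma meanD g h : ccontinuous g -> ccontinuous h ->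
  mean (fun t => g t + h t) = mean g + mean h.
Proof.
move=> [g1 g2] [h1 h2]; apply: complex_eq; rewrite ?ReD ?ImD /=.
  by under eq_Rintegral do rewrite ReD; rewrite RintegralD//; exact: integ.
by under eq_Rintegral do rewrite ImD; rewrite RintegralD//; exact: integ.
Qed.

Lemma meanZ z g : ccontinuous g -> mean (fun t => z * g t) = z * mean g.
Proof.
move=> [g1 g2].
have Z (k : R) (f : R -> R) : continuous f -> \int[mu]_(t in `[0, 2 * pi]) (k * f t) =
   k * \int[mu]_(t in `[0, 2 * pi]) f t.
  by move=> cf; rewrite RintegralZl//; exact: integ.
have cZ (k : R) (f : R -> R) : continuous f -> continuous (fun t => k * f t).
  by move=> cf t; apply: continuousM; [exact: cst_continuous|exact: cf].
apply: complex_eq; rewrite ?ReM ?ImM /=.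
  under eq_Rintegral do rewrite ReM.
  by rewrite RintegralB//; [rewrite !Z|exact/integ/cZ..].
under eq_Rintegral do rewrite ImM.
by rewrite RintegralD//; [rewrite !Z|exact/integ/cZ..].
Qed.

Lemma mean0 : mean (fun=> 0) = 0.
Proof.
rewrite -[RHS](mul0r (mean (fun=> 0))) -meanZ; last exact: ccontinuous_cst.
by congr mean; apply/funext => t; rewrite mulr0.
Qed.

Lemma mean_sum (I : finType) (F : I -> R -> C) : (forall i, ccontinuous (F i)) ->
  mean (fun t => \sum_i F i t) = \sum_i mean (F i).
Proof.
move=> cF; elim: (index_enum I) => [|i s IH].
  by under eq_fun do rewrite big_nil; rewrite big_nil mean0.
under eq_fun do rewrite big_cons; rewrite big_cons meanD// ?IH//.
elim: s {IH} => [|j s IH].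
  by under eq_fun do rewrite big_nil; exact: ccontinuous_cst.
by under eq_fun do rewrite big_cons; exact: ccontinuousD.
Qed.

Lemma Re_le_normc z : `|complex.Re z| <= normc z.
Proof.
by case: z => a b /=; rewrite -sqrtr_sqr ler_wsqrtr// lerDl sqr_ge0.
Qed.

Lemma Im_le_normc z : `|complex.Im z| <= normc z.
Proof.
by case: z => a b /=; rewrite -sqrtr_sqr ler_wsqrtr// lerDr sqr_ge0.
Qed.

Lemma normc_le_ReIm z b : `|complex.Re z| <= b -> `|complex.Im z| <= b ->
  normc z <= 2 * b.
Proof.
case: z => x y /= xb yb; have b0 := le_trans (normr_ge0 _) xb.
rewrite -[leRHS]ger0_norm ?mulr_ge0// -sqrtr_sqr ler_wsqrtr//.
rewrite -(real_normK (num_real x)) -(real_normK (num_real y)).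
have := lerXn2r 2 (normr_ge0 x : `|x| \in Num.nneg) (b0 : b \in Num.nneg) xb.
have := lerXn2r 2 (normr_ge0 y : `|y| \in Num.nneg) (b0 : b \in Num.nneg) yb.
rewrite exprMn; nra.
Qed.

(** The real and the imaginary part are bounded separately, whence the factor 2. *)
Lemma mean_bound g b : ccontinuous g -> (forall t, normc (g t) <= b) ->
  normc (mean g) <= 2 * (b * (2 * pi)).
Proof.
have H (f : R -> R) : continuous f -> (forall t, `|f t| <= b) ->
    `|\int[mu]_(t in `[0, 2 * pi]) f t| <= b * (2 * pi).
  move=> cf fb; have := @Rintegral_near_cst R f 0 (2 * pi) 0 b.
  rewrite mul0r !subr0; apply => //; first exact/continuous_subspaceT.
  by move=> x _; rewrite subr0.
move=> [c1 c2] gb; apply: normc_le_ReIm => /=; apply: H => // t.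
  exact: le_trans (Re_le_normc _) _.
exact: le_trans (Im_le_normc _) _.
Qed.

Definition cis t : C := cos t +i* sin t.

Lemma cisD t b : cis (t + b) = cis t * cis b.
Proof.
by apply: complex_eq; rewrite ?ReM ?ImM /= ?cosD ?sinD// addrC.
Qed.

Lemma cis0 : cis 0 = 1. Proof. by rewrite /cis cos0 sin0. Qed.

Lemma normc_cis t : normc (cis t) = 1.
Proof. by rewrite /= cos2Dsin2 sqrtr1. Qed.

Lemma cis_neq0 t : cis t != 0.
Proof.
by apply/eqP => H; have := normc_cis t; rewrite H ComplexField.Normc.normc0 => /esym/eqP; rewrite oner_eq0.
Qed.

Lemma cisN t : cis (- t) = (cis t)^-1.
Proof.
by apply: (mulfI (cis_neq0 t)); rewrite -cisD subrr cis0 divff// cis_neq0.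
Qed.

Lemma cisX t k : cis t ^+ k = cis (k%:R * t).
Proof.
elim: k => [|k IH]; first by rewrite expr0 mul0r cis0.
by rewrite exprS IH -cisD -nat1r mulrDl mul1r.
Qed.

Lemma ccontinuous_cis : ccontinuous cis.
Proof. by split=> t; [exact: continuous_cos|exact: continuous_sin]. Qed.

Lemma cexp_imag t : cexp (0 +i* t) = cis t.
Proof. by rewrite /cexp /= expR0 mul1r. Qed.

Let int_deriv (f F : R -> R) : continuous f -> (forall t, is_derive t 1 F (f t)) ->
  F (2 * pi) = F 0 -> \int[mu]_(t in `[0, 2 * pi]) f t = 0.
Proof.
move=> cf dF FF; have pi2 : 0 < 2 * pi :> R by rewrite mulr_gt0// pi_gt0.
have cF : continuous F.
  by move=> t; apply/differentiable_continuous/derivable1_diffP; case: (dF t).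
rewrite /Rintegral (continuous_FTC2 pi2 (F := F)).
- by rewrite FF -EFinB subrr.
- exact: continuous_subspaceT.
- split; [by move=> t _; case: (dF t)|exact/cvg_at_right_filter/cF|exact/cvg_at_left_filter/cF].
- by move=> t _; rewrite derive1E; exact: derive_val.
Qed.

Lemma cos2pin k : cos (k%:R * (2 * pi)) = 1 :> R.
Proof.
elim: k => [|k IH]; first by rewrite mul0r cos0.
by rewrite -natr1 mulrDl mul1r {2}[2 * _](mulr_natl pi 2) cosD2pi.
Qed.

Lemma sin2pin k : sin (k%:R * (2 * pi)) = 0 :> R.
Proof.
elim: k => [|k IH]; first by rewrite mul0r sin0.
by rewrite -natr1 mulrDl mul1r {2}[2 * _](mulr_natl pi 2) sinD2pi.
Qed.

(* The primitives sin (k t) / k and - cos (k t) / k are 2 pi-periodic. *)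
Let mean_cos_sin k : (0 < k)%N -> \int[mu]_(t in `[0, 2 * pi]) cos (k%:R * t) = 0 /\
  \int[mu]_(t in `[0, 2 * pi]) sin (k%:R * t) = 0.
Proof.
move=> k0; have k0' : k%:R != 0 :> R by rewrite pnatr_eq0 -lt0n.
have dk t : is_derive t 1 ( *%R k%:R) k%:R.
  by apply: (is_derive_eq (is_deriveZ _ _)); rewrite /= scaler1.
have ck : continuous ( *%R (k%:R : R)) by exact: mulrl_continuous.
split.
- apply: (int_deriv (F := fun t => k%:R^-1 * sin (k%:R * t))).
  + by move=> t; apply: continuous_comp; [exact: ck|exact: continuous_cos].
  + move=> t; have d1 := @is_derive1_comp _ sin _ t _ _ (is_derive_sin _) (dk t).
    apply: (is_derive_eq (@is_deriveZ _ _ _ _ k%:R^-1 _ _ _ d1)).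
    by rewrite /GRing.scale /= mulrC -mulrA divff// mulr1.
  + by rewrite sin2pin !mulr0 sin0 mulr0.
- apply: (int_deriv (F := fun t => - k%:R^-1 * cos (k%:R * t))).
  + by move=> t; apply: continuous_comp; [exact: ck|exact: continuous_sin].
  + move=> t; have d1 := @is_derive1_comp _ cos _ t _ _ (is_derive_cos _) (dk t).
    apply: (is_derive_eq (@is_deriveZ _ _ _ _ (- k%:R^-1) _ _ _ d1)).
    by rewrite /GRing.scale /= mulNr mulNr mulrN opprK mulrC -mulrA divff// mulr1.
  + by rewrite cos2pin mulr0 cos0.
Qed.

Lemma mean_cisX k : (0 < k)%N -> mean (fun t => cis t ^+ k) = 0.
Proof.
move=> k0; have [c s] := mean_cos_sin k0.
by apply: complex_eq => /=; [rewrite -[RHS]c|rewrite -[RHS]s];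
  apply: eq_Rintegral => t _; rewrite cisX.
Qed.

Lemma mean_cisVX k : (0 < k)%N -> mean (fun t => cis t ^- k) = 0.
Proof.
move=> k0; have [c s] := mean_cos_sin k0.
apply: complex_eq => /=; [rewrite -[RHS]c|rewrite -[RHS]oppr0 -[in RHS]s -mulN1r -RintegralZl//].
- by apply: eq_Rintegral => t _; rewrite cisX -cisN /= cosN.
- by apply: eq_Rintegral => t _; rewrite cisX -cisN /= sinN mulN1r.
- apply: integ => t; apply: continuous_comp; [exact: mulrl_continuous|exact: continuous_sin].
Qed.

Lemma mean_cst z : mean (fun=> z) = z * (2 * pi)%:C.
Proof.
by apply: complex_eq; rewrite ?ReM ?ImM /= !Rintegral_cst_itv// !subr0 ?mulr0 ?subr0 ?add0r.
Qed.

End CircleMean.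

Section ComplexExponential.
Context {R : realType}.
Local Notation C := (complex R).
Local Notation normc := (@ComplexField.Normc.normc R).
Implicit Types (z w : C) (t b c : R).
Local Open Scope complex_scope.

Lemma cexpD z w : cexp (z + w) = cexp z * cexp w.
Proof.
rewrite /cexp ReD ImD expRD rmorphM/= mulrACA; congr (_ * _).
exact: (cisD (complex.Im z) (complex.Im w)).
Qed.

Lemma cexp_real t : cexp t%:C = (expR t)%:C.
Proof. by rewrite /cexp /= cos0 sin0 mulr1. Qed.

Lemma Re_realM t z : complex.Re (t%:C * z) = t * complex.Re z.
Proof. by rewrite ReM /= mul0r subr0. Qed.
Lemma Im_realM t z : complex.Im (t%:C * z) = t * complex.Im z.
Proof. by rewrite ImM /= mul0r addr0. Qed.
Lemma Re_cexp z : complex.Re (cexp z) = expR (complex.Re z) * cos (complex.Im z).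
Proof. by rewrite /cexp Re_realM. Qed.
Lemma Im_cexp z : complex.Im (cexp z) = expR (complex.Re z) * sin (complex.Im z).
Proof. by rewrite /cexp Im_realM. Qed.

Let fact_shift c t M : c / M.+1`!%:R * (M.+1%:R * t) = c / M`!%:R * t.
Proof.
have M0 : M`!%:R != 0 :> R by rewrite pnatr_eq0 -lt0n fact_gt0.
have M1 : M.+1%:R != 0 :> R by rewrite pnatr_eq0.
rewrite factS natrM invfM; move: (M.+1%:R : R) (M`!%:R : R) M0 M1 => p q p0 q0.
by field; rewrite p0 q0.
Qed.

Let der_bound (f df : R -> R) c M : (forall t, is_derive t 1 f (df t)) -> f 0 = 0 ->
  (forall t, 0 <= t <= 1 -> `|df t| <= c * (t ^+ M / M`!%:R)) ->
  forall t, 0 <= t <= 1 -> `|f t| <= c * (t ^+ M.+1 / M.+1`!%:R).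
Proof.
move=> dfE f0 dfb t t01.
have H (s : R) : `|s| <= 1 -> 0 <= c * (t ^+ M.+1 / M.+1`!%:R) - s * f t.
  move=> s1; pose F x := c * M.+1`!%:R^-1 * x ^+ M.+1 - s * f x.
  have dF (x : R) : is_derive x 1 F (c * (x ^+ M / M`!%:R) - s * df x).
    refine (is_derive_eq (pw_is_deriveB (pw_is_deriveZ _ (pw_is_deriveX _ _))
      (pw_is_deriveZ _ (dfE _))) _).
    by rewrite /= fact_shift mulrA mulrAC.
  have -> : c * (t ^+ M.+1 / M.+1`!%:R) - s * f t = F t.
    by rewrite /F mulrA mulrAC.
  have <- : F 0 = 0 by rewrite /F f0 expr0n /= !mulr0 subr0.
  have /andP[t0 t1] := t01.
  apply: (@ger0_derive1_ndecr _ F 0 1) => //.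
  + move=> x; rewrite in_itv /= => /andP[x0 x1].
    rewrite derive1E (@derive_val _ _ _ _ _ _ _ (dF x)) subr_ge0.
    apply: le_trans (ler_norm _) _; rewrite normrM.
    apply: le_trans (dfb x _); last by rewrite !ltW.
    by rewrite ler_piMl.
  + by apply: continuous_subspaceT => x; exact: is_derive_continuous (dF x).
rewrite ler_norml; apply/andP; split.
  by rewrite -subr_ge0 opprK addrC; have := H (-1); rewrite mulN1r opprK normrN normr1; apply.
by rewrite -subr_ge0; have := H 1; rewrite mul1r normr1; apply.
Qed.

Let rem (f : C -> R) z M t :=
  f (cexp (t%:C * z)) - \sum_(m < M) f (z ^+ m) / m`!%:R * t ^+ m.

Let is_derive_cexp_Re z t : is_derive t 1 (fun t => complex.Re (cexp (t%:C * z)))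
  (complex.Re z * complex.Re (cexp (t%:C * z)) - complex.Im z * complex.Im (cexp (t%:C * z))).
Proof.
under eq_fun do rewrite Re_cexp Re_realM Im_realM.
rewrite Re_cexp Im_cexp Re_realM Im_realM; apply: is_derive_eq.
by rewrite /GRing.scale /=; ring.
Qed.

Let is_derive_cexp_Im z t : is_derive t 1 (fun t => complex.Im (cexp (t%:C * z)))
  (complex.Re z * complex.Im (cexp (t%:C * z)) + complex.Im z * complex.Re (cexp (t%:C * z))).
Proof.
under eq_fun do rewrite Im_cexp Re_realM Im_realM.
rewrite Re_cexp Im_cexp Re_realM Im_realM; apply: is_derive_eq.
by rewrite /GRing.scale /=; ring.
Qed.

Let is_derive_taylor (u : nat -> R) M t :
  is_derive t 1 (fun t => \sum_(m < M.+1) u m / m`!%:R * t ^+ m)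
    (\sum_(m < M) u m.+1 / m`!%:R * t ^+ m).
Proof.
elim: M => [|M IH].
  rewrite big_ord0; under eq_fun do rewrite big_ord_recl big_ord0 addr0 expr0.
  exact: is_derive_cst.
under eq_fun do rewrite big_ord_recr; rewrite big_ord_recr /=.
refine (is_derive_eq (pw_is_deriveD IH (pw_is_deriveZ _ (pw_is_deriveX _ _))) _).
by congr (_ + _); rewrite /= fact_shift.
Qed.

(* By induction on the order: the derivative of each remainder is, up to the
   factors Re z and Im z, a combination of the two remainders of the previous order. *)
Let rem_bound z b M : normc z <= b -> forall t, 0 <= t <= 1 ->
  `|rem (@complex.Re R) z M t| <= expR b * (2 * b) ^+ M * (t ^+ M / M`!%:R) /\
  `|rem (@complex.Im R) z M t| <= expR b * (2 * b) ^+ M * (t ^+ M / M`!%:R).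
Proof.
move=> zb; have zRb := le_trans (Re_le_normc z) zb; have zIb := le_trans (Im_le_normc z) zb.
have b0 : 0 <= b by apply: le_trans zRb.
elim: M => [|M IH] t t01.
  have ce : normc (cexp (t%:C * z)) <= expR b.
    rewrite /cexp ComplexField.Normc.normcM (normc_cis (complex.Im (t%:C * z))) mulr1 /=.
    rewrite expr0n addr0 sqrtr_sqr ger0_norm ?expR_ge0// ler_expR.
    rewrite Re_realM; case/andP: t01 => t0 t1.
    apply: le_trans (ler_norm _) _; rewrite normrM (ger0_norm t0) -[leRHS]mul1r.
    by rewrite ler_pM.
  rewrite !expr0 mulr1 divr1 mulr1 /rem !big_ord0 !subr0.
  by split; [exact: le_trans (Re_le_normc _) _|exact: le_trans (Im_le_normc _) _].
have b2 : 0 <= 2 * b by rewrite mulr_ge0.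
have E (x y u v B : R) : `|x| <= b -> `|y| <= b -> `|u| <= B -> `|v| <= B ->
   `|x * u| + `|y * v| <= 2 * b * B.
  move=> xb yb uB vB; rewrite !normrM.
  have -> : 2 * b * B = b * B + b * B by ring.
  by rewrite lerD// ler_pM.
have lin (x y t' : R) (p q : nat -> R) :
    x * \sum_(m < M) p m / m`!%:R * t' ^+ m + y * \sum_(m < M) q m / m`!%:R * t' ^+ m =
    \sum_(m < M) (x * p m + y * q m) / m`!%:R * t' ^+ m.
  by rewrite !big_distrr -big_split /=; apply: eq_bigr => m _; ring.
have rem0 f : f 1 = f (cexp 0) -> rem f z M.+1 0 = 0.
  move=> f1; rewrite /rem big_ord_recl big1 => [|i _]; last by rewrite expr0n mulr0.
  by rewrite mul0r -f1 !expr0 divr1 mulr1 addr0 subrr.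
have cexp0 : cexp 0 = 1 :> C by rewrite (cexp_real 0) expR0.
split.
- apply: (@der_bound _ (fun t => complex.Re z * rem (@complex.Re R) z M t - complex.Im z * rem (@complex.Im R) z M t)) t01.
  + move=> u; refine (is_derive_eq (pw_is_deriveB (is_derive_cexp_Re z u)
      (is_derive_taylor (fun m => complex.Re (z ^+ m)) M u)) _).
    under eq_bigr do rewrite exprS ReM -mulNr.
    rewrite -(lin _ _ u (fun m => complex.Re (z ^+ m)) (fun m => complex.Im (z ^+ m))).
    by rewrite /rem; ring.
  + by rewrite !rem0 ?cexp0// !mulr0 ?subr0 ?addr0.
  + move=> u u01; have [h1 h2] := IH u u01.
    apply: le_trans (ler_normB _ _) _; rewrite exprS.
    rewrite [leRHS](_ : _ = 2 * b * (expR b * (2 * b) ^+ M * (u ^+ M / M`!%:R))); last by ring.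
    exact: E.
- apply: (@der_bound _ (fun t => complex.Re z * rem (@complex.Im R) z M t + complex.Im z * rem (@complex.Re R) z M t)) t01.
  + move=> u; refine (is_derive_eq (pw_is_deriveB (is_derive_cexp_Im z u)
      (is_derive_taylor (fun m => complex.Im (z ^+ m)) M u)) _).
    under eq_bigr do rewrite exprS ImM.
    rewrite -(lin _ _ u (fun m => complex.Im (z ^+ m)) (fun m => complex.Re (z ^+ m))).
    by rewrite /rem; ring.
  + by rewrite !rem0 ?cexp0// !mulr0 ?subr0 ?addr0.
  + move=> u u01; have [h1 h2] := IH u u01.
    apply: le_trans (ler_normD _ _) _; rewrite exprS.
    rewrite [leRHS](_ : _ = 2 * b * (expR b * (2 * b) ^+ M * (u ^+ M / M`!%:R))); last by ring.
    exact: E.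
Qed.

(** Applied to the function t |-> cexp (t z) of a real variable, between 0 and 1. *)
Lemma cexp_taylor z b M : normc z <= b ->
  normc (cexp z - \sum_(m < M) z ^+ m / m`!%:R) <= 2 * (expR b * ((2 * b) ^+ M / M`!%:R)).
Proof.
move=> zb; have := @rem_bound z b M zb 1; rewrite lexx ler01 => /(_ isT).
have natc (m : nat) : (m`!%:R : C) = (m`!%:R : R)%:C by rewrite rmorph_nat.
have E f : {morph f : x y / x + y} -> (forall (t : R) x, f (t%:C * x) = t * f x) ->
    f (cexp z - \sum_(m < M) z ^+ m / m`!%:R) = rem f z M 1.
  move=> fD fZ; have fN x : f (- x) = - f x.
    by have := fZ (-1) x; rewrite rmorphN1 !mulN1r.
  rewrite fD fN /rem mul1r; congr (_ - _).
  elim: (M) => [|m IH]; first by rewrite !big_ord0 -[0](mul0r (1 : C)) (fZ 0) mul0r.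
  by rewrite !big_ord_recr /= fD IH expr1n mulr1 natc -fmorphV mulrC fZ mulrC.
rewrite -!E; [|exact: ImD|exact: Im_realM|exact: ReD|exact: Re_realM].
rewrite expr1n -mulrA [1 / _ in X in X /\ _]mul1r [1 / _ in X in _ /\ X]mul1r => -[h1 h2].
exact: normc_le_ReIm.
Qed.

End ComplexExponential.

Section CauchyCoefficients.
Context {R : realType}.
Local Notation C := (complex R).
Local Notation normc := (@ComplexField.Normc.normc R).
Variable rho : R.
Hypothesis rho01 : 0 < rho < 1.
Implicit Types (h : R -> C) (P : {poly C}) (z w : C) (t b e tau : R).
Local Open Scope complex_scope.

Let rho0 : 0 < rho. Proof. by case/andP: rho01. Qed.
Let rho1 : rho < 1. Proof. by case/andP: rho01. Qed.

Definition circ t : C := rho%:C * cis t.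

Lemma circ_neq0 t : circ t != 0.
Proof.
by rewrite /circ mulf_neq0// ?cis_neq0// eq_complex /= eqxx andbT gt_eqF.
Qed.

Lemma normc_circ t : normc (circ t) = rho.
Proof.
rewrite /circ ComplexField.Normc.normcM normc_cis mulr1 /= expr0n addr0 sqrtr_sqr.
by rewrite gtr0_norm.
Qed.

Lemma normcX z k : normc (z ^+ k) = normc z ^+ k.
Proof.
elim: k => [|k IH]; first by rewrite !expr0 ComplexField.Normc.normc1.
by rewrite !exprS ComplexField.Normc.normcM IH.
Qed.

Lemma normc_ge0 z : 0 <= normc z.
Proof. exact: le_trans (normr_ge0 _) (Re_le_normc z). Qed.

Lemma ccontinuous_circ : ccontinuous circ.
Proof. exact: ccontinuousM (ccontinuous_cst _) ccontinuous_cis. Qed.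

Lemma ccontinuous_horner P : ccontinuous (fun t => P.[circ t]).
Proof.
under eq_fun do rewrite horner_coef.
apply: ccontinuous_sum => i; apply: ccontinuousM; first exact: ccontinuous_cst.
exact/ccontinuousX/ccontinuous_circ.
Qed.

Lemma circ1_neq0 t : 1 + circ t != 0.
Proof.
apply/eqP => /(congr1 (fun z => normc (z - 1))).
rewrite addrC addKr normc_circ sub0r => E.
have := @Re_le_normc _ (-1 : C); rewrite -E /= normrN normr1 => /le_lt_trans /(_ rho1).
by rewrite ltxx.
Qed.

Lemma ccontinuous_divX h k : ccontinuous h -> ccontinuous (fun t => h t / circ t ^+ k).
Proof.
move=> ch; apply: ccontinuousM => //; apply: ccontinuousV.
  by move=> t; rewrite expf_neq0// circ_neq0.
exact/ccontinuousX/ccontinuous_circ.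
Qed.

Let two_pi : C := (2 * pi : R)%:C.

Lemma mean_circX m k :
  mean (fun t => circ t ^+ m / circ t ^+ k) = (m == k)%:R * two_pi.
Proof.
have cX k' : ccontinuous (fun t : R => cis t ^+ k') by exact/ccontinuousX/ccontinuous_cis.
have cVX k' : ccontinuous (fun t : R => cis t ^- k').
  by apply: ccontinuousV => // t; rewrite expf_neq0// cis_neq0.
have -> : (fun t => circ t ^+ m / circ t ^+ k) =
    (fun t => rho%:C ^+ m / rho%:C ^+ k * (cis t ^+ m / cis t ^+ k)).
  by apply/funext => t; rewrite /circ !exprMn invfM mulrACA.
have rC : rho%:C != 0 :> C by rewrite eq_complex /= eqxx andbT gt_eqF.
case: (ltngtP m k) => mk.
- rewrite mul0r; have -> : (fun t : R => rho%:C ^+ m / rho%:C ^+ k * (cis t ^+ m / cis t ^+ k)) =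
    (fun t => rho%:C ^+ m / rho%:C ^+ k * (cis t ^- (k - m))).
    apply/funext => t; congr (_ * _); rewrite -{1}(subnKC (ltnW mk)) exprD invfM mulrA divff ?mul1r//.
    by rewrite expf_neq0// cis_neq0.
  by rewrite meanZ// mean_cisVX ?mulr0// subn_gt0.
- rewrite mul0r; have -> : (fun t : R => rho%:C ^+ m / rho%:C ^+ k * (cis t ^+ m / cis t ^+ k)) =
    (fun t => rho%:C ^+ m / rho%:C ^+ k * (cis t ^+ (m - k))).
    apply/funext => t; congr (_ * _); rewrite -{1}(subnK (ltnW mk)) exprD mulfK//.
    by rewrite expf_neq0// cis_neq0.
  by rewrite meanZ// mean_cisX ?mulr0// subn_gt0.
- rewrite mk mul1r divff ?expf_neq0//.
  rewrite (_ : (fun=> _) = (fun=> 1)) ?mean_cst ?mul1r//.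
  by apply/funext => t; rewrite divff ?mulr1// expf_neq0// cis_neq0.
Qed.

Lemma mean_poly P k : mean (fun t => P.[circ t] / circ t ^+ k) = P`_k * two_pi.
Proof.
under eq_fun do rewrite horner_coef big_distrl /=.
have cE (i : 'I_(size P)) : ccontinuous (fun t => P`_i * (circ t ^+ i / circ t ^+ k)).
  apply: ccontinuousM; first exact: ccontinuous_cst.
  exact/ccontinuous_divX/ccontinuousX/ccontinuous_circ.
under eq_fun do under eq_bigr do rewrite -mulrA.
rewrite mean_sum//.
rewrite (eq_bigr (fun i : 'I_(size P) => P`_i * ((i == k :> nat)%:R * two_pi))); last first.
  move=> i _; rewrite meanZ ?mean_circX//.
  exact/ccontinuous_divX/ccontinuousX/ccontinuous_circ.
have [kP|Pk] := ltnP k (size P); last first.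
  rewrite nth_default// mul0r big1// => i _.
  by rewrite (ltn_eqF (leq_trans (ltn_ord i) Pk)) mul0r mulr0.
rewrite (bigD1 (Ordinal kP))//= eqxx mul1r big1 ?addr0// => i ik.
by rewrite (_ : (i == k :> nat) = false) ?mul0r ?mulr0//; apply/negbTE.
Qed.

(** The coefficient of order [k] is kept fixed along the approximation, and is then the value of
    the Cauchy integral of order [k] in the limit. *)
Definition poly_approx (k : nat) (c : C) h :=
  forall e, 0 < e -> exists2 P : {poly C}, P`_k = c & forall t, normc (h t - P.[circ t]) <= e.

Lemma mean_poly_approx h k c : ccontinuous h -> poly_approx k c h ->
  mean (fun t => h t / circ t ^+ k) = c * two_pi.
Proof.
move=> ch ah; apply/subr0_eq/ComplexField.Normc.eq0_normc/le_anti.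
rewrite normc_ge0 andbT; apply/ler_addgt0Pl => e e0; rewrite addr0.
have pp : 0 < 2 * (2 * pi) / rho ^+ k.
  by rewrite divr_gt0 ?exprn_gt0// !mulr_gt0// pi_gt0.
have [P <- hP] := ah (e / (2 * (2 * pi) / rho ^+ k)) (divr_gt0 e0 pp).
rewrite -mean_poly -[X in _ - X]mul1r -mulNr -meanZ; last exact/ccontinuous_divX/ccontinuous_horner.
rewrite -meanD; [|exact: ccontinuous_divX|]; last first.
  by apply: ccontinuousM; [exact: ccontinuous_cst|exact/ccontinuous_divX/ccontinuous_horner].
apply: le_trans (_ : 2 * (e / (2 * (2 * pi) / rho ^+ k) / rho ^+ k * (2 * pi)) <= _).
  apply: mean_bound => [|t].
    apply: ccontinuousD; first exact: ccontinuous_divX.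
    by apply: ccontinuousM; [exact: ccontinuous_cst|exact/ccontinuous_divX/ccontinuous_horner].
  rewrite mulN1r -mulrBl ComplexField.Normc.normcM ComplexField.Normc.normcV normcX normc_circ.
  by rewrite ler_wpM2r// invr_ge0 exprn_ge0// ltW.
rewrite le_eqVlt; apply/orP; left; apply/eqP.
have r0 : rho ^+ k != 0 by rewrite expf_neq0// gt_eqF.
have p0 : pi != 0 :> R by rewrite gt_eqF// pi_gt0.
move: (rho ^+ k) (pi : R) r0 p0 => x y x0 y0.
by field; rewrite x0 y0.
Qed.

(** Uniform limits on the circle of polynomials form an algebra; Cauchy's
    theorem for them is inherited from polynomials. *)
Definition poly_limit h := (exists b, forall t, normc (h t) <= b) /\
  forall e, 0 < e -> exists P, forall t, normc (h t - P.[circ t]) <= e.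

Lemma poly_limitM h1 h2 : poly_limit h1 -> poly_limit h2 ->
  poly_limit (fun t => h1 t * h2 t).
Proof.
move=> [[b1 hb1] a1] [[b2 hb2] a2]; split.
  exists (b1 * b2) => t; rewrite ComplexField.Normc.normcM.
  by rewrite ler_pM ?normc_ge0.
have b10 := le_trans (normc_ge0 _) (hb1 0); have b20 := le_trans (normc_ge0 _) (hb2 0).
move=> e e0; pose d := Num.min 1 (e / (b1 + b2 + 1)).
have s0 : 0 < b1 + b2 + 1 by lra.
have d0 : 0 < d by rewrite lt_min ltr01 divr_gt0.
have [P1 hP1] := a1 d d0; have [P2 hP2] := a2 d d0.
exists (P1 * P2) => t; rewrite hornerM.
have -> : h1 t * h2 t - P1.[circ t] * P2.[circ t] =
   h1 t * (h2 t - P2.[circ t]) + (h1 t - P1.[circ t]) * P2.[circ t] by ring.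
apply: le_trans (le_normcD _ _) _; rewrite !ComplexField.Normc.normcM.
have nP2 : normc P2.[circ t] <= b2 + 1.
  rewrite -(subrK (h2 t) P2.[circ t]) addrC; apply: le_trans (le_normcD _ _) _.
  rewrite lerD// -normcN opprB; apply: le_trans (hP2 t) _.
  by rewrite ge_min lexx.
apply: le_trans (_ : b1 * d + d * (b2 + 1) <= _).
  by rewrite lerD// ler_pM ?normc_ge0.
have -> : b1 * d + d * (b2 + 1) = d * (b1 + b2 + 1) by ring.
by rewrite -ler_pdivlMr// ge_min lexx orbT.
Qed.

Lemma poly_limit1 : poly_limit (fun=> 1).
Proof.
split; first by exists 1 => t; rewrite ComplexField.Normc.normc1.
by move=> e e0; exists 1 => t; rewrite hornerE subrr ComplexField.Normc.normc0 ltW.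
Qed.

Lemma poly_limit_exp h k : poly_limit h -> poly_limit (fun t => h t ^+ k).
Proof.
move=> lh; elim: k => [|k IH]; first exact: poly_limit1.
by under eq_fun do rewrite exprS; exact: poly_limitM.
Qed.

(** The geometric series, which converges uniformly on the circle as its radius is less than 1. *)
Lemma poly_limit_inv1 : poly_limit (fun t => (1 + circ t)^-1).
Proof.
have lb t : 1 - rho <= normc (1 + circ t).
  have := le_normcD (1 + circ t) (- circ t); rewrite addrK ComplexField.Normc.normc1.
  by rewrite normcN normc_circ lerBlDr.
have r10 : 0 < 1 - rho by rewrite subr_gt0.
split.
  exists (1 - rho)^-1 => t; rewrite ComplexField.Normc.normcV lef_pV2 ?posrE//.
  exact: lt_le_trans (lb t).
move=> e e0.
have [M hM] : exists M, rho ^+ M <= e * (1 - rho).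
  have := @cvg_expr R rho; rewrite ger0_norm ?(ltW rho0)// => /(_ rho1).
  move=> /cvgrPdist_le /(_ (e * (1 - rho))); rewrite mulr_gt0// => /(_ isT)[M _ HM].
  exists M; have := HM M (leqnn M).
  by rewrite sub0r normrN ger0_norm// exprn_ge0// ltW.
exists (\sum_(m < M) (- 'X) ^+ m) => t.
have -> : (1 + circ t)^-1 - (\sum_(m < M) (- 'X) ^+ m).[circ t] =
   (- circ t) ^+ M / (1 + circ t).
  apply: (mulIf (circ1_neq0 t)); rewrite mulrBl mulVf ?circ1_neq0// mulfVK ?circ1_neq0//.
  rewrite horner_sum; under eq_bigr do rewrite horner_exp hornerN hornerX.
  by have := subrX1 (- circ t) M; rewrite -[1 + _]opprK opprD [- 1 - _]addrC mulrN mulrC => <-; ring.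
rewrite ComplexField.Normc.normcM ComplexField.Normc.normcV normcX normcN normc_circ.
rewrite ler_pdivrMr; last exact: lt_le_trans (lb t).
by apply: le_trans hM _; rewrite ler_wpM2l// ltW.
Qed.

Let cexp_poly tau M : {poly C} := \poly_(m < M) ((- tau)%:C ^+ m / m`!%:R).

Let cexp_circ_approx tau e : 0 < e -> exists M0, forall M, (M0 <= M)%N -> forall t,
  normc (cexp (- (circ t * tau%:C)) - (cexp_poly tau M).[circ t]) <= e.
Proof.
move=> e0; pose b := rho * `|tau|.
have : 2 * (expR b * ((2 * b) ^+ M / M`!%:R)) @[M --> \oo] --> (0 : R).
  rewrite -(mulr0 2); apply: cvgM; first exact: cvg_cst.
  rewrite -(mulr0 (expR b)); apply: cvgM; first exact: cvg_cst.
  exact: (cvg_series_cvg_0 (is_cvg_series_exp_coeff (2 * b))).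
move=> /cvgrPdist_le /(_ e e0)[M0 _ HM]; exists M0 => M /HM; rewrite sub0r normrN => hM t.
apply: le_trans (le_trans (ler_norm _) hM).
have E : (cexp_poly tau M).[circ t] = \sum_(m < M) (- (circ t * tau%:C)) ^+ m / m`!%:R.
  rewrite horner_poly; apply: eq_bigr => m _.
  have -> : - (circ t * tau%:C) = (- tau)%:C * circ t by rewrite rmorphN mulNr mulrC.
  by rewrite [in RHS]exprMn; exact: mulrAC.
rewrite E; apply: cexp_taylor.
by rewrite normcN ComplexField.Normc.normcM normc_circ /= expr0n addr0 sqrtr_sqr.
Qed.

Lemma poly_limit_cexp tau : poly_limit (fun t => cexp (- (circ t * tau%:C))).
Proof.
split; last first.
  by move=> e e0; have [M HM] := cexp_circ_approx tau e0; exists (cexp_poly tau M); exact: HM.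
exists (expR (rho * `|tau|)) => t; set z := - _.
rewrite /cexp ComplexField.Normc.normcM (normc_cis (complex.Im z)) mulr1 /=.
rewrite expr0n addr0 sqrtr_sqr ger0_norm ?expR_ge0// ler_expR.
apply: le_trans (ler_norm _) (le_trans (Re_le_normc z) _).
by rewrite normcN ComplexField.Normc.normcM normc_circ /= expr0n addr0 sqrtr_sqr.
Qed.

Let hfun tau r t := (1 + circ t) ^- r * cexp (- (circ t * tau%:C)).

Let ccontinuous_cexp tau : ccontinuous (fun t => cexp (- (circ t * tau%:C))).
Proof.
have [c1 c2] : ccontinuous (fun t => - (circ t * tau%:C)).
  exact/ccontinuousN/ccontinuousM/ccontinuous_cst/ccontinuous_circ.
split=> t.
  under eq_fun do rewrite Re_cexp.
  apply: (@cvgM _ _ _ _ _ _ _ _ _ _); apply: continuous_comp (c1 t) _ || apply: continuous_comp (c2 t) _.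
    exact: continuous_expR.
  exact: continuous_cos.
under eq_fun do rewrite Im_cexp.
apply: (@cvgM _ _ _ _ _ _ _ _ _ _); apply: continuous_comp (c1 t) _ || apply: continuous_comp (c2 t) _.
  exact: continuous_expR.
exact: continuous_sin.
Qed.

Let ccontinuous_hfun tau r : ccontinuous (hfun tau r).
Proof.
apply: ccontinuousM; last exact: ccontinuous_cexp.
apply: ccontinuousV => [t|]; first by rewrite expf_neq0// circ1_neq0.
apply/ccontinuousX/ccontinuousD; [exact: ccontinuous_cst|exact: ccontinuous_circ].
Qed.

(* A function that is a uniform limit of polynomials without constant term. *)
Let mean_hfunM tau r k : (0 < k)%N -> mean (fun t => hfun tau r t * circ t ^+ k) = 0.
Proof.
move=> k0; rewrite -(mul0r two_pi) -(mean_poly_approx (k := 0) (h := fun t => hfun tau r t * circ t ^+ k)).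
- by congr mean; apply/funext => t; rewrite expr0 divr1.
- exact/ccontinuousM/ccontinuousX/ccontinuous_circ.
move=> e e0; have [_ lim] : poly_limit (hfun tau r).
  apply: poly_limitM; last exact: poly_limit_cexp.
  by under eq_fun do rewrite -exprVn; exact/poly_limit_exp/poly_limit_inv1.
have rk : 0 < rho ^+ k by rewrite exprn_gt0.
have [P HP] := lim (e / rho ^+ k) (divr_gt0 e0 rk).
exists (P * 'X^k); first by rewrite coefMXn k0.
move=> t; rewrite hornerM hornerXn -mulrBl ComplexField.Normc.normcM normcX normc_circ.
by rewrite -ler_pdivlMr.
Qed.

(** The coefficient of w ^ p in the expansion of (1 + w)^-r exp(- tau w): multiplication of the
    series for r + 1 by 1 + w gives the series for r. *)
Fixpoint taylor_coef tau (r p : nat) {struct r} : R :=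
  if r is r'.+1 then
    (fix tc p := if p is p'.+1 then taylor_coef tau r' p'.+1 - tc p'
                 else taylor_coef tau r' 0) p
  else (- tau) ^+ p / p`!%:R.

Lemma taylor_coef0 tau p : taylor_coef tau 0 p = (- tau) ^+ p / p`!%:R.
Proof. by []. Qed.

Lemma taylor_coefS0 tau r : taylor_coef tau r.+1 0 = taylor_coef tau r 0.
Proof. by []. Qed.

Lemma taylor_coefSS tau r p :
  taylor_coef tau r.+1 p.+1 = taylor_coef tau r p.+1 - taylor_coef tau r.+1 p.
Proof. by []. Qed.

(* Double induction following the recursion of the coefficients; the vanishing of the integrals
   without pole starts the inner one. *)
Let mean_hfun tau r p :
  mean (fun t => hfun tau r t / circ t ^+ p) = (taylor_coef tau r p)%:C * two_pi.
Proof.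
elim: r p => [|r IH] p.
  apply: mean_poly_approx; first exact: ccontinuous_hfun.
  move=> e e0; have [M0 HM] := cexp_circ_approx tau e0.
  exists (cexp_poly tau (maxn M0 p.+1)).
    rewrite coef_poly leq_max ltnSn orbT /=.
    by rewrite rmorphM /= fmorphV /= rmorph_nat rmorphXn.
  by move=> t; rewrite /hfun expr0 invr1 mul1r; apply: HM; rewrite leq_maxl.
have split_h t : hfun tau r t = hfun tau r.+1 t + hfun tau r.+1 t * circ t.
  have -> : hfun tau r t = (1 + circ t) ^- r.+1 * (1 + circ t) * cexp (- (circ t * tau%:C)).
    by rewrite exprSr invfM mulfVK ?circ1_neq0.
  by rewrite /hfun; ring.
elim: p => [|p IHp].
  rewrite taylor_coefS0 -IH; apply/esym.
  under eq_fun do rewrite split_h mulrDl.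
  rewrite meanD; [|exact/ccontinuous_divX|]; last first.
    exact/ccontinuous_divX/ccontinuousM/ccontinuous_circ.
  rewrite [X in _ + X](_ : _ = 0) ?addr0//.
  rewrite -(@mean_hfunM tau r.+1 1%N)//; congr mean; apply/funext => t.
  by rewrite expr0 divr1 expr1.
rewrite taylor_coefSS rmorphB mulrBl -IH -IHp; apply/eqP; rewrite -subr_eq opprK; apply/eqP/esym.
under eq_fun do rewrite split_h mulrDl.
rewrite meanD; [|exact/ccontinuous_divX|]; last first.
  exact/ccontinuous_divX/ccontinuousM/ccontinuous_circ.
congr (_ + _); congr mean; apply/funext => t.
by rewrite exprS invfM mulrA mulfK// circ_neq0.
Qed.

(** The one-variable factor of the integrand, with the power [m] of z - 1 contributed by the
    Vandermonde determinants. *)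
Definition entry_fun n r tau m (z : C) : C :=
  (z - 1) ^+ m * z ^- r * (cexp (- (z * tau%:C)) / (1 - z) ^+ n).

Let circle_param_eq n r tau m t :
  entry_fun n r tau m (1 + rho%:C * cexp (0 +i* t)) * ('i%C * rho%:C * cexp (0 +i* t)) =
  ('i%C * ((expR (- tau))%:C * (-1) ^+ n)) * (hfun tau r t * (circ t ^+ m.+1 / circ t ^+ n)).
Proof.
rewrite cexp_imag -mulrA -/(circ t) /entry_fun [1 + _ - 1]addrC addKr opprD addrA subrr add0r.
rewrite mulrDl mul1r opprD cexpD -rmorphN cexp_real [(- circ t) ^+ n]exprNn /hfun exprS invfM.
rewrite (_ : ((-1) ^+ n)^-1 = (-1) ^+ n); last by rewrite -exprVn invrN1.
ring.
Qed.

Definition entry_val n r tau m : R :=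
  if (m < n)%N then taylor_coef tau r (n - m.+1) else 0.

Lemma ccontinuous_entry n r tau m : ccontinuous (fun t =>
  entry_fun n r tau m (1 + rho%:C * cexp (0 +i* t)) * ('i%C * rho%:C * cexp (0 +i* t))).
Proof.
under eq_fun do rewrite circle_param_eq.
apply: ccontinuousM; first exact: ccontinuous_cst.
apply: ccontinuousM => //; exact/ccontinuous_divX/ccontinuousX/ccontinuous_circ.
Qed.

(** Cauchy with w = z - 1: the pole at w = 0 has order n - m. *)
Lemma circle_integral_entry n r tau m : circle_integral rho (entry_fun n r tau m) =
  (2 * pi%:C * 'i%C) * ((expR (- tau) * (-1) ^+ n * entry_val n r tau m)%:C).
Proof.
rewrite -[LHS]/(mean (fun t => entry_fun n r tau m (1 + rho%:C * cexp (0 +i* t)) *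
  ('i%C * rho%:C * cexp (0 +i* t)))).
under eq_fun do rewrite circle_param_eq.
rewrite meanZ; last first.
  by apply: ccontinuousM => //; exact/ccontinuous_divX/ccontinuousX/ccontinuous_circ.
have -> : mean (fun t => hfun tau r t * (circ t ^+ m.+1 / circ t ^+ n)) =
   (entry_val n r tau m)%:C * two_pi.
  rewrite /entry_val; case: ltnP => mn.
    rewrite -mean_hfun; congr mean; apply/funext => t; congr (_ * _).
    rewrite -{1}(subnKC mn) exprD invfM mulrA divff ?mul1r//.
    by rewrite expf_neq0// circ_neq0.
  rewrite mul0r -(@mean_hfunM tau r (m.+1 - n)) ?subn_gt0//.
  congr mean; apply/funext => t; congr (_ * _).
  by rewrite -{1}(subnK (leqW mn)) exprD mulfK// expf_neq0// circ_neq0.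
rewrite /two_pi !rmorphM /= rmorphXn /= rmorphN1 rmorph_nat; ring.
Qed.

End CauchyCoefficients.

Section IteratedContour.
Context {R : realType}.
Local Notation C := (complex R).
Variable rho : R.
Hypothesis rho01 : 0 < rho < 1.
Implicit Types (tau : R) (zs : seq C).
Local Open Scope complex_scope.

Lemma eq_contour_integral r (f g : seq C -> C) :
  (forall zs, size zs = r -> f zs = g zs) ->
  contour_integral rho r f = contour_integral rho r g.
Proof.
elim: r f g => [|r IH] f g fg; first exact: fg.
rewrite /=; congr circle_integral; apply/funext => z.
by apply: IH => zs sz; apply: fg; rewrite /= sz.
Qed.

Definition contour_continuous (f : C -> C) := ccontinuous (fun t : R =>
  f (1 + rho%:C * cexp (0 +i* t)) * ('i%C * rho%:C * cexp (0 +i* t))).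

Lemma circle_integral_sum (I : finType) (c : I -> C) (f : I -> C -> C) :
  (forall i, contour_continuous (f i)) ->
  circle_integral rho (fun z => \sum_i c i * f i z) =
  \sum_i c i * circle_integral rho (f i).
Proof.
move=> cf; pose w t := 'i%C * rho%:C * cexp (0 +i* t).
pose p t := 1 + rho%:C * cexp (0 +i* t).
rewrite -[LHS]/(mean (fun t => (\sum_i c i * f i (p t)) * w t)).
under eq_fun do rewrite big_distrl /=.
under eq_fun do under eq_bigr do rewrite -mulrA.
rewrite mean_sum => [|i].
  by apply: eq_bigr => i _; rewrite meanZ//; exact: cf.
apply: ccontinuousM; [exact: ccontinuous_cst|exact: cf].
Qed.

(** Fubini for finite sums of products of one-variable functions. *)
Lemma contour_integral_sum_prod r (I : finType) (c : I -> C)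
    (f : I -> nat -> C -> C) : (forall i k, contour_continuous (f i k)) ->
  contour_integral rho r (fun zs => \sum_i c i * \prod_(k < r) f i k zs`_k) =
  \sum_i c i * \prod_(k < r) circle_integral rho (f i k).
Proof.
elim: r c f => [|r IH] c f cf.
  by rewrite /=; apply: eq_bigr => i _; rewrite !big_ord0.
transitivity (circle_integral rho (fun z => \sum_i
   (c i * \prod_(k < r) circle_integral rho (f i k.+1)) * f i 0 z)).
  rewrite /=; congr circle_integral; apply/funext => z.
  transitivity (contour_integral rho r (fun zs => \sum_i (c i * f i 0 z) *
     \prod_(k < r) f i k.+1 zs`_k)).
    apply: eq_contour_integral => zs _; apply: eq_bigr => i _.
    by rewrite big_ord_recl /= mulrA.
  rewrite (IH _ (fun i k => f i k.+1))//.
  by apply: eq_bigr => i _; rewrite mulrAC.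
rewrite circle_integral_sum//; apply: eq_bigr => i _.
by rewrite big_ord_recl /= -mulrA; congr (_ * _); rewrite mulrC.
Qed.

(* The Vandermonde determinant is invariant under the shift z = 1 + w. *)
Let vandermonde_sqr r (z : nat -> C) :
  \prod_(l < r) \prod_(k < r | (k < l)%N) (z k - z l) ^+ 2 =
  \sum_(s : ('S_r * 'S_r)%type) ((-1) ^+ s.1 * (-1) ^+ s.2) *
     \prod_(k < r) (z k - 1) ^+ (s.1 k + s.2 k).
Proof.
have V : \det (Vandermonde r (\row_(j < r) (z j - 1))) =
    \prod_(i < r) \prod_(j < r | (i < j)%N) (z j - z i).
  rewrite det_Vandermonde; apply: eq_bigr => i _; apply: eq_bigr => j _.
  by rewrite !mxE; ring.
have D : \det (Vandermonde r (\row_(j < r) (z j - 1))) =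
   \sum_(s : 'S_r) (-1) ^+ s * \prod_(k < r) (z k - 1) ^+ s k.
  rewrite -det_tr; apply: eq_bigr => s _; congr (_ * _).
  by apply: eq_bigr => k _; rewrite !mxE.
transitivity (\det (Vandermonde r (\row_(j < r) (z j - 1))) ^+ 2).
  rewrite V (exchange_big_dep xpredT)//= -prodrXl; apply: eq_bigr => i _.
  rewrite -prodrXl; apply: eq_bigr => j _.
  by rewrite -sqrrN opprB.
rewrite expr2 D big_distrl /=; under eq_bigr do rewrite big_distrr /=.
rewrite pair_big /=; apply: eq_bigr => -[s s'] _ /=.
rewrite mulrACA; congr (_ * _); rewrite -big_split; apply: eq_bigr => k _ /=.
by rewrite exprD.
Qed.

(* For each of the first permutations, the sum over the second one is the determinant with rows
   permuted, the sign of which cancels. *)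
Let andreief_det r (b : nat -> C) :
  \sum_(s : ('S_r * 'S_r)%type) ((-1) ^+ s.1 * (-1) ^+ s.2) * \prod_(k < r) b (s.1 k + s.2 k)%N =
  r`!%:R * \det (\matrix_(i < r, j < r) b (i + j)%N).
Proof.
set B := \matrix_(i, j) _.
rewrite -(pair_big xpredT xpredT (fun s s' : 'S_r =>
  ((-1) ^+ s * (-1) ^+ s') * \prod_(k < r) b (s k + s' k)%N)) /=.
rewrite (eq_bigr (fun=> \det B)); last first.
  move=> s _; under eq_bigr do rewrite -mulrA; rewrite -big_distrr /=.
  have -> : \sum_(s' : 'S_r) (-1) ^+ s' * \prod_(k < r) b (s k + s' k)%N = \det (row_perm s B).
    by apply: eq_bigr => s' _; congr (_ * _); apply: eq_bigr => k _; rewrite !mxE.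
  by rewrite row_permE det_mulmx det_perm mulrA -signr_addb addbb mul1r.
by rewrite sumr_const card_Sn mulr_natl.
Qed.

(** Andreief's identity turns the multiple integral into a Hankel determinant of simple ones. *)
Lemma contour_integral_frakF n r tau : contour_integral rho r (frakF n r tau) =
  ((-1) ^+ (r * r.+1)./2 *
   \det (\matrix_(i < r, j < r) (expR (- tau) * (-1) ^+ n * entry_val n r tau (i + j))))%:C.
Proof.
pose K : C := (-1) ^+ (r * r.+1)./2 / ((2 * pi%:C * 'i%C) ^+ r * r`!%:R).
(* The exponents have to be a function of a natural number; the default value 0 is not reached. *)
transitivity (contour_integral rho r (fun zs => \sum_(s : ('S_r * 'S_r)%type)
   (K * ((-1) ^+ s.1 * (-1) ^+ s.2)) * \prod_(k < r) entry_fun n r tau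
     (if insub (k : nat) is Some k' then (s.1 k' + s.2 k')%N else 0%N) zs`_k)).
  apply: eq_contour_integral => zs _; rewrite /frakF (vandermonde_sqr r (nth 0 zs)).
  set S := \sum_s _.
  transitivity (K * (S * (\prod_(k < r) (zs`_k ^+ r)^-1 *
      \prod_(k < r) (cexp (- (zs`_k * tau%:C)) / (1 - zs`_k) ^+ n)))).
    rewrite /K prodfV [(_ * \prod_(k < r) _)^-1]invfM.
    by rewrite -!mulrA; congr (_ * _); rewrite mulrCA.
  rewrite /S big_distrl big_distrr /=; apply: eq_bigr => s _.
  rewrite -!mulrA; congr (_ * (_ * (_ * _))); rewrite -!big_split /=.
  congr (_ * _); apply: eq_bigr => k _; rewrite valK /entry_fun.
  exact: mulrA.
rewrite (@contour_integral_sum_prod r _ (fun s : ('S_r * 'S_r)%type => K * ((-1) ^+ s.1 * (-1) ^+ s.2))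
  (fun s k => entry_fun n r tau (if insub k is Some k' then (s.1 k' + s.2 k')%N else 0%N))); last first.
  by move=> s k; exact: ccontinuous_entry.
under eq_bigr => s _.
  rewrite -mulrA.
  under eq_bigr => k _ do rewrite circle_integral_entry// valK.
  over.
rewrite -big_distrr /= (andreief_det r (fun m => 2 * pi%:C * 'i%C * (expR (- tau) * (-1) ^+ n * entry_val n r tau m)%:C)).
have pii : 2 * pi%:C * 'i%C != 0 :> C.
  rewrite !mulf_neq0 ?pnatr_eq0//.
    by rewrite eq_complex /= eqxx andbT gt_eqF// pi_gt0.
  by rewrite eq_complex /= oner_eq0 andbF.
have rf : r`!%:R != 0 :> C by rewrite pnatr_eq0 -lt0n fact_gt0.
have -> : \matrix_(i < r, j < r) (2 * pi%:C * 'i%C *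
    (expR (- tau) * (-1) ^+ n * entry_val n r tau (i + j))%:C) =
  (2 * pi%:C * 'i%C) *: map_mx (real_complex R)
    (\matrix_(i < r, j < r) (expR (- tau) * (-1) ^+ n * entry_val n r tau (i + j))).
  by apply/matrixP => i j; rewrite !mxE.
rewrite detZ det_map_mx /= rmorphM /= rmorphXn rmorphN1 /K.
move: ((_ * 'i%C) ^+ r) (expf_neq0 r pii) (r`!%:R) rf => x x0 y y0.
by field; rewrite x0 y0.
Qed.

End IteratedContour.

(** * Large-time asymptotics *)

Section BigO.
Context {R : realType}.
Implicit Types (f g : R -> R) (c d e t u : R).

(** f t = c + O(1 / t) as t tends to infinity. *)
Definition tends_inv f c := exists K t0, 0 < t0 /\ forall t, t0 <= t -> `|f t - c| <= K / t.

Lemma tends_inv_shift f c : tends_inv f c -> forall u,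
  exists K t0, [/\ 0 <= K, 0 < t0, u <= t0 & forall t, t0 <= t -> `|f t - c| <= K / t].
Proof.
move=> [K [t0 [t00 H]]] u; exists K, (Num.max t0 u); split.
- have := le_trans (normr_ge0 _) (H _ (lexx t0)).
  by rewrite pmulr_lge0// invr_gt0.
- by rewrite lt_max t00.
- by rewrite le_max lexx orbT.
- by move=> t; rewrite ge_max => /andP[/H].
Qed.

Lemma tends_inv_cst c : tends_inv (fun=> c) c.
Proof. by exists 0, 1; split=> // t _; rewrite subrr normr0 mul0r. Qed.

Lemma tends_inv_eq f g c : (exists t0, forall t, t0 <= t -> f t = g t) ->
  tends_inv f c -> tends_inv g c.
Proof.
move=> [u fg] /tends_inv_shift /(_ u)[K [t0 [K0 t00 ut H]]]; exists K, t0; split=> // t tt.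
by rewrite -fg ?H// (le_trans ut).
Qed.

Lemma tends_invD f g c d : tends_inv f c -> tends_inv g d ->
  tends_inv (fun t => f t + g t) (c + d).
Proof.
move=> [K [u [u0 Hf]]] /tends_inv_shift /(_ u)[L [t0 [L0 t00 ut Hg]]].
exists (K + L), t0; split=> // t tt; rewrite opprD addrACA mulrDl.
by apply: le_trans (ler_normD _ _) _; rewrite lerD ?Hg ?Hf// (le_trans ut).
Qed.

Lemma tends_invM f g c d : tends_inv f c -> tends_inv g d ->
  tends_inv (fun t => f t * g t) (c * d).
Proof.
move=> /tends_inv_shift /(_ 1)[K [u [K0 u0 u1 Hf]]] /tends_inv_shift /(_ u)[L [t0 [L0 t00 ut Hg]]].
exists (K * (`|d| + L) + `|c| * L), t0; split=> // t tt.
have -> : f t * g t - c * d = (f t - c) * g t + c * (g t - d) by ring.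
apply: le_trans (ler_normD _ _) _; rewrite !normrM mulrDl.
have tp : 0 < t by apply: lt_le_trans tt.
have t1 : 1 <= t by apply: le_trans tt; apply: le_trans ut.
have gb : `|g t| <= `|d| + L.
  rewrite -(subrK d (g t)) addrC; apply: le_trans (ler_normD _ _) _; rewrite lerD2l.
  apply: le_trans (Hg _ tt) _; rewrite ler_pdivrMr// ler_peMr//.
apply: lerD.
  by rewrite mulrAC ler_pM// Hf// (le_trans ut).
by rewrite -mulrA ler_wpM2l// Hg.
Qed.

Lemma tends_invN f c : tends_inv f c -> tends_inv (fun t => - f t) (- c).
Proof.
move=> H; have := tends_invM (tends_inv_cst (-1)) H; rewrite mulN1r.
by apply: tends_inv_eq; exists 0 => t _; rewrite mulN1r.
Qed.

Lemma tends_invB f g c d : tends_inv f c -> tends_inv g d ->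
  tends_inv (fun t => f t - g t) (c - d).
Proof. by move=> cf cg; apply: tends_invD cf (tends_invN cg). Qed.

Lemma tends_inv_inv : tends_inv (fun t => t^-1) 0.
Proof. by exists 1, 1; split=> // t t1; rewrite subr0 mul1r ger0_norm// invr_ge0 (le_trans _ t1). Qed.

Lemma tends_inv_gt f c d : tends_inv f c -> d < c -> exists t0, forall t, t0 <= t -> d < f t.
Proof.
move=> [K [u [u0 Hf]]] dc; pose e := c - d; have e0 : 0 < e by rewrite subr_gt0.
exists (Num.max u ((`|K| + 1) / e)) => t; rewrite ge_max => /andP[ut].
rewrite ler_pdivrMr// => Kt; have t0 := lt_le_trans u0 ut.
have : K / t < e.
  rewrite ltr_pdivrMr// mulrC; apply: lt_le_trans Kt.
  by rewrite ltr_pwDr// ler_norm.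
move/(le_lt_trans (Hf _ ut)); rewrite ltr_distl /e => /andP[+ _].
by rewrite subKr.
Qed.

Lemma tends_inv_lt f c d : tends_inv f c -> c < d -> exists t0, forall t, t0 <= t -> f t < d.
Proof.
move=> /tends_invN H cd; have [|t0 Ht] := tends_inv_gt H (d := - d); first by rewrite ltrN2.
by exists t0 => t /Ht; rewrite ltrN2.
Qed.

Lemma tends_invV f c : 0 < c -> tends_inv f c -> tends_inv (fun t => (f t)^-1) c^-1.
Proof.
move=> c0 H; have [u Hu] := @tends_inv_gt f c (c / 2) H ltac:(by rewrite ltr_pdivrMr// ltr_pMr// ltr1n).
have [K [t0 [K0 t00 ut Hf]]] := tends_inv_shift H u.
exists (K * (2 / c ^+ 2)), t0; split=> // t tt.
have ft : c / 2 < f t by apply: Hu; apply: le_trans tt.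
have f0 : 0 < f t by apply: lt_trans ft; rewrite divr_gt0.
have -> : (f t)^-1 - c^-1 = - (f t - c) * ((f t)^-1 * c^-1).
  by field; rewrite !gt_eqF.
rewrite normrM normrN mulrAC; apply: ler_pM => //; first exact: Hf.
rewrite ger0_norm; last by rewrite mulr_ge0// invr_ge0 ltW.
rewrite expr2 invfM mulrA ler_wpM2r ?invr_ge0 ?(ltW c0)//.
by rewrite -[2 / c]invrK invf_div lef_pV2 ?posrE ?divr_gt0// ltW.
Qed.

Lemma tends_inv_sqrt f : tends_inv f 1 -> tends_inv (fun t => Num.sqrt (f t)) 1.
Proof.
move=> H; have [u Hu] := tends_inv_gt H (ltr01 : 0 < 1).
have [K [t0 [K0 t00 ut Hf]]] := tends_inv_shift H u.
exists K, t0; split=> // t tt; apply: le_trans (Hf t tt).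
have f0 : 0 < f t by apply: Hu; apply: le_trans tt.
have -> : f t - 1 = (Num.sqrt (f t) - 1) * (Num.sqrt (f t) + 1).
  by rewrite -subr_sqr sqr_sqrtr ?(ltW f0)// expr1n.
rewrite normrM ler_peMr// ger0_norm ?addr_ge0 ?sqrtr_ge0//.
by rewrite lerDr sqrtr_ge0.
Qed.

Lemma tends_inv_sum (I : finType) (f : I -> R -> R) (c : I -> R) :
  (forall i, tends_inv (f i) (c i)) -> tends_inv (fun t => \sum_i f i t) (\sum_i c i).
Proof.
move=> H; elim: (index_enum I) => [|i s IH].
  by rewrite big_nil; under eq_fun do rewrite big_nil; exact: tends_inv_cst.
by rewrite big_cons; under eq_fun do rewrite big_cons; exact: tends_invD.
Qed.

Lemma tends_inv_prod (I : finType) (f : I -> R -> R) (c : I -> R) :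
  (forall i, tends_inv (f i) (c i)) -> tends_inv (fun t => \prod_i f i t) (\prod_i c i).
Proof.
move=> H; elim: (index_enum I) => [|i s IH].
  by rewrite big_nil; under eq_fun do rewrite big_nil; exact: tends_inv_cst.
by rewrite big_cons; under eq_fun do rewrite big_cons; exact: tends_invM.
Qed.

Lemma tends_inv_det r (A : R -> 'M[R]_r) (B : 'M[R]_r) :
  (forall i j, tends_inv (fun t => A t i j) (B i j)) ->
  tends_inv (fun t => \det (A t)) (\det B).
Proof.
move=> H; apply: tends_inv_sum => s; apply: tends_invM; first exact: tends_inv_cst.
exact: tends_inv_prod.
Qed.

Lemma tends_inv_expN k : tends_inv (fun t => expR (- t) * t ^+ k) 0.
Proof.
exists (k.+1`!%:R), 1; split=> // t t1; have t0 : 0 < t by apply: lt_le_trans t1.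
rewrite subr0 ger0_norm ?mulr_ge0 ?expR_ge0 ?exprn_ge0 ?(ltW t0)//.
rewrite expRN ler_pdivlMr// -mulrA -exprSr mulrC ler_pdivrMr ?expR_gt0//.
rewrite mulrC -ler_pdivrMr ?ltr0n ?fact_gt0//.
by apply: le_trans (expR_ge1Dxn k (ltW t0)); rewrite lerDr.
Qed.

End BigO.

Section Determinants.
Context {F : fieldType}.

Lemma det_scale_rc r (a b : 'I_r -> F) (M : 'M[F]_r) :
  \det (\matrix_(i, j) (a i * b j * M i j)) = (\prod_i a i) * (\prod_j b j) * \det M.
Proof.
rewrite big_distrr /=; apply: eq_bigr => s _; rewrite mulrCA; congr (_ * _).
rewrite [\prod_j b j](reindex_inj (@perm_inj _ s)) /= -!big_split /=.
by apply: eq_bigr => i _; rewrite mxE.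
Qed.

(** The change of basis from the monomials to the p_j is triangular with unit diagonal. *)
Lemma det_monic_eval r (x : 'I_r -> F) (p : nat -> {poly F}) :
  (forall j, size (p j) = j.+1) -> (forall j, p j \is monic) ->
  \det (\matrix_(i, j) (p j).[x i]) = \det (\matrix_(i, j < r) x i ^+ j).
Proof.
move=> sp mp.
have -> : \matrix_(i, j) (p j).[x i] =
    (\matrix_(i, k < r) x i ^+ k) *m (\matrix_(k, j < r) (p j)`_k).
  apply/matrixP => i j; rewrite !mxE (@horner_coef_wide _ r) ?sp//.
  by apply: eq_bigr => k _; rewrite !mxE mulrC.
rewrite det_mulmx -[X in _ * X]det_tr [X in _ * X]det_trig ?big1 ?mulr1//.
  by move=> i _; rewrite !mxE; have /monicP := mp i; rewrite lead_coefE sp.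
by apply/is_trig_mxP => i j ij; rewrite !mxE nth_default// sp.
Qed.

End Determinants.

Section HankelFactorial.
Context {R : realType}.

Let ffact_poly (j : nat) : {poly R} := \prod_(l < j) ('X - l%:R%:P).

Let ffact_polyE j m : (ffact_poly j).[m%:R] = (m ^_ j)%:R.
Proof.
elim: j => [|j IH]; first by rewrite /ffact_poly big_ord0 hornerE.
rewrite /ffact_poly big_ord_recr /= -/(ffact_poly j) hornerM IH ffactnSr natrM.
rewrite hornerXsubC; have [jm|mj] := leqP j m; first by rewrite natrB.
by rewrite ffact_small// !mul0r.
Qed.

(** Pulling the factors 1 / (n - 1 - i)! out of the rows leaves the falling factorials of order j
    at n - 1 - i: monic polynomials, so that the determinant is a Vandermonde determinant. *)
Lemma det_inv_fact n r : (r <= n)%N ->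
  `|\det (\matrix_(i < r, j < r)
     (if (i + j < n)%N then (-1) ^+ (n.-1 - (i + j)) / (n.-1 - (i + j))`!%:R else 0 : R))| =
  \prod_(i < r) (i`!%:R / (n.-1 - i)`!%:R).
Proof.
move=> rn; set A := \matrix_(i, j) _.
have f0 m : m`!%:R != 0 :> R by rewrite pnatr_eq0 -lt0n fact_gt0.
have -> : A = \matrix_(i < r, j < r) (((-1) ^+ (n.-1 + i) / (n.-1 - i)`!%:R) *
    ((-1) ^+ j) * (\matrix_(i < r, j < r) (ffact_poly j).[(n.-1 - i)%:R]) i j).
  apply/matrixP => i j; rewrite !mxE ffact_polyE.
  have n0 : (0 < n)%N by apply: leq_trans rn; apply: leq_ltn_trans (ltn_ord i).
  case: ifP => ijn.
    have ijn1 : (i + j <= n.-1)%N by rewrite -ltnS prednK.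
    have jn : (j <= n.-1 - i)%N by rewrite leq_subRL// (leq_trans (leq_addr _ _) ijn1).
    rewrite -(ffact_fact jn) natrM subnDA.
    have -> : (-1) ^+ (n.-1 - i - j) = (-1) ^+ (n.-1 + i) * (-1) ^+ j :> R.
      rewrite -exprD -signr_odd -[RHS]signr_odd; congr (_ ^+ _); congr nat_of_bool.
      rewrite -subnDA oddB// !oddD; by do 3 case: odd.
    have := f0 (n.-1 - i - j)%N; have : ((n.-1 - i) ^_ j)%:R != 0 :> R by rewrite pnatr_eq0 -lt0n ffact_gt0.
    move: (_%:R) (_%:R) => y x x0 y0.
    by rewrite invfM; field; rewrite x0 y0.
  rewrite ffact_small ?mulr0//.
  move/negbT: ijn; rewrite -leqNgt => ijn; rewrite ltn_subLR.
    by apply: leq_trans ijn; rewrite prednK.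
  by rewrite -ltnS prednK//; apply: leq_trans rn.
rewrite det_scale_rc det_monic_eval; first last.
- by move=> j; apply: monic_prod => l _; rewrite monicXsubC.
- by move=> j; rewrite size_prod_XsubC ?card_ord // /index_enum -enumT size_enum_ord.
have -> : \matrix_(i, j < r) (n.-1 - i)%:R ^+ j = (Vandermonde r (\row_(i < r) (n.-1 - i)%:R))^T :> 'M[R]_r.
  by apply/matrixP => i j; rewrite !mxE.
rewrite det_tr det_Vandermonde !normrM !normr_prod.
rewrite (eq_bigr (fun i : 'I_r => ((n.-1 - i)`!%:R)^-1 : R)); last first.
  by move=> i _; rewrite normrM normrX normrN1 expr1n mul1r ger0_norm.
rewrite [\prod_(i < r) `|_ ^+ _|]big1 ?mulr1; last by move=> i _; rewrite normrX normrN1 expr1n.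
rewrite big_split /= mulrC; congr (_ * _).
under eq_bigr do rewrite normr_prod.
rewrite (exchange_big_dep xpredT) //=; apply: eq_bigr => j _.
rewrite (eq_bigr (fun i : 'I_r => (j - i)%:R)); last first.
  move=> i ij; rewrite !mxE distrC natrB; last first.
    by rewrite -ltnS prednK ?(leq_trans (ltn_ord i))// (leq_trans _ rn)// (leq_ltn_trans _ (ltn_ord i)).
  rewrite natrB; last first.
    by rewrite -ltnS prednK ?(leq_trans (ltn_ord j))// (leq_trans _ rn)// (leq_ltn_trans _ (ltn_ord i)).
  rewrite natrB; last exact: ltnW.
  rewrite opprB addrC addrA subrK; rewrite ger0_norm// subr_ge0 ler_nat ltnW//.
rewrite -(big_mkord (fun i => (i < j)%N) (fun i => (j - i)%:R : R)).
rewrite -(big_nat_widen 0 j r xpredT) ?(ltnW (ltn_ord j))// big_nat_rev /= fact_prod natr_prod big_add1 /=.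
apply: eq_big_nat => i /andP[_ ij]; congr (_%:R).
by rewrite add0n subKn.
Qed.

End HankelFactorial.

Section CoefficientAsymptotics.
Context {R : realType}.
Implicit Types (tau t c : R).

Lemma taylor_coef_asym r p :
  tends_inv (fun t : R => taylor_coef t r p / t ^+ p) ((-1) ^+ p / p`!%:R).
Proof.
elim: r p => [|r IH] p.
  apply: tends_inv_eq (tends_inv_cst _); exists 1 => t t1.
  have tp : t ^+ p != 0 by rewrite expf_neq0// gt_eqF// (lt_le_trans _ t1).
  rewrite taylor_coef0 [(- t) ^+ p]exprNn.
  by move: (t ^+ p) tp (p`!%:R)^-1 => y y0 z; field.
elim: p => [|p IHp]; first by under eq_fun do rewrite taylor_coefS0; exact: IH.
have H := tends_invB (IH p.+1) (tends_invM (@tends_inv_inv R) IHp).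
rewrite mul0r subr0 in H; apply: tends_inv_eq H; exists 1 => t t1.
have t0 : t != 0 by rewrite gt_eqF// (lt_le_trans _ t1).
rewrite taylor_coefSS mulrBl; congr (_ - _).
by rewrite exprS invfM mulrCA.
Qed.

(** The power of t and the exponential that rows and columns release when the Hankel determinant
    is normalised to have a limit. *)
Definition top_exp n r t : R :=
  expR (- t) ^+ r * ((t ^+ n.-1) ^+ r / (\prod_(i < r) t ^+ i) ^+ 2).

(** The entry (i, j) of the Hankel determinant is of order t ^ (n - 1 - i - j), a product of a
    factor of the row and a factor of the column; the limit of the normalised determinant is
    known up to sign, and an exponential is positive. *)
Lemma top_exp_asym (N : nat) (rho : R) (x : nat -> nat -> R -> R) (n r : nat) :
  0 < rho < 1 -> determines_x N rho x -> (r <= n)%N -> (n <= N)%N ->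
  exists delta, tends_inv delta (\prod_(i < r) (i`!%:R / (n.-1 - i)`!%:R)) /\
    forall t, 0 < t -> expR (- \sum_((n - r).+1 <= k < n.+1) x n k t) = top_exp n r t * delta t.
Proof.
move=> rho01 hx rn nN.
pose v t (i j : nat) : R := entry_val n r t (i + j) / t ^+ n.-1 * t ^+ (i + j).
exists (fun t => `|\det (\matrix_(i < r, j < r) v t i j)|); split.
  rewrite -(det_inv_fact rn).
  have norm f c : tends_inv f c -> tends_inv (fun t => `|f t|) `|c|.
    move=> [K [t0 [t00 H]]]; exists K, t0; split=> // t tt.
    exact: le_trans (ler_dist_dist _ _) (H t tt).
  apply: norm; apply: tends_inv_det => i j; rewrite !mxE.
  apply: (@tends_inv_eq _ (fun t => v t i j)); first by exists 0 => t _; rewrite mxE.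
  rewrite /v /entry_val; case: ifP => ijn; last first.
    by apply: tends_inv_eq (tends_inv_cst 0); exists 0 => t _; rewrite !mul0r.
  have := taylor_coef_asym r (n.-1 - (i + j)); apply: tends_inv_eq; exists 1 => t t1.
  have t0 : 0 < t by apply: lt_le_trans t1.
  have n0 : (0 < n)%N by apply: leq_ltn_trans ijn.
  have ijn1 : (i + j <= n.-1)%N by rewrite -ltnS prednK.
  have -> : (n - (i + j).+1 = n.-1 - (i + j))%N by rewrite -[in LHS](prednK n0) subSS.
  rewrite -mulrA; congr (_ * _); rewrite -{2}(subnK ijn1) exprD invfM -mulrA mulVf ?mulr1//.
  by rewrite expf_neq0// gt_eqF.
move=> t t0; have tne : t != 0 by rewrite gt_eqF.
have tX k : t ^+ k != 0 by rewrite expf_neq0.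
have M (a : R) : \det (\matrix_(i < r, j < r) (a * entry_val n r t (i + j))) =
    a ^+ r * ((t ^+ n.-1) ^+ r / (\prod_(i < r) t ^+ i) ^+ 2) * \det (\matrix_(i < r, j < r) v t i j).
  transitivity (\det (\matrix_(i < r, j < r) (a * t ^+ n.-1 / t ^+ i * t ^- j * (\matrix_(i < r, j < r) v t i j) i j))).
    congr (\det _); apply/matrixP => i j; rewrite !mxE /v exprD.
    have := tX i; have := tX j; have := tX n.-1.
    move: (t ^+ i) (t ^+ j) (t ^+ n.-1) => x1 x2 x3 h1 h2 h3.
    by field; rewrite h1 h2 h3.
  rewrite det_scale_rc; congr (_ * _).
  rewrite big_split /= prodr_const card_ord exprMn -!mulrA; congr (_ * (_ * _)).
  by rewrite expr2 invfM !prodfV.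
have [r0|r0] := posnP r.
  rewrite r0 /= subn0 big_geq// oppr0 expR0 /top_exp !expr0 big_ord0 expr1n divr1.
  by rewrite det_mx00 normr1 !mulr1.
have := hx n r t; rewrite r0 rn => /(_ isT nN t0).
rewrite contour_integral_frakF// M => /complexI E.
rewrite -[LHS]ger0_norm ?expR_ge0// E !normrM normrX normrN1 expr1n mul1r.
rewrite normrX normrM [`|expR _|]ger0_norm ?expR_ge0// [`|(-1) ^+ n|]normrX normrN1 expr1n mulr1.
rewrite /top_exp; congr (_ * _ * _).
rewrite -normrM ger0_norm// mulr_ge0// ?exprn_ge0 ?(ltW t0)//.
by rewrite invr_ge0 exprn_ge0// prodr_ge0// => i _; rewrite exprn_ge0// ltW.
Qed.

Section Coefficients.
Variables (N : nat) (rho : R) (x : nat -> nat -> R -> R).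
Hypothesis (rho01 : 0 < rho < 1) (hx : determines_x N rho x).

(** A quotient of two consecutive partial sums. The limits telescope to a single factor. *)
Lemma yy_asym (n k : nat) : (k <= n)%N -> (n < N)%N ->
  exists delta, tends_inv delta ((n - k)`!%:R / k`!%:R) /\
    forall t, 0 < t -> yy x n.+1 k.+1 t = expR (- t) * (t ^+ n / (t ^+ (n - k)) ^+ 2) * delta t /\
      0 < delta t.
Proof.
move=> kn nN.
have [d1 [h1 e1]] := @top_exp_asym _ _ _ n.+1 (n - k).+1 rho01 hx ltac:(lia) nN.
have [d2 [h2 e2]] := @top_exp_asym _ _ _ n.+1 (n - k) rho01 hx ltac:(lia) nN.
have fpos r' : 0 < \prod_(i < r') (i`!%:R / (n - i)`!%:R) :> R.
  by apply: prodr_gt0 => i _; rewrite divr_gt0// ltr0n fact_gt0.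
exists (fun t => d1 t / d2 t); split.
  have -> : (n - k)`!%:R / k`!%:R = \prod_(i < (n - k).+1) (i`!%:R / (n - i)`!%:R) /
      \prod_(i < n - k) (i`!%:R / (n - i)`!%:R) :> R.
    rewrite big_ord_recr /= subKn//; move: (fpos (n - k)%N); set p := \prod_(i < _) _ => p0.
    by rewrite [p * _]mulrC mulfK// gt_eqF.
  exact: tends_invM h1 (tends_invV (fpos _) h2).
move=> t t0; have tX j : 0 < t ^+ j by rewrite exprn_gt0.
have kE : ((n.+1 - (n - k).+1).+1 = k.+1)%N by lia.
have kE' : ((n.+1 - (n - k)).+1 = k.+2)%N by lia.
have := e1 t t0; have := e2 t t0; rewrite kE kE' => E2 E1.
have tepos r' : 0 < top_exp n.+1 r' t.
  rewrite /top_exp mulr_gt0 ?exprn_gt0 ?expR_gt0// divr_gt0 ?exprn_gt0//.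
  exact: prodr_gt0.
have d1pos : 0 < d1 t by rewrite -(pmulr_rgt0 _ (tepos (n - k).+1)) -E1 expR_gt0.
have d2pos : 0 < d2 t by rewrite -(pmulr_rgt0 _ (tepos (n - k)%N)) -E2 expR_gt0.
split; last by rewrite divr_gt0.
have -> : yy x n.+1 k.+1 t = expR (- x n.+1 k.+1 t) by rewrite /yy ltnNge ltnS kn.
have E : expR (- x n.+1 k.+1 t) * (top_exp n.+1 (n - k) t * d2 t) = top_exp n.+1 (n - k).+1 t * d1 t.
  by rewrite -E1 -E2 -expRD -opprD (big_ltn (m := k.+1))// ltnS.
have -> : expR (- x n.+1 k.+1 t) = top_exp n.+1 (n - k).+1 t * d1 t / (top_exp n.+1 (n - k) t * d2 t).
  by rewrite -E mulfK// mulf_neq0// gt_eqF.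
rewrite /top_exp big_ord_recr /= [expR _ ^+ _.+1]exprS [(t ^+ n) ^+ _.+1]exprS.
have : 0 < \prod_(i < n - k) t ^+ i by apply: prodr_gt0.
have := tX (n - k)%N; have := tX n; have := expR_gt0 (- t).
have := exprn_gt0 (n - k) (expR_gt0 (- t)); have := exprn_gt0 (n - k) (tX n).
move: d1pos d2pos; move: (d1 t) (d2 t) (expR (- t)) (t ^+ n) (t ^+ (n - k)) (\prod_(i < _) _)
  (expR (- t) ^+ _) ((t ^+ n) ^+ _) => a1 a2 a3 a4 a5 a6 a7 a8 ? ? ? ? ? ? ? ?.
by field; rewrite !gt_eqF.
Qed.

Lemma yy_gt n k t : (n < k)%N -> yy x n k t = 1.
Proof. by move=> nk; rewrite /yy nk gtn_eqF// (leq_ltn_trans _ nk). Qed.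

Let f0 m : m`!%:R != 0 :> R. Proof. by rewrite pnatr_eq0 -lt0n fact_gt0. Qed.
Let ff0 m k : 0 < m`!%:R / k`!%:R :> R. Proof. by rewrite divr_gt0// ltr0n fact_gt0. Qed.

Lemma ratio_diag_asym n k : (k <= n)%N -> (n < N)%N ->
  tends_inv (fun t => t * ratio_diag x n.+1 k.+1 t) k%:R.
Proof.
move=> kn nN; have [d1 [h1 e1]] := yy_asym kn nN; rewrite /ratio_diag /=.
case: k kn h1 e1 => [|k] kn h1 e1.
  by apply: tends_inv_eq (tends_inv_cst 0); exists 0 => t _; rewrite /yy /= mul0r mulr0.
case: n kn nN h1 e1 => [//|n] kn nN h1 e1.
have [d2 [h2 e2]] := yy_asym (kn : (k <= n)%N) (ltnW nN).
have -> : k.+1%:R = ((n - k)`!%:R / k`!%:R) / ((n.+1 - k.+1)`!%:R / k.+1`!%:R) :> R.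
  rewrite subSS factS natrM; have := f0 (n - k)%N; have := f0 k; move: (_`!%:R) (_`!%:R) => a b a0 b0.
  have : k.+1%:R != 0 :> R by rewrite pnatr_eq0.
  by move: (k.+1%:R) => c c0; field; rewrite ?a0 ?b0 ?c0.
apply: tends_inv_eq (tends_invM h2 (tends_invV (ff0 _ _) h1)).
exists 1 => t t1; have t0 : 0 < t by apply: lt_le_trans t1.
have [-> p1] := e1 t t0; have [-> p2] := e2 t t0.
rewrite subSS [t ^+ n.+1]exprS; have := exprn_gt0 (n - k) t0; have := exprn_gt0 n t0; have := expR_gt0 (- t).
move: (t ^+ n) (t ^+ (n - k)) (expR (- t)) (d1 t) (d2 t) p1 p2 => a b c d e ? ? ? ? ?.
by field; rewrite !gt_eqF.
Qed.

(* On the boundary k = n the neighbour is the constant 1, and the exponential decay prevails. *)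
Let corner_asym n : (n < N)%N -> tends_inv (fun t => t * yy x n.+1 n.+1 t) 0.
Proof.
move=> nN; have [d1 [h1 e1]] := yy_asym (leqnn n) nN.
rewrite -(mul0r ((n - n)`!%:R / n`!%:R)).
apply: tends_inv_eq (tends_invM (tends_inv_expN n.+1) h1).
exists 1 => t t1; have t0 : 0 < t by apply: lt_le_trans t1.
by have [-> _] := e1 t t0; rewrite subnn expr0 expr1n divr1 exprS; ring.
Qed.

Lemma ratio_next_asym n k : (k <= n)%N -> (n < N)%N ->
  tends_inv (fun t => t * ratio_next x n.+1 k.+1 t) 0.
Proof.
move=> kn nN; have [d1 [h1 e1]] := yy_asym kn nN; rewrite /ratio_next.
move: kn; rewrite leq_eqVlt => /predU1P[kn|kn].
  rewrite kn; apply: tends_inv_eq (corner_asym nN); exists 1 => t _.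
  by rewrite [yy x n.+1 n.+2 t]yy_gt// divr1.
have [d2 [h2 e2]] := yy_asym kn nN.
rewrite -(mul0r ((n - k)`!%:R / k`!%:R / ((n - k.+1)`!%:R / k.+1`!%:R))).
apply: tends_inv_eq (tends_invM (@tends_inv_inv R) (tends_invM h1 (tends_invV (ff0 _ _) h2))).
exists 1 => t t1; have t0 : 0 < t by apply: lt_le_trans t1.
have [-> p1] := e1 t t0; have [-> p2] := e2 t t0.
have -> : (n - k = (n - k.+1).+1)%N by lia.
rewrite [t ^+ _.+1]exprS; have := exprn_gt0 (n - k.+1) t0; have := exprn_gt0 n t0; have := expR_gt0 (- t).
move: (t ^+ n) (t ^+ (n - k.+1)) (expR (- t)) (d1 t) (d2 t) p1 p2 => a b c d e ? ? ? ? ?.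
by field; rewrite !gt_eqF.
Qed.

Lemma ratio_below_asym n k : (k <= n)%N -> (n < N)%N ->
  tends_inv (fun t => t * ratio_below x n.+1 k.+1 t) (n%:R - k%:R).
Proof.
move=> kn nN; have [d1 [h1 e1]] := yy_asym kn nN; rewrite /ratio_below /=.
move: kn; rewrite leq_eqVlt => /predU1P[kn|kn].
  rewrite kn subrr; apply: tends_inv_eq (corner_asym nN); exists 1 => t _.
  by rewrite [yy x n n.+1 t]yy_gt// divr1.
case: n kn nN h1 e1 => [//|n] kn nN h1 e1.
have [d2 [h2 e2]] := yy_asym (kn : (k <= n)%N) (ltnW nN).
have -> : n.+1%:R - k%:R = ((n.+1 - k)`!%:R / k`!%:R) / ((n - k)`!%:R / k`!%:R) :> R.
  rewrite -natrB 1?ltnW// subSn// factS natrM.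
  have := f0 (n - k)%N; have := f0 k; move: (_`!%:R) (_`!%:R) => a b a0 b0.
  by move: ((n - k).+1%:R) => c; field; rewrite a0 b0.
apply: tends_inv_eq (tends_invM h1 (tends_invV (ff0 _ _) h2)).
exists 1 => t t1; have t0 : 0 < t by apply: lt_le_trans t1.
have [-> p1] := e1 t t0; have [-> p2] := e2 t t0.
rewrite subSn// [t ^+ n.+1]exprS [t ^+ (n - k).+1]exprS; have := exprn_gt0 (n - k) t0; have := exprn_gt0 n t0; have := expR_gt0 (- t).
move: (t ^+ n) (t ^+ (n - k)) (expR (- t)) (d1 t) (d2 t) p1 p2 => a b c d e ? ? ? ? ?.
by field; rewrite !gt_eqF.
Qed.

Let small f c : tends_inv (fun t => t * f t) c -> tends_inv f 0.
Proof.
move=> h; rewrite -(mul0r c); apply: tends_inv_eq (tends_invM (@tends_inv_inv R) h).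
by exists 1 => t t1; rewrite mulKf// gt_eqF// (lt_le_trans _ t1).
Qed.

Let one_sub f c : tends_inv (fun t => t * f t) c -> tends_inv (fun t => 1 - f t) 1.
Proof. by move=> /small h; rewrite -[X in tends_inv _ X]subr0; exact: tends_invB (tends_inv_cst 1) h. Qed.

(** All three ratios tend to 0, so that every factor 1 - ratio tends to 1 and is positive for
    large t. *)
Lemma coef_asym n k : (k <= n)%N -> (n < N)%N ->
  [/\ tends_inv (fun t => t * coef_a x n.+1 k.+1 t) k%:R,
      tends_inv (fun t => t * coef_b x n.+1 k.+1 t) 0,
      tends_inv (fun t => t * coef_c x n.+1 k.+1 t) (n%:R - k%:R),
      tends_inv (coef_sigma x n.+1 k.+1) 1 &
      exists t0, forall t, t0 <= t -> 0 <= coef_a x n.+1 k.+1 t /\ 0 <= coef_c x n.+1 k.+1 t].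
Proof.
move=> kn nN; have hd := ratio_diag_asym kn nN; have hn := ratio_next_asym kn nN.
have hb := ratio_below_asym kn nN.
have od := one_sub hd; have on := one_sub hn; have ob := one_sub hb.
have iob := tends_invV ltr01 ob; rewrite invr1 in iob.
split.
- have := tends_invM hd (tends_invM on iob); rewrite !mulr1.
  by apply: tends_inv_eq; exists 0 => t _; rewrite /coef_a -mulrA.
- have := tends_invM hn (tends_invM od iob); rewrite !mulr1.
  by apply: tends_inv_eq; exists 0 => t _; rewrite /coef_b -mulrA.
- have := tends_invM hb (tends_invM (tends_invM od on) (tends_invM iob iob)); rewrite !mulr1.
  by apply: tends_inv_eq; exists 0 => t _; rewrite /coef_c expr2 invfM -!mulrA.
- have := tends_invM (tends_invM od on) iob; rewrite !mulr1.
  exact: tends_inv_sqrt.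
- have [u1 H1] := tends_inv_gt od ltr01; have [u2 H2] := tends_inv_gt on ltr01.
  have [u3 H3] := tends_inv_gt ob ltr01.
  exists (Num.max (Num.max u1 u2) (Num.max u3 1)) => t; rewrite !ge_max.
  move=> /andP[/andP[/H1 h1 /H2 h2] /andP[/H3 h3 t1]].
  have t0 : 0 < t by apply: lt_le_trans t1.
  have y0 m l : (m <= N)%N -> 0 <= yy x m l t.
    move=> mN; case: l => [//|l]; case: m mN => [|m] mN; first by rewrite yy_gt.
    by rewrite /yy /=; case: ifP => // _; exact: expR_ge0.
  have rd0 : 0 <= ratio_diag x n.+1 k.+1 t by rewrite divr_ge0// y0// ltnW.
  have rb0 : 0 <= ratio_below x n.+1 k.+1 t by rewrite divr_ge0// y0// ltnW.
  rewrite /coef_a /coef_c; split; rewrite mulr_ge0// divr_ge0 ?exprn_ge0 ?mulr_ge0 ?ltW//.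
Qed.

End Coefficients.
End CoefficientAsymptotics.

Section CoefficientContinuity.
Context {R : realType}.
Implicit Types (t c : R).

Let cts_ext (f g : R -> R) t : f =1 g -> continuous_at t f -> continuous_at t g.
Proof. by move=> /funext ->. Qed.
Let cts_cst c t : continuous_at t (fun=> c). Proof. exact: cvg_cst. Qed.
Let ctsD (f g : R -> R) t : continuous_at t f -> continuous_at t g ->
  continuous_at t (fun u => f u + g u).
Proof. exact: continuousD. Qed.
Let ctsM (f g : R -> R) t : continuous_at t f -> continuous_at t g ->
  continuous_at t (fun u => f u * g u).
Proof. exact: continuousM. Qed.
Let ctsN (f : R -> R) t : continuous_at t f -> continuous_at t (fun u => - f u).
Proof. exact: continuousN. Qed.
Let cts_id t : continuous_at t (fun u : R => u). Proof. exact: cvg_id. Qed.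
Let ctsX (f : R -> R) m t : continuous_at t f -> continuous_at t (fun u => f u ^+ m).
Proof.
move=> cf; elim: m => [|m IH].
  by apply: cts_ext (@cts_cst 1 t) => u; rewrite expr0.
by apply: cts_ext (ctsM cf IH) => u; rewrite exprS.
Qed.

Lemma continuous_bigsum (I : Type) (s : seq I) (f : I -> R -> R) t :
  (forall i, {for t, continuous (f i)}) -> continuous_at t (fun u => \sum_(i <- s) f i u).
Proof.
move=> cf; elim: s => [|i s IH].
  by under eq_fun do rewrite big_nil; exact: cvg_cst.
by under eq_fun do rewrite big_cons; exact: continuousD (cf i) IH.
Qed.

Lemma continuous_bigprod (I : Type) (s : seq I) (f : I -> R -> R) t :
  (forall i, {for t, continuous (f i)}) -> continuous_at t (fun u => \prod_(i <- s) f i u).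
Proof.
move=> cf; elim: s => [|i s IH].
  by under eq_fun do rewrite big_nil; exact: cvg_cst.
by under eq_fun do rewrite big_cons; exact: continuousM (cf i) IH.
Qed.

Lemma taylor_coef_continuous r p t : continuous_at t (fun u : R => taylor_coef u r p).
Proof.
elim: r p => [|r IH] p.
  apply: cts_ext (_ : continuous_at t (fun u : R => (- u) ^+ p / p`!%:R)) => //.
  by apply: ctsM; [apply: ctsX; apply: ctsN; exact: cts_id|exact: cts_cst].
elim: p => [|p IHp]; first by apply: cts_ext (IH 0%N).
by apply: cts_ext (ctsD (IH p.+1) (ctsN IHp)).
Qed.

Variables (N : nat) (rho : R) (x : nat -> nat -> R -> R).
Hypothesis (rho01 : 0 < rho < 1) (hx : determines_x N rho x).

Lemma top_exp_continuous n r t : (r <= n <= N)%N -> 0 < t ->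
  continuous_at t (fun u => expR (- \sum_((n - r).+1 <= k < n.+1) x n k u)).
Proof.
move=> /andP[rn nN] t0; have [r0|r0] := posnP r.
  rewrite r0 subn0 (_ : (fun _ => _) = cst 1); first exact: cvg_cst.
  by apply/funext => u; rewrite big_geq// oppr0 expR0.
pose g u : R := (-1) ^+ (r * r.+1)./2 *
   \det (\matrix_(i < r, j < r) (expR (- u) * (-1) ^+ n * entry_val n r u (i + j))).
have cg : continuous_at t g.
  apply: ctsM; first exact: cts_cst.
  apply: continuous_bigsum => s; apply: ctsM; first exact: cts_cst.
  apply: continuous_bigprod => i; apply: cts_ext (_ : continuous_at t
    (fun u => expR (- u) * (-1) ^+ n * entry_val n r u (i + s i))) => [u|]; first by rewrite mxE.
  apply: ctsM.
    apply: ctsM; last exact: cts_cst.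
    by apply: continuous_comp; [exact: oppr_continuous|exact: continuous_expR].
  by rewrite /entry_val; case: (i + s i < n)%N; [exact: taylor_coef_continuous|exact: cts_cst].
have E u : 0 < u -> g u = expR (- \sum_((n - r).+1 <= k < n.+1) x n k u).
  move=> u0; have := @hx n r u; rewrite r0 rn => /(_ isT nN u0).
  by rewrite contour_integral_frakF// => /complexI ->.
rewrite /continuous_at -E//; apply: cvg_trans cg; apply: near_eq_cvg.
near=> u; rewrite E//; near: u; exact: lt_nbhsr.
Unshelve. all: end_near. Qed.

(** Again a quotient of consecutive partial sums, continuous as the Hankel determinants are. *)
Lemma yy_continuous n k t : (n <= N)%N -> 0 < t -> continuous_at t (yy x n k).
Proof.
move=> nN t0; have [->|k0] := posnP k; first exact: cvg_cst.
have [nk|kn] := ltnP n k.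
  by rewrite (_ : yy x n k = cst 1); [exact: cvg_cst|apply/funext => u; rewrite yy_gt].
pose f r u := expR (- \sum_((n - r).+1 <= k < n.+1) x n k u).
have -> : yy x n k = (fun u => f (n - k).+1 u / f (n - k)%N u).
  apply/funext => u; rewrite /yy gtn_eqF// ltnNge kn /= /f.
  have -> : ((n - (n - k).+1).+1 = k)%N by lia.
  have -> : ((n - (n - k)).+1 = k.+1)%N by lia.
  rewrite (big_ltn (m := k)) ?ltnS// -expRN opprK -expRD opprD -addrA addNr addr0//.
apply: continuousM; first by apply: top_exp_continuous => //; apply/andP; split=> //; lia.
apply: continuousV; first by rewrite gt_eqF// expR_gt0.
by apply: top_exp_continuous => //; apply/andP; split=> //; lia.
Qed.

Lemma yy_neq0 n k t : (0 < k)%N -> yy x n k t != 0.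
Proof.
by case: k => // k _; rewrite /yy /=; case: ifP => _; rewrite ?oner_eq0// gt_eqF// expR_gt0.
Qed.

Lemma coef_continuous n k t : (1 <= k <= n)%N -> (n <= N)%N -> 0 < t ->
  ratio_below x n k t < 1 ->
  [/\ continuous_at t (coef_a x n k), continuous_at t (coef_b x n k) &
      continuous_at t (coef_c x n k)].
Proof.
move=> /andP[k1 kn] nN t0 rb1.
have cd : continuous_at t (ratio_diag x n k).
  apply: continuousM; first by apply: yy_continuous => //; lia.
  by apply: continuousV; [exact: yy_neq0|exact: yy_continuous].
have cn : continuous_at t (ratio_next x n k).
  apply: continuousM; first exact: yy_continuous.
  by apply: continuousV; [exact: yy_neq0|exact: yy_continuous].
have cb : continuous_at t (ratio_below x n k).
  apply: continuousM; first exact: yy_continuous.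
  by apply: continuousV; [exact: yy_neq0|apply: yy_continuous => //; lia].
have s (f : R -> R) : continuous_at t f -> continuous_at t (fun u : R => 1 - f u).
  by move=> cf; apply: continuousB cf; exact: cvg_cst.
have ib : continuous_at t (fun u => (1 - ratio_below x n k u)^-1).
  by apply: continuousV (s _ cb); rewrite subr_eq0 gt_eqF.
split.
- exact: continuousM cd (continuousM (s _ cn) ib).
- exact: continuousM cn (continuousM (s _ cd) ib).
- rewrite (_ : coef_c x n k = fun t => ratio_below x n k t *
    ((1 - ratio_diag x n k t) * (1 - ratio_next x n k t) *
     ((1 - ratio_below x n k t)^-1 * (1 - ratio_below x n k t)^-1))); last first.
    by apply/funext => u; rewrite /coef_c expr2 invfM.
  exact: continuousM cb (continuousM (continuousM (s _ cd) (s _ cn)) (continuousM ib ib)).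
Qed.

Lemma fin_eventually (I : finType) (Q : I -> R -> Prop) :
  (forall i, exists u, forall v, u <= v -> Q i v) ->
  exists u, forall v, u <= v -> forall i, Q i v.
Proof.
move=> /boolp.choice[f Hf]; exists (\big[Num.max/0]_i f i) => v fv i.
by apply: Hf; apply: le_trans fv; exact: le_bigmax.
Qed.

(** What the comparison of the two equations uses about the coefficients. The bounds hold past
    the constant [K] itself, which makes the condition upward closed in [K]. *)
Definition coef_bounds (K : R) := 0 < K /\ forall (i : tri N) t, K <= t ->
  let n := level i in let k := kpos i in
  [/\ [/\ `|coef_a x n k t - (k%:R - 1) / t| <= K / t ^+ 2,
         `|coef_b x n k t| <= K / t ^+ 2,
         `|coef_c x n k t - (n%:R - k%:R) / t| <= K / t ^+ 2 &
         `|coef_sigma x n k t - 1| <= K / t],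
      0 <= coef_a x n k t, 0 <= coef_c x n k t &
      [/\ continuous_at t (coef_a x n k), continuous_at t (coef_b x n k) &
        continuous_at t (coef_c x n k)]].

Lemma tri_bounds (i : tri N) : (1 <= kpos i <= level i)%N /\ (level i <= N)%N.
Proof. by split; [exact: (valP i)|rewrite -ltnS; exact: ltn_ord]. Qed.

Lemma coef_boundsP : exists K, coef_bounds K.
Proof.
have sq (f : R -> R) c : tends_inv (fun t => t * f t) c -> exists u, forall v, u <= v ->
    forall t, v <= t -> `|f t - c / t| <= v / t ^+ 2.
  move=> [K [t0 [t00 H]]]; exists (Num.max K t0) => v; rewrite ge_max => /andP[Kv t0v] t vt.
  have tp : 0 < t by apply: lt_le_trans t00 _; apply: le_trans vt.
  have -> : f t - c / t = (t * f t - c) / t by rewrite mulrBl mulrAC divff ?mul1r// gt_eqF.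
  rewrite normrM normfV [`|t|]gtr0_norm// expr2 invfM mulrA ler_wpM2r ?invr_ge0 ?(ltW tp)//.
  apply: le_trans (H t (le_trans t0v vt)) _.
  by rewrite ler_wpM2r// invr_ge0 ltW.
have lin (f : R -> R) c : tends_inv f c -> exists u, forall v, u <= v ->
    forall t, v <= t -> `|f t - c| <= v / t.
  move=> [K [t0 [t00 H]]]; exists (Num.max K t0) => v; rewrite ge_max => /andP[Kv t0v] t vt.
  apply: le_trans (H t (le_trans t0v vt)) _.
  by rewrite ler_wpM2r// invr_ge0 (le_trans (ltW t00))// (le_trans t0v).
have H (i : tri N) : exists u, forall v, u <= v -> 0 < v /\ forall t, v <= t ->
  let n := level i in let k := kpos i in
  [/\ [/\ `|coef_a x n k t - (k%:R - 1) / t| <= v / t ^+ 2,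
         `|coef_b x n k t| <= v / t ^+ 2,
         `|coef_c x n k t - (n%:R - k%:R) / t| <= v / t ^+ 2 &
         `|coef_sigma x n k t - 1| <= v / t],
      0 <= coef_a x n k t, 0 <= coef_c x n k t &
      [/\ continuous_at t (coef_a x n k), continuous_at t (coef_b x n k) &
        continuous_at t (coef_c x n k)]].
  have [kn nN] := tri_bounds i; have cc := fun t => @coef_continuous (level i) (kpos i) t kn nN.
  move: (level i) (kpos i) kn nN cc => [|n] [|k] //=; rewrite !ltnS => kn nN cc.
  have [ha hb hc hs [u5 hp]] := coef_asym rho01 hx kn nN.
  have [u1 H1] := sq _ _ ha; have [u2 H2] := sq _ _ hb; have [u3 H3] := sq _ _ hc.
  have [u4 H4] := lin _ _ hs.
  have hbl := ratio_below_asym rho01 hx kn nN.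
  have [u6 H6] : exists u, forall t, u <= t -> ratio_below x n.+1 k.+1 t < 1.
    have := tends_invM (@tends_inv_inv R) hbl; rewrite mul0r => /tends_inv_lt /(_ ltr01)[u Hu].
    exists (Num.max u 1) => t; rewrite ge_max => /andP[ut t1].
    by have := Hu t ut; rewrite mulKf// gt_eqF// (lt_le_trans _ t1).
  exists (Num.max (Num.max (Num.max u1 u2) (Num.max u3 u4)) (Num.max (Num.max u5 u6) 1)) => v.
  rewrite !ge_max => /andP[/andP[/andP[v1 v2] /andP[v3 v4]] /andP[/andP[v5 v6] v7]].
  have v0 : 0 < v by apply: lt_le_trans v7.
  split=> // t vt; have [a0 c0] := hp t (le_trans v5 vt).
  split=> //; last by apply: cc; [exact: lt_le_trans vt|exact: H6 (le_trans v6 vt)].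
  split.
  - by rewrite -[k.+1%:R]natr1 addrK; exact: H1.
  - by have := H2 v v2 t vt; rewrite mul0r subr0.
  - by rewrite -[k.+1%:R]natr1 -[n.+1%:R]natr1 opprD addrACA subrr addr0; exact: H3.
  - exact: H4.
have [K HK] := fin_eventually H; exists (Num.max K 1); split.
  by rewrite lt_max ltr01 orbT.
by move=> i t Kt; apply: (proj2 (HK (Num.max K 1) _ i)); rewrite // le_max lexx.
Qed.

End CoefficientContinuity.

(** * Normal laws *)

(** The structure is named because the measurability of [f] is given by a proof, and not by a
    structure on [f]. *)
Definition image_measure {d1 d2 : measure_display} {T1 : measurableType d1}
    {T2 : measurableType d2} {R : realType} (m : {measure set T1 -> \bar R})
    {f : T1 -> T2} (mf : measurable_fun setT f) : {measure set T2 -> \bar R} :=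
  measure_function_pushforward__canonical__measure_function_Measure m mf.

Section NormalMoments.
Context {R : realType}.
Local Notation mu := (@lebesgue_measure R).
Implicit Types (k s : R) (A B : set (measurableTypeR R)) (f : measurableTypeR R -> \bar R).
Local Open Scope ereal_scope.

Lemma measurable_mull k :
  measurable_fun setT (fun x : measurableTypeR R => (k * x)%R : measurableTypeR R).
Proof. exact: measurable_funM. Qed.

(** Both sides, as functions of the set, are measures that agree on half-open intervals. *)
Lemma lebesgue_measure_scale k A : k != 0%R -> measurable A ->
  mu A = `|k|%:E * mu [set x | A (k * x)%R].
Proof.
move=> k0 mA.
pose m := mscale (NngNum (normr_ge0 k)) (image_measure mu (measurable_mull k)).
rewrite (@lebesgue_measure_unique R m)// => _ [[a b] _ <-] /=.
rewrite /m /mscale /pushforward /= lebesgue_measure_itv /=.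
rewrite /pushforward.
have [kp|kn|k00] := ltgtP 0%R k; last by move: k0; rewrite -k00 eqxx.
  have -> : (fun x => (k * x)%R) @^-1` `]a, b]%classic = `](a / k)%R, (b / k)%R]%classic.
    apply/seteqP; split=> x /=; rewrite !in_itv/= ltr_pdivrMr// ler_pdivlMr//;
    by rewrite mulrC.
  rewrite lebesgue_measure_itv/= !lte_fin ltr_pM2r ?invr_gt0//.
  case: ifPn => ab; last by rewrite mule0.
  by rewrite -!EFinB -EFinM -mulrBl gtr0_norm// mulrC divfK// gt_eqF.
have -> : (fun x => (k * x)%R) @^-1` `]a, b]%classic = `[(b / k)%R, (a / k)%R[%classic.
  apply/seteqP; split=> x /=; rewrite !in_itv/= ltr_ndivlMr// ler_ndivrMr// andbC;
  by rewrite mulrC.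
rewrite lebesgue_measure_itv/= !lte_fin ltr_nM2r ?invr_lt0//.
case: ifPn => ab; last by rewrite mule0.
rewrite -!EFinB -EFinM -mulrBl ltr0_norm//; congr (_%:E); field.
by rewrite lt_eqF.
Qed.

Lemma ge0_integral_scale k f : k != 0%R -> measurable_fun setT f ->
  (forall x, 0 <= f x) -> \int[mu]_x f x = `|k|%:E * \int[mu]_x f (k * x)%R.
Proof.
move=> k0 mf f0.
pose m := mscale (NngNum (normr_ge0 k)) (image_measure mu (measurable_mull k)).
rewrite (@eq_measure_integral _ _ _ _ m) => [|A mA _]; last first.
  exact: lebesgue_measure_scale.
rewrite ge0_integral_mscale// (ge0_integral_pushforward (measurable_mull k))//.
Qed.

Lemma normal_peak_scale k s : normal_peak (k * s) = (`|k|^-1 * normal_peak s)%R.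
Proof.
rewrite /normal_peak; have -> : ((k * s) ^+ 2 * pi *+ 2 = k ^+ 2 * (s ^+ 2 * pi *+ 2))%R by ring.
by rewrite sqrtrM ?sqr_ge0// sqrtr_sqr invfM.
Qed.

Lemma normal_prob_scale k s B : k != 0%R -> s != 0%R -> measurable B ->
  normal_prob 0 (k * s) B = normal_prob 0 s [set x | B (k * x)%R].
Proof.
move=> k0 s0 mB.
have mN t : measurable_fun setT (fun x : measurableTypeR R => (normal_pdf 0 t x)%:E).
  by apply/measurable_EFinP; exact: measurable_normal_pdf.
rewrite /normal_prob integral_mkcond [RHS]integral_mkcond.
rewrite (ge0_integral_scale k0); last 2 first.
- by apply/measurable_restrict => //; rewrite setTI; apply: measurable_funTS.
- by move=> x; apply: erestrict_ge0 => y _; rewrite lee_fin normal_pdf_ge0.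
rewrite -ge0_integralZl//; last 2 first.
- suff mp : measurable_fun setT ((fun x : measurableTypeR R => (normal_pdf 0 (k * s) x)%:E) \_ B).
    exact: (measurableT_comp mp (measurable_mull k)).
  by apply/measurable_restrict => //; rewrite setTI; apply: measurable_funTS.
- by move=> x _; apply: erestrict_ge0 => y _; rewrite lee_fin normal_pdf_ge0.
apply: eq_integral => x _; rewrite !patchE.
have -> : (x \in [set x0 | B (k * x0)%R]) = ((k * x)%R \in B) by apply/idP/idP; rewrite !inE.
case: ifP => _; last by rewrite mule0.
rewrite -EFinM; congr (_%:E); rewrite !normal_pdfE ?mulf_neq0//.
rewrite mulrA; congr (_ * _)%R.
  by rewrite normal_peak_scale mulVKf// normr_eq0.
rewrite /normal_fun !subr0 !exprMn; congr expR.
by rewrite -mulrnAr !mulNr -mulf_div divff ?mul1r// sqrf_eq0.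
Qed.

Lemma ge0_integral_normal_prob s f : measurable_fun setT f -> (forall x, 0 <= f x) ->
  \int[normal_prob 0 s]_x f x = \int[mu]_x (f x * (normal_pdf 0 s x)%:E).
Proof.
move=> mf f0.
have dom := @normal_prob_dominates R 0%R s.
have mN : measurable_fun setT (fun x : measurableTypeR R => (normal_pdf 0 s x)%:E).
  by apply/measurable_EFinP; exact: measurable_normal_pdf.
rewrite -(Radon_Nikodym_SigmaFinite.change_of_variables dom)//.
have int_f := Radon_Nikodym_SigmaFinite.f_integrable dom.
apply: ae_eq_integral => //.
- by apply: emeasurable_funM => //; exact: measurable_int int_f.
- exact: emeasurable_funM.
apply: ae_eqe_mul2l => /=; apply: integral_ae_eq => // E _ mE.
by rewrite -(Radon_Nikodym_SigmaFinite.f_integral dom).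
Qed.

(** Domination of the second moment by the density of twice the standard deviation, which avoids
    computing a Gaussian integral; the constant 6 is not sharp. *)
Lemma sqr_expR_le (p x s : R) : (0 <= p)%R -> s != 0%R ->
  (x ^+ 2 * (p * expR (- x ^+ 2 / (s ^+ 2 *+ 2))) <=
   6 * s ^+ 2 * (2^-1 * p * expR (- x ^+ 2 / ((2 * s) ^+ 2 *+ 2))))%R.
Proof.
move=> p0 s0; have ss : (0 < s ^+ 2)%R by rewrite exprn_even_gt0.
(* split off the factor e^u, with u = 3 x^2 / (8 s^2), and use u <= e^u *)
pose u := (3 * x ^+ 2 / (8 * s ^+ 2))%R.
have -> : expR (- x ^+ 2 / ((2 * s) ^+ 2 *+ 2)) = (expR u * expR (- x ^+ 2 / (s ^+ 2 *+ 2)))%R.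
  rewrite -expRD; congr expR; rewrite /u exprMn.
  by move: (s ^+ 2)%R (x ^+ 2)%R ss => a b a0; field; rewrite gt_eqF.
have x2 : (x ^+ 2 = 8 / 3 * s ^+ 2 * u)%R.
  by rewrite /u; move: (s ^+ 2)%R (x ^+ 2)%R ss => a b a0; field; rewrite gt_eqF.
have ue : (u <= expR u)%R by apply: le_trans (expR_ge1Dx u); rewrite lerDr.
have xe : (x ^+ 2 <= 3 * s ^+ 2 * expR u)%R.
  have := expR_gt0 u; move: (expR u) ue => e ue e0.
  have h1 : (0 <= s ^+ 2 * (e - u))%R by rewrite mulr_ge0 ?subr_ge0// ltW.
  have h2 : (0 <= s ^+ 2 * e)%R by rewrite mulr_ge0// ltW.
  by move: h1; rewrite x2 mulrBr; clearbody u; lra.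
have := mulr_ge0 p0 (expR_ge0 (- x ^+ 2 / (s ^+ 2 *+ 2))).
move: (expR (- _ / _)) => e pe0; apply: le_trans (ler_wpM2r pe0 xe) _.
move: (expR u) (s ^+ 2)%R => a b.
by rewrite le_eqVlt; apply/orP; left; apply/eqP; field.
Qed.

Lemma normal_second_moment_le s : s != 0%R ->
  \int[normal_prob 0 s]_x (x ^+ 2)%:E <= (6 * s ^+ 2)%:E.
Proof.
move=> s0; have ts0 : (2 * s)%R != 0%R by rewrite mulf_neq0.
have mN t : measurable_fun setT (fun x : measurableTypeR R => (normal_pdf 0 t x)%:E).
  by apply/measurable_EFinP; exact: measurable_normal_pdf.
have msq : measurable_fun setT (fun x : measurableTypeR R => (x ^+ 2)%:E).
  by apply/measurable_EFinP; exact: measurable_funX.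
rewrite ge0_integral_normal_prob//; last by move=> x; rewrite lee_fin sqr_ge0.
apply: (@le_trans _ _ (\int[mu]_x ((6 * s ^+ 2)%:E * (normal_pdf 0 (2 * s) x)%:E))); last first.
  rewrite ge0_integralZl//; last by rewrite lee_fin mulr_ge0// sqr_ge0.
    by rewrite integral_normal_pdf// mule1.
  by move=> x _; rewrite lee_fin normal_pdf_ge0.
apply: ge0_le_integral => //.
- by move=> x _; rewrite mule_ge0// lee_fin ?sqr_ge0 ?normal_pdf_ge0.
- exact: emeasurable_funM.
- exact: emeasurable_funM.
move=> x _; rewrite -!EFinM lee_fin !normal_pdfE// /normal_fun subr0.
have := normal_peak_ge0 s; rewrite normal_peak_scale ger0_norm//.
by move=> p0; exact: sqr_expR_le.
Qed.

Lemma normal_prob_opp s B : s != 0%R -> measurable B ->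
  normal_prob 0 s [set x | B (- x)%R] = normal_prob 0 s B.
Proof.
move=> s0 mB; have := @normal_prob_scale (-1) s B _ s0 mB; rewrite oppr_eq0 oner_eq0 => /(_ isT).
under [in X in _ = X -> _]eq_set do rewrite mulN1r.
move=> <-; rewrite mulN1r /normal_prob; apply: eq_integral => x _.
by rewrite !normal_pdfE ?oppr_eq0// /normal_peak /normal_fun sqrrN.
Qed.

Lemma normal_integrable s : s != 0%R ->
  (normal_prob 0 s).-integrable setT (fun x : R => x%:E).
Proof.
move=> s0.
have msq : measurable_fun setT (fun x : measurableTypeR R => (x ^+ 2)%:E).
  by apply/measurable_EFinP; exact: measurable_funX.
apply/integrableP; split; first exact/measurable_EFinP.
apply: (@le_lt_trans _ _ (\int[normal_prob 0 s]_x (1 + (x ^+ 2)%:E))).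
  apply: ge0_le_integral => //.
  - by apply: measurableT_comp => //; exact/measurable_EFinP.
  - exact: emeasurable_funD.
  move=> x _; rewrite -EFinD lee_fin -(real_normK (num_real x)).
  move: (normr_ge0 x); move: `|x|%R => y y0; have := sqr_ge0 (y - 1)%R.
  by rewrite sqrrB mulr1 expr1n => ?; nra.
rewrite ge0_integralD//; last by move=> x _; rewrite lee_fin sqr_ge0.
have -> : \int[normal_prob 0 s]__ 1 = 1.
  by rewrite integral_cst//= mul1e; exact: probability_setT.
rewrite lte_add_pinfty// ?ltry//.
by apply: le_lt_trans (normal_second_moment_le s0) _; exact: ltry.
Qed.

(** The law is symmetric. *)
Lemma normal_mean0 s : s != 0%R -> \int[normal_prob 0 s]_x x%:E = 0.
Proof.
move=> s0; have int_id := normal_integrable s0.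
have fin : \int[normal_prob 0 s]_x x%:E \is a fin_num by exact: integrable_fin_num.
have : \int[normal_prob 0 s]_x x%:E = - \int[normal_prob 0 s]_x x%:E.
  rewrite {1}(@eq_measure_integral _ _ _ _ (image_measure (normal_prob 0 s) (measurable_mull (-1)))).
    rewrite (integral_pushforward (measurable_mull (-1)))//.
      rewrite -integralN//; last exact: integrable_add_def.
      by rewrite preimage_setT; apply: eq_integral => x _ /=; rewrite mulN1r EFinN.
    - rewrite preimage_setT; apply: eq_integrable (integrableN int_id) => // x _ /=.
      by rewrite mulN1r.
  move=> A mA _; apply: etrans (esym (normal_prob_opp s0 mA)) _.
  rewrite /= /pushforward; congr (normal_prob _ _ _).
  by apply/seteqP; split=> x /=; rewrite mulN1r.
move: fin; case: (integral _ _ _) => // r _ /(congr1 fine) /= rr; congr (_%:E).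
by lra.
Qed.

End NormalMoments.

(** * Brownian increments and stochastic integrals *)

Section MeasurableWrt.
Context {R : realType} {d : measure_display} {Omega : measurableType d}.
Implicit Types (G : set (set Omega)) (X Y : Omega -> R).

(** The bridge to measurability in the sense of a measurable space, where the closure properties
    are available. *)
Lemma measurable_wrtP G X : sigma_algebra setT G ->
  measurable_wrt G X <->
  measurable_fun [set: g_sigma_algebraType G] (X : g_sigma_algebraType G -> R).
Proof.
move=> sG; have GE := sigma_algebra_id sG; split=> [mX _ B mB|mX B mB].
  by rewrite setTI /measurable /= GE; exact: mX.
by have := mX measurableT B mB; rewrite setTI /measurable /= GE.
Qed.

Lemma measurable_wrt_fun G X : G `<=` measurable -> measurable_wrt G X ->
  measurable_fun setT X.
Proof. by move=> Gm mX _ B mB; rewrite setTI; apply/Gm/mX. Qed.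

Lemma measurable_wrt_sub G G' X : G `<=` G' -> measurable_wrt G X -> measurable_wrt G' X.
Proof. by move=> GG mX B mB; apply/GG/mX. Qed.

End MeasurableWrt.

Section SquareIntegrable.
Context {R : realType} {d : measure_display} {Omega : measurableType d}.
Variable P : probability Omega R.
Implicit Types (X Y : Omega -> R).

Definition sq_integrable X :=
  measurable_fun setT X /\ P.-integrable setT (fun w => (X w ^+ 2)%:E).

Lemma le_integrable_EFin X Y : measurable_fun setT X -> (forall w, `|X w| <= Y w) ->
  P.-integrable setT (EFin \o Y) -> P.-integrable setT (EFin \o X).
Proof.
move=> mX XY; apply: le_integrable => //; first exact/measurable_EFinP.
by move=> w _ /=; rewrite lee_fin (le_trans (XY w))// ler_norm.
Qed.

Lemma integrableD_EFin X Y : P.-integrable setT (EFin \o X) ->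
  P.-integrable setT (EFin \o Y) -> P.-integrable setT (fun w => (X w + Y w)%:E).
Proof. by move=> iX iY; apply: eq_integrable (integrableD _ iX iY). Qed.

Lemma integrableZl_EFin k X : P.-integrable setT (EFin \o X) ->
  P.-integrable setT (fun w => (k * X w)%:E).
Proof. by move=> iX; apply: eq_integrable (integrableZl _ k iX). Qed.

Lemma sq_integrableM X Y : sq_integrable X -> sq_integrable Y ->
  P.-integrable setT (fun w => (X w * Y w)%:E).
Proof.
move=> [mX iX] [mY iY]; apply: (@le_integrable_EFin _ (fun w => X w ^+ 2 + Y w ^+ 2)).
- exact: measurable_funM.
- move=> w; rewrite normrM -(real_normK (num_real (X w))) -(real_normK (num_real (Y w))).
  move: `|X w| `|Y w| (normr_ge0 (X w)) (normr_ge0 (Y w)) => x y x0 y0.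
  by have := sqr_ge0 (x - y); rewrite sqrrB; nra.
- exact: integrableD_EFin.
Qed.

Lemma sq_integrableD X Y : sq_integrable X -> sq_integrable Y ->
  sq_integrable (fun w => X w + Y w).
Proof.
move=> sX sY; have iXY := sq_integrableM sX sY; case: sX sY => mX iX [mY iY].
split; first exact: measurable_funD.
under eq_fun do rewrite sqrrD -mulr_natl.
by apply: integrableD_EFin => //; apply: integrableD_EFin => //; exact: integrableZl_EFin.
Qed.

Lemma sq_integrableZ k X : sq_integrable X -> sq_integrable (fun w => k * X w).
Proof.
move=> [mX iX]; split; first exact: measurable_funM.
under eq_fun do rewrite exprMn.
exact: integrableZl_EFin.
Qed.

Lemma sq_integrable_le X Y : measurable_fun setT X -> (forall w, `|X w| <= `|Y w|) ->
  sq_integrable Y -> sq_integrable X.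
Proof.
move=> mX XY [mY iY]; split => //; apply: le_integrable_EFin iY.
  exact: measurable_funX.
by move=> w; rewrite normrX -(real_normK (num_real (Y w))) lerXn2r ?nnegrE.
Qed.

Lemma sq_integrable0 : sq_integrable (cst 0).
Proof.
split; first exact: measurable_cst.
by under eq_fun do rewrite /= expr0n /=; exact: integrable0.
Qed.

Lemma second_moment_tail X (v lambda : R) : sq_integrable X -> 0 < lambda ->
  \int[P]_w X w ^+ 2 <= v -> (P [set w | (lambda <= `|X w|)%R ] <= (v / lambda ^+ 2)%:E)%E.
Proof.
move=> [mX iX] l0 Xv.
have mA : measurable [set w | lambda <= `|X w| ].
  rewrite (_ : [set w | _] = (fun w => `|X w|) @^-1` `[lambda, +oo[); last first.
    by apply/seteqP; split=> w /=; rewrite in_itv/= andbT.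
  by rewrite -[X in measurable X]setTI; apply: measurableT_comp => //; exact: measurableT_comp.
have l2 : 0 < lambda ^+ 2 by rewrite exprn_gt0.
rewrite EFinM muleC lee_pdivlMl//; apply: le_trans (_ : ((\int[P]_w X w ^+ 2)%:E <= _)%E).
  rewrite /Rintegral fineK; last exact: integrable_fin_num.
  set A := [set w | _]; rewrite -[A]setIT -(integral_indic P measurableT mA) -ge0_integralZl//; last 2 first.
  - by apply/measurable_EFinP; exact: measurable_indic.
  - by rewrite lee_fin ltW.
  apply: ge0_le_integral => //.
  - by move=> w _; rewrite -EFinM lee_fin mulr_ge0// ltW.
  - by apply: measurable_funeM; apply/measurable_EFinP; exact: measurable_indic.
  - by case/integrableP: iX.
  move=> w _; rewrite -EFinM lee_fin indicE; case: (boolP (_ \in _)) => [/set_mem /= lw|_].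
    by rewrite mulr1 -(real_normK (num_real (X w))) lerXn2r ?nnegrE ?(ltW l0).
  by rewrite mulr0 sqr_ge0.
by rewrite lee_fin.
Qed.

End SquareIntegrable.

Section Kolmogorov.
Context {R : realType} {d : measure_display} {Omega : measurableType d}.
Variables (P : probability Omega R) (G : nat -> set (set Omega)).
Hypotheses (sG : forall l, sigma_algebra setT (G l)) (Gm : forall l, G l `<=` measurable)
  (GS : forall l, G l `<=` G l.+1).
Variables (K : nat) (dd : nat -> Omega -> R) (v : nat -> R).
Hypotheses (mdd : forall l, (l < K)%N -> measurable_wrt (G l.+1) (dd l))
  (idd : forall l, (l < K)%N -> sq_integrable P (dd l))
  (vdd : forall l, (l < K)%N -> \int[P]_w dd l w ^+ 2 <= v l)
  (odd : forall l Z, (l < K)%N -> measurable_wrt (G l) Z -> sq_integrable P Z ->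
    \int[P]_w (Z w * dd l w) = 0).

(** Freezing the sums when they leave [D] makes Kolmogorov's inequality an instance of
    Chebyshev's, and keeps the martingale property. *)
Fixpoint stopped (D : set R) (l : nat) (w : Omega) : R :=
  if l is l'.+1 then stopped D l' w + \1_D (stopped D l' w) * dd l' w else 0.

(** The cross term vanishes at every step, the decision to stop being taken
    before the next increment. *)
Lemma stopped_L2 D l : measurable D -> (l <= K)%N ->
  [/\ measurable_wrt (G l) (stopped D l), sq_integrable P (stopped D l) &
      \int[P]_w stopped D l w ^+ 2 <= \sum_(j < l) v j].
Proof.
move=> mD; elim: l => [_|l IHl lK].
  split => //=.
  - apply/measurable_wrtP => //; exact: measurable_cst.
  - exact: sq_integrable0.
  by rewrite big_ord0; under eq_Rintegral do rewrite expr0n/=; rewrite Rintegral_cst// mul0r.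
have [mT iT IH] := IHl (ltnW lK); have mT' := measurable_wrt_fun (@Gm l) mT.
have mind : measurable_fun setT (fun y : R => \1_D y : R) by exact: measurable_indic.
have mU := measurableT_comp mind mT'.
have U1 w : 0 <= (\1_D (stopped D l w) : R) <= 1.
  by rewrite indicE; case: (_ \in _); rewrite ler01 lexx.
pose Z w := stopped D l w * \1_D (stopped D l w).
have mZ : measurable_wrt (G l) Z.
  apply/measurable_wrtP => //; move/measurable_wrtP : mT => mT.
  by apply: measurable_funM; [exact: mT|exact: measurableT_comp mind (mT _)].
have iZ : sq_integrable P Z.
  apply: sq_integrable_le iT; first exact: measurable_funM.
  move=> w; rewrite normrM ler_piMr//; have /andP[u0 u1] := U1 w.
  by rewrite ger0_norm.
have iU : sq_integrable P (fun w => \1_D (stopped D l w) * dd l w).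
  apply: sq_integrable_le (idd lK); first by apply: measurable_funM => //; case: (idd lK).
  move=> w; rewrite normrM ler_piMl//; have /andP[u0 u1] := U1 w.
  by rewrite ger0_norm.
have iS : sq_integrable P (stopped D l.+1) by exact: sq_integrableD.
split => //.
  apply/measurable_wrtP => //=; apply: measurable_funD.
    apply/measurable_wrtP => //; exact: measurable_wrt_sub mT.
  apply: measurable_funM; last by apply/measurable_wrtP => //; exact: mdd.
  apply: (measurableT_comp mind); apply/measurable_wrtP => //; exact: measurable_wrt_sub mT.
have iZd := sq_integrableM iZ (idd lK).
rewrite (@eq_Rintegral _ _ _ _ _ (fun w => stopped D l w ^+ 2 +
   (2 * (Z w * dd l w) + (\1_D (stopped D l w) * dd l w) ^+ 2))); last first.
  by move=> w _; rewrite /= /Z; ring.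
rewrite RintegralD//; last 2 first.
- by case: iT.
- by apply: integrableD_EFin; [exact: integrableZl_EFin|case: iU].
rewrite RintegralD//; last 2 first.
- exact: integrableZl_EFin.
- by case: iU.
rewrite RintegralZl// odd// mulr0 add0r big_ord_recr/= lerD//.
apply: le_trans (vdd lK); apply: le_Rintegral => //.
- by case: iU.
- by case: (idd lK).
move=> w _; have /andP[u0 u1] := U1 w; rewrite exprMn ler_piMl ?sqr_ge0//.
Qed.

Lemma sum_L2 : let S := fun w => \sum_(j < K) dd j w in
  [/\ measurable_wrt (G K) S, sq_integrable P S & \int[P]_w S w ^+ 2 <= \sum_(j < K) v j].
Proof.
move=> S; have -> : S = stopped setT K.
  apply/funext => w; rewrite /S; elim: (K) => [|l IH]; first by rewrite big_ord0.
  by rewrite big_ord_recr/= IH indicT mul1r.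
exact: stopped_L2 (leqnn K).
Qed.

(** The stopped sum is at a distance at least lambda from 0 at the end exactly when some partial
    sum has been so. *)
Lemma kolmogorov_ineq (lambda : R) : 0 < lambda ->
  (P [set w | exists2 l, (l <= K)%N & (lambda <= `|\sum_(j < l) dd j w|)%R]
   <= ((\sum_(j < K) v j) / lambda ^+ 2)%:E)%E.
Proof.
move=> l0; pose D := `](- lambda), lambda[%classic : set R.
have DE y : (y \in D) = (`|y| < lambda) by rewrite mem_setE in_itv/= ltr_norml.
have [_ iT vT] := stopped_L2 (measurable_itv _ : measurable D) (leqnn K).
apply: le_trans (second_moment_tail iT l0 vT).
suff -> : [set w | exists2 l, (l <= K)%N & (lambda <= `|\sum_(j < l) dd j w|)%R] =
  [set w | lambda <= `|stopped D K w| ] by [].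
have H w l : (forall j, (j < l)%N -> `|\sum_(i < j) dd i w| < lambda) ->
    stopped D l w = \sum_(j < l) dd j w.
  elim: l => [|l IH] jl; first by rewrite big_ord0.
  rewrite /= IH; last by move=> j /ltnW; exact: jl.
  by rewrite indicE DE jl// mul1r big_ord_recr.
apply/seteqP; split=> w /=.
  elim: (K) => [|k IH] [l lK ll].
    by move: ll; move: lK; rewrite leqn0 => /eqP ->; rewrite big_ord0.
  have [TK|TK] := leP lambda `|stopped D k w|.
    by rewrite /= indicE DE ltNge TK mul0r addr0.
  have jK j : (j <= k)%N -> `|\sum_(i < j) dd i w| < lambda.
    move=> jK; rewrite ltNge; apply/negP => lj.
    by have := IH (ex_intro2 _ _ j jK lj); rewrite leNgt TK.
  have lE : l = k.+1.
    apply/eqP; rewrite eqn_leq lK ltnNge; apply/negP => /jK.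
    by rewrite ltNge ll.
  by rewrite -lE H// => j; rewrite lE ltnS; exact: jK.
elim: (K) => [|k IH] /= lT; first by exists 0%N => //; rewrite big_ord0.
have [TK|TK] := leP lambda `|stopped D k w|.
  by have [l lK ll] := IH TK; exists l => //; exact: leqW.
have [[l lK ll]|nl] := pselect (exists2 l, (l <= k)%N & lambda <= `|\sum_(j < l) dd j w|).
  by exists l => //; exact: leqW.
exists k.+1 => //; rewrite -H// => j; rewrite ltnS => jK.
by rewrite ltNge; apply/negP => lj; apply: nl; exists j.
Qed.

End Kolmogorov.

Section IndependentProduct.
Context {R : realType} {d : measure_display} {Omega : measurableType d}.
Variables (P : probability Omega R) (Z X : Omega -> R).
Hypotheses (mZ : measurable_fun setT Z) (mX : measurable_fun setT X).

Lemma integral_law (N : {measure set (measurableTypeR R) -> \bar R}) (f : R -> \bar R) :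
  (forall B : set R, measurable B -> P (X @^-1` B) = N B) -> measurable_fun setT f ->
  P.-integrable setT (f \o X) -> (\int[P]_w f (X w) = \int[N]_x f x)%E.
Proof.
move=> law mf iX.
have mX' : measurable_fun setT (X : Omega -> measurableTypeR R) by exact: mX.
have mf' : measurable_fun setT (f : measurableTypeR R -> \bar R) by exact: mf.
rewrite -[LHS](@integral_pushforward _ _ _ _ _ _ mX' P setT f mf' iX measurableT).
by apply: (@eq_measure_integral _ _ _ _ N (image_measure P mX')) => A mA _; rewrite -law.
Qed.

Lemma ge0_integral_law (N : {measure set (measurableTypeR R) -> \bar R}) (f : R -> \bar R) :
  (forall B : set R, measurable B -> P (X @^-1` B) = N B) -> measurable_fun setT f ->
  (forall x, (0 <= f x)%E) -> (\int[P]_w f (X w) = \int[N]_x f x)%E.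
Proof.
move=> law mf f0.
have mX' : measurable_fun setT (X : Omega -> measurableTypeR R) by exact: mX.
have mf' : measurable_fun setT (f : measurableTypeR R -> \bar R) by exact: mf.
rewrite -[LHS](@ge0_integral_pushforward _ _ _ _ _ _ mX' P setT f measurableT mf')//.
by apply: (@eq_measure_integral _ _ _ _ N (image_measure P mX')) => A mA _; rewrite -law.
Qed.

(** Fubini, on the product of the laws of [Z] and [X]. *)
Lemma indep_mul_mean0 :
  (forall A B : set R, measurable A -> measurable B ->
    P ((Z @^-1` A) `&` (X @^-1` B)) = (P (Z @^-1` A) * P (X @^-1` B))%E) ->
  P.-integrable setT (fun w => (Z w * X w)%:E) ->
  P.-integrable setT (EFin \o X) -> (\int[P]_w (X w)%:E = 0)%E ->
  \int[P]_w (Z w * X w) = 0.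
Proof.
move=> indep iZX iX X0.
pose Zrv : {mfun Omega >-> R} := HB.pack Z (isMeasurableFun.Build _ _ _ _ _ mZ).
pose Xrv : {mfun Omega >-> R} := HB.pack X (isMeasurableFun.Build _ _ _ _ _ mX).
have mZX : measurable_fun setT (fun w => (Z w, X w)) by exact/measurable_fun_pair.
pose f (z : R * R) : \bar R := (z.1 * z.2)%:E.
have mf : measurable_fun setT f.
  by apply/measurable_EFinP; apply: measurable_funM; [exact: measurable_fst|exact: measurable_snd].
have prodE A : measurable A ->
    (distribution P Zrv \x distribution P Xrv)%E A = image_measure P mZX A.
  by apply: product_measure_unique => B C mB mC; rewrite /= /distribution/pushforward/= -indep.
have mid : measurable_fun setT (fun x : R => x%:E) by exact/measurable_EFinP.
have iN : (distribution P Xrv).-integrable setT (fun x : R => x%:E).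
  exact: (@integrable_pushforward _ _ _ _ _ _ mX).
have N0 : (\int[distribution P Xrv]_x x%:E = 0)%E.
  by rewrite integral_distribution//.
have iN2 : (image_measure P mZX).-integrable setT f.
  exact: (@integrable_pushforward _ _ _ _ _ _ mZX).
rewrite /Rintegral [X in fine X](_ : _ = 0%E)//.
rewrite -[LHS](@integral_pushforward _ _ _ _ _ _ mZX P setT f mf iZX measurableT).
transitivity (\int[(distribution P Zrv \x distribution P Xrv)%E]_z f z)%E.
  by apply: (@eq_measure_integral _ _ _ _ (distribution P Zrv \x distribution P Xrv)%E (image_measure P mZX)) => A mA _; exact/esym/prodE.
rewrite -integral12_prod_meas1; last first.
  move/integrableP: iN2 => [_ oo]; apply/integrableP; split => //.
  apply: le_lt_trans oo; rewrite le_eqVlt; apply/orP; left; apply/eqP.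
  by apply: eq_measure_integral => A mA _; exact: prodE.
transitivity (\int[distribution P Zrv]_z 0)%E; last exact: integral0.
apply: eq_integral => z _; rewrite /fubini_F /f/=.
under eq_integral do rewrite EFinM.
by rewrite integralZl// N0 mule0.
Qed.

End IndependentProduct.

Section BrownianIncrements.
Context {R : realType} {d : measure_display} {Omega : measurableType d}.
Variables (P : probability Omega R) (I : finType) (F : R -> set (set Omega))
  (W : I -> R -> Omega -> R).
Hypothesis hW : brownian_motions P F W.
Implicit Types (i : I) (s t : R) (Z : Omega -> R) (A : set Omega).

Lemma brownian_increment i s t A (B : set R) : 0 <= s -> s < t -> F s A -> measurable B ->
  P (A `&` ((fun w => W i t w - W i s w) @^-1` B)) =
  (P A * normal_prob 0%R (Num.sqrt (t - s)) B)%E.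
Proof.
move=> s0 st FA mB; have [_ _ _ _ H] := hW.
have := H s t s0 st A (fun j => if j == i then B else setT) FA.
have -> : \bigcap_(j in [set: I]) ((fun w => W j t w - W j s w) @^-1` (if j == i then B else setT))
    = (fun w => W i t w - W i s w) @^-1` B.
  apply/seteqP; split=> [w /(_ i Logic.I)|w Bw j _] /=; first by rewrite eqxx.
  by case: eqP => [->|].
move=> -> //; last by move=> j; case: ifP.
congr (_ * _)%E; rewrite (bigD1 i)//= eqxx big1 ?mule1// => j /negbTE ->.
exact: probability_setT.
Qed.

Let sG t : 0 <= t -> sigma_algebra setT (F t). Proof. by have [[h _ _] _ _ _ _] := hW; exact: h. Qed.
Let Fm t : 0 <= t -> F t `<=` measurable. Proof. by have [[_ h _] _ _ _ _] := hW; exact: h. Qed.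
Let FS s t : 0 <= s -> s <= t -> F s `<=` F t. Proof. by have [[_ _ h] _ _ _ _] := hW; exact: h. Qed.

Lemma brownian_adapted i t : 0 <= t -> measurable_wrt (F t) (W i t).
Proof. by have [_ h _ _ _] := hW; exact: h. Qed.

Lemma increment_adapted i s t : 0 <= s -> s <= t ->
  measurable_wrt (F t) (fun w => W i t w - W i s w).
Proof.
move=> s0 st; have t0 := le_trans s0 st.
apply/measurable_wrtP; first exact: sG.
apply: measurable_funB; apply/measurable_wrtP; try exact: sG.
  exact: brownian_adapted.
exact: measurable_wrt_sub (FS s0 st) (brownian_adapted _ s0).
Qed.

Lemma increment_measurable i s t : 0 <= s -> s <= t ->
  measurable_fun setT (fun w => W i t w - W i s w).
Proof.
move=> s0 st; apply: measurable_wrt_fun (increment_adapted i s0 st).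
exact: Fm (le_trans s0 st).
Qed.

Lemma increment_law i s t (B : set R) : 0 <= s -> s < t -> measurable B ->
  P ((fun w => W i t w - W i s w) @^-1` B) = normal_prob 0%R (Num.sqrt (t - s)) B.
Proof.
move=> s0 st mB; have := brownian_increment i s0 st _ mB.
have FT : F s setT by case: (sG s0) => F0 FC _; rewrite -(setD0 setT); exact: FC.
by move=> /(_ _ FT); rewrite setTI probability_setT mul1e.
Qed.

Let sqrt_neq0 s t : s < t -> Num.sqrt (t - s) != 0 :> R.
Proof. by move=> st; rewrite gt_eqF// sqrtr_gt0 subr_gt0. Qed.

(** The constant 6 is that of the bound on the second moment of a normal law. *)
Lemma increment_L2 i s t : 0 <= s -> s < t ->
  sq_integrable P (fun w => W i t w - W i s w) /\
  \int[P]_w (W i t w - W i s w) ^+ 2 <= 6 * (t - s).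
Proof.
move=> s0 st; have mX := increment_measurable i s0 (ltW st).
have msq : measurable_fun setT (fun x : R => (x ^+ 2)%:E).
  by apply/measurable_EFinP; exact: measurable_funX.
have le6 : (\int[P]_w ((W i t w - W i s w) ^+ 2)%:E <= (6 * (t - s))%:E)%E.
  rewrite (ge0_integral_law mX (fun B mB => increment_law i s0 st mB) msq); last first.
    by move=> x; rewrite lee_fin sqr_ge0.
  apply: le_trans (normal_second_moment_le (sqrt_neq0 st)) _.
  by rewrite sqr_sqrtr// subr_ge0 ltW.
have iX : P.-integrable setT (fun w => ((W i t w - W i s w) ^+ 2)%:E).
  apply/integrableP; split; first by apply/measurable_EFinP; exact: measurable_funX.
  rewrite (eq_integral (fun w => ((W i t w - W i s w) ^+ 2)%:E)).
    by apply: le_lt_trans le6 _; exact: ltry.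
  by move=> w _; rewrite gee0_abs// lee_fin sqr_ge0.
split; first by split.
by rewrite -lee_fin /Rintegral fineK//; exact: integrable_fin_num.
Qed.

Lemma increment_orth i s t Z : 0 <= s -> s < t -> measurable_wrt (F s) Z ->
  sq_integrable P Z -> \int[P]_w (Z w * (W i t w - W i s w)) = 0.
Proof.
move=> s0 st mZ iZ; have mX := increment_measurable i s0 (ltW st).
have [iX _] := increment_L2 i s0 st.
have iX1 : P.-integrable setT (EFin \o (fun w => W i t w - W i s w)).
  have i1 : sq_integrable P (cst 1).
    split; first exact: measurable_cst.
    by under eq_fun do rewrite /= expr1n; exact: finite_measure_integrable_cst.
  by have := sq_integrableM i1 iX; apply: eq_integrable => // w _ /=; rewrite mul1r.
apply: indep_mul_mean0 => //.
- exact: measurable_wrt_fun (Fm s0) mZ.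
- move=> A B mA mB; rewrite increment_law//.
  by rewrite (brownian_increment i s0 st (mZ _ mA) mB).
- exact: sq_integrableM.
rewrite (integral_law mX (fun B mB => increment_law i s0 st mB))//.
exact: normal_mean0 (sqrt_neq0 st).
Qed.

End BrownianIncrements.

Section WienerIntegralBounds.
Context {R : realType} {d : measure_display} {Omega : measurableType d}.
Variables (P : probability Omega R) (I : finType) (F : R -> set (set Omega))
  (W : I -> R -> Omega -> R).
Hypothesis hW : brownian_motions P F W.
Implicit Types (i : I) (a b s t u v : R) (X Z : Omega -> R).

Let sG t : 0 <= t -> sigma_algebra setT (F t). Proof. by have [[h _ _] _ _ _ _] := hW; exact: h. Qed.
Let Fm t : 0 <= t -> F t `<=` measurable. Proof. by have [[_ h _] _ _ _ _] := hW; exact: h. Qed.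
Let FS s t : 0 <= s -> s <= t -> F s `<=` F t. Proof. by have [[_ _ h] _ _ _ _] := hW; exact: h. Qed.

Definition wiener_sum i (sigma : R -> R) a b (m : nat) (w : Omega) : R :=
  \sum_(j < m.+1) sigma (mesh a b m.+1 j) *
    (W i (mesh a b m.+1 j.+1) w - W i (mesh a b m.+1 j) w).

Lemma mesh_ge a b m j : a <= b -> a <= mesh a b m j.
Proof. by move=> ab; rewrite -{1}(mesh0 a b m) le_mesh. Qed.

Lemma mesh_ltS a b m j : a < b -> mesh a b m.+1 j < mesh a b m.+1 j.+1.
Proof. by move=> ab; rewrite -subr_gt0 meshS divr_gt0// subr_gt0. Qed.

Lemma wiener_sum_L2 i sigma a b m v : 0 <= a -> a < b ->
  (forall u, u \in `[a, b] -> sigma u ^+ 2 * (b - a) <= v) ->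
  sq_integrable P (wiener_sum i sigma a b m) /\
  \int[P]_w wiener_sum i sigma a b m w ^+ 2 <= 6 * v.
Proof.
move=> a0 ab sv; have p0 j : 0 <= mesh a b m.+1 j := le_trans a0 (mesh_ge _ _ (ltW ab)).
have plt j := mesh_ltS m j ab.
pose dd l w := sigma (mesh a b m.+1 l) *
  (W i (mesh a b m.+1 l.+1) w - W i (mesh a b m.+1 l) w).
pose vv l := sigma (mesh a b m.+1 l) ^+ 2 * (6 * ((b - a) / m.+1%:R)).
have mdd l : (l < m.+1)%N -> measurable_wrt (F (mesh a b m.+1 l.+1)) (dd l).
  move=> _; apply/measurable_wrtP; first exact: sG.
  apply: measurable_funM; first exact: measurable_cst.
  apply/measurable_wrtP; first exact: sG.
  by apply: (increment_adapted hW) => //; exact: ltW.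
have idd l : (l < m.+1)%N -> sq_integrable P (dd l).
  by move=> _; apply: sq_integrableZ; case: (increment_L2 hW i (p0 l) (plt l)).
have vdd l : (l < m.+1)%N -> \int[P]_w dd l w ^+ 2 <= vv l.
  move=> _; have [[mX iX] vX] := increment_L2 hW i (p0 l) (plt l).
  under eq_Rintegral do rewrite exprMn.
  by rewrite RintegralZl// ler_wpM2l ?sqr_ge0// -(meshS a b m l).
have odd l Z : (l < m.+1)%N -> measurable_wrt (F (mesh a b m.+1 l)) Z ->
    sq_integrable P Z -> \int[P]_w (Z w * dd l w) = 0.
  move=> _ mZ iZ; have [iX _] := increment_L2 hW i (p0 l) (plt l).
  under eq_Rintegral do rewrite mulrCA.
  by rewrite RintegralZl//; [rewrite (increment_orth hW)// mulr0|exact: sq_integrableM].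
have [_ iS vS] := @sum_L2 _ _ _ P (fun l => F (mesh a b m.+1 l)) (fun l => sG (p0 l))
  (fun l => Fm (p0 l)) (fun l => FS (p0 l) (ltW (plt l))) m.+1 dd vv mdd idd vdd odd.
split => //; apply: le_trans vS _.
apply: le_trans (_ : \sum_(j < m.+1) (6 * v / m.+1%:R) <= _).
  apply: ler_sum => j _; rewrite [leLHS](_ : _ = 6 * (sigma (mesh a b m.+1 j) ^+ 2 * (b - a)) / m.+1%:R); last first.
    by rewrite /vv; move: (sigma _ ^+ 2) (_^-1) => x y; ring.
  by rewrite ler_wpM2r ?invr_ge0// ler_wpM2l// sv// (mesh_itv (ltW ab))// ltnW.
by rewrite sumr_const card_ord -[leLHS]mulr_natr divfK ?pnatr_eq0.
Qed.

Lemma wiener_sum_orth i sigma a b m Z : 0 <= a -> a < b -> measurable_wrt (F a) Z ->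
  sq_integrable P Z -> \int[P]_w (Z w * wiener_sum i sigma a b m w) = 0.
Proof.
move=> a0 ab mZ iZ; have p0 j : 0 <= mesh a b m.+1 j := le_trans a0 (mesh_ge _ _ (ltW ab)).
have plt j := mesh_ltS m j ab.
have iX l := (increment_L2 hW i (p0 l) (plt l)).1.
pose S k w := \sum_(j < k) sigma (mesh a b m.+1 j) *
  (W i (mesh a b m.+1 j.+1) w - W i (mesh a b m.+1 j) w).
have iS k : sq_integrable P (S k).
  rewrite /S; elim: k => [|k IHk].
    by under eq_fun do rewrite big_ord0; exact: sq_integrable0.
  by under eq_fun do rewrite big_ord_recr/=; apply: sq_integrableD => //; exact: sq_integrableZ.
suff : forall k, \int[P]_w (Z w * S k w) = 0 by move/(_ m.+1).
elim=> [|k IH].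
  by rewrite /S; under eq_Rintegral do rewrite big_ord0 mulr0; rewrite Rintegral_cst// mul0r.
rewrite (@eq_Rintegral _ _ _ _ _ (fun w => Z w * S k w + sigma (mesh a b m.+1 k) *
   (Z w * (W i (mesh a b m.+1 k.+1) w - W i (mesh a b m.+1 k) w)))); last first.
  by move=> w _; rewrite /S big_ord_recr/= mulrDr mulrCA.
rewrite RintegralD//; first last.
- by apply: integrableZl_EFin; exact: sq_integrableM.
- exact: sq_integrableM.
rewrite IH add0r RintegralZl//; last exact: sq_integrableM.
rewrite (increment_orth hW) ?mulr0//.
by apply: measurable_wrt_sub mZ; apply: FS => //; exact: mesh_ge (ltW ab).
Qed.

(** A weighted substitute for the Cauchy-Schwarz inequality, from 2 |z y| <= e z^2 + y^2 / e. *)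
Lemma young_expectation Z Y e : sq_integrable P Z -> sq_integrable P Y -> 0 < e ->
  `|\int[P]_w (Z w * Y w)| <= e * \int[P]_w Z w ^+ 2 + e^-1 * \int[P]_w Y w ^+ 2.
Proof.
move=> iZ iY e0; have iZY := sq_integrableM iZ iY.
apply: le_trans (le_normr_Rintegral _ _) _ => //.
rewrite -!RintegralZl//; [|by case: iY|by case: iZ].
have i1 : P.-integrable setT (fun w => (e * Z w ^+ 2)%:E) by apply: integrableZl_EFin; case: iZ.
have i2 : P.-integrable setT (fun w => (e^-1 * Y w ^+ 2)%:E) by apply: integrableZl_EFin; case: iY.
rewrite -RintegralD//; apply: le_Rintegral => //.
- exact: integrable_norm.
- exact: integrableD_EFin.
move=> w _; rewrite normrM -(real_normK (num_real (Z w))) -(real_normK (num_real (Y w))).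
move: `|Z w| `|Y w| (normr_ge0 (Z w)) (normr_ge0 (Y w)) => x y x0 y0.
rewrite -(ler_pM2l e0) mulrDr (mulrA e e^-1) divff ?gt_eqF// mul1r.
by have := sqr_ge0 (e * x - y); have := mulr_ge0 (ltW e0) (mulr_ge0 x0 y0); nra.
Qed.

(** Both properties pass from the Riemann sums to their limit in L2; 12 is twice the constant for
    the sums, since X^2 <= 2 (X - S)^2 + 2 S^2. *)
Lemma wiener_integral_L2 i sigma a b X v : 0 <= a -> a < b ->
  measurable_wrt (F b) X -> is_wiener_integral P (W i) sigma a b X ->
  (forall u, u \in `[a, b] -> sigma u ^+ 2 * (b - a) <= v) ->
  [/\ sq_integrable P X, \int[P]_w X w ^+ 2 <= 12 * v &
     forall Z, measurable_wrt (F a) Z -> sq_integrable P Z -> \int[P]_w (Z w * X w) = 0].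
Proof.
move=> a0 ab mX wX sv; have mX' := measurable_wrt_fun (Fm (le_trans a0 (ltW ab))) mX.
have HS m := wiener_sum_L2 i m a0 ab sv.
have small e : 0 < e -> exists m, sq_integrable P (fun w => X w - wiener_sum i sigma a b m w) /\
    \int[P]_w (X w - wiener_sum i sigma a b m w) ^+ 2 < e.
  move=> e0; move: wX; rewrite /is_wiener_integral => wX.
  have [m _ Hm] : \forall m \near \oo, ('E_P[fun w => ((X w - wiener_sum i sigma a b m w) ^+ 2)%R] < e%:E)%E.
    apply: (wX [set y | (y < e%:E)%E]); apply: open_nbhs_nbhs; split; first exact: open_ereal_lt_ereal.
    by rewrite /= lte_fin.
  exists m; have := Hm m (leqnn m); rewrite unlock => Em.
  have mY : measurable_fun setT (fun w => X w - wiener_sum i sigma a b m w).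
    by apply: measurable_funB => //; case: (HS m) => -[].
  have iY : P.-integrable setT (fun w => ((X w - wiener_sum i sigma a b m w) ^+ 2)%:E).
    apply/integrableP; split; first by apply/measurable_EFinP; exact: measurable_funX.
    rewrite (eq_integral (fun w => ((X w - wiener_sum i sigma a b m w) ^+ 2)%:E)).
      by apply: lt_trans Em _; exact: ltry.
    by move=> w _; rewrite gee0_abs// lee_fin sqr_ge0.
  by split; [split|rewrite -lte_fin /Rintegral fineK//; exact: integrable_fin_num].
have iX : sq_integrable P X.
  have [m [iY _]] := small 1 ltr01; have [iS _] := HS m.
  by have := sq_integrableD iY iS; under eq_fun do rewrite subrK.
split => //.
- apply/ler_addgt0Pr => e e0; have [m [iY Ye]] := small (e / 2) (divr_gt0 e0 (ltr0Sn _ 1)).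
  have [iS Sv] := HS m.
  have i1 : P.-integrable setT (fun w => (2 * (X w - wiener_sum i sigma a b m w) ^+ 2)%:E).
    by apply: integrableZl_EFin; case: iY.
  have i2 : P.-integrable setT (fun w => (2 * (wiener_sum i sigma a b m w) ^+ 2)%:E).
    by apply: integrableZl_EFin; case: iS.
  apply: le_trans (_ : \int[P]_w (2 * (X w - wiener_sum i sigma a b m w) ^+ 2 +
      2 * (wiener_sum i sigma a b m w) ^+ 2) <= _).
    apply: le_Rintegral => //; [by case: iX|exact: integrableD_EFin|move=> w _].
    by have := sqr_ge0 (X w - 2 * wiener_sum i sigma a b m w); nra.
  rewrite RintegralD// !RintegralZl//; [|by case: iS|by case: iY].
  by move: Sv Ye; lra.
move=> Z mZ iZ; apply/eqP; rewrite -normr_le0; apply/ler_addgt0Pr => e e0; rewrite add0r.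
pose D := \int[P]_w Z w ^+ 2 + 1.
have D0 : 0 < D by rewrite ltr_wpDl// Rintegral_ge0// => w _; exact: sqr_ge0.
have h0 : 0 < e / D by rewrite divr_gt0.
have [m [iY Ye]] := small ((e / D) ^+ 2) (exprn_gt0 2 h0).
have [iS _] := HS m.
have -> : \int[P]_w (Z w * X w) = \int[P]_w (Z w * (X w - wiener_sum i sigma a b m w)).
  rewrite -[RHS]addr0 -(wiener_sum_orth i sigma m a0 ab mZ iZ) -RintegralD//.
  - by apply: eq_Rintegral => w _; rewrite -mulrDr subrK.
  - exact: sq_integrableM.
  - exact: sq_integrableM.
apply: le_trans (young_expectation iZ iY h0) _.
apply: le_trans (_ : e / D * \int[P]_w Z w ^+ 2 + (e / D)^-1 * (e / D) ^+ 2 <= _).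
  by rewrite lerD2l ler_wpM2l ?invr_ge0 ?(ltW h0) ?(ltW Ye).
rewrite expr2 mulKf ?gt_eqF// -[X in _ + X]mulr1 -mulrDr -/D divfK ?lexx ?(gt_eqF D0)//.
Qed.

Lemma mesh_approx a b u n : a < b -> u \in `[a, b] ->
  exists2 l, (l <= n.+1)%N & `|u - mesh a b n.+1 l| <= (b - a) / n.+1%:R.
Proof.
move=> ab; rewrite in_itv/= => /andP[au ub].
have ba : 0 < b - a by rewrite subr_gt0.
have n0 : 0 < n.+1%:R :> R by rewrite ltr0n.
pose y := (u - a) / (b - a) * n.+1%:R.
have y0 : 0 <= y by rewrite mulr_ge0// divr_ge0// ?subr_ge0// ltW.
have yn : y <= n.+1%:R by rewrite ler_piMl// ler_pdivrMr// mul1r lerD2r.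
have /andP[y1 y2] := truncn_itv y0.
exists (Num.truncn y); first by rewrite -(ler_nat R) (le_trans y1).
have -> : u - mesh a b n.+1 (Num.truncn y) = (y - (Num.truncn y)%:R) * ((b - a) / n.+1%:R).
  rewrite /mesh; move: ((Num.truncn y)%:R : R) => z; rewrite /y.
  move: (n.+1%:R : R) n0 => k k0.
  by field; rewrite !gt_eqF.
have k0 : 0 < (b - a) / n.+1%:R by rewrite divr_gt0.
rewrite normrM ger0_norm ?subr_ge0// [`|_ / _|]gtr0_norm// ler_piMl ?(ltW k0)//.
by rewrite lerBlDl natr1 ltW.
Qed.

(** Kolmogorov's inequality on dyadic grids; continuity of the paths fills the
    gaps between the dyadic points. *)
Lemma wiener_max_ineq i sigma (V : R -> R) (m : R -> Omega -> R) s t e lambda :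
  0 <= s -> s < t -> 0 < e -> 0 < lambda ->
  (forall w, m s w = 0) -> (forall w, {within `[s, t], continuous (m ^~ w)}) ->
  (forall u, u \in `[s, t] -> measurable_wrt (F u) (m u)) ->
  (forall a b, s <= a -> a < b -> b <= t ->
     is_wiener_integral P (W i) sigma a b (fun w => m b w - m a w)) ->
  (forall a b u, s <= a -> a < b -> b <= t -> b - a <= e -> u \in `[a, b] ->
     sigma u ^+ 2 * (b - a) <= V b - V a) ->
  exists A, [/\ measurable A, (P A <= (12 * (V t - V s) / lambda ^+ 2)%:E)%E &
    forall w, ~ A w -> forall u, u \in `[s, t] -> `|m u w| <= lambda].
Proof.
move=> s0 st e0 l0 m0 mC mA mW mV.
have [n0 n0P] : exists n0, forall n, (n0 <= n)%N -> (t - s) / n.+1%:R < e.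
  by have [n0 _ H] := near_mesh_lt s t e0; exists n0.
(* The grids have to be nested, and fine enough for the variance bound to apply to each cell. *)
pose N k := (2 ^ (k + n0))%N.
have N0 k : (0 < N k)%N by rewrite expn_gt0.
have Nn k : (n0 <= (N k).-1)%N.
  rewrite -ltnS prednK// /N; apply: leq_trans (ltn_expl n0 (ltnSn 1)) _.
  by rewrite leq_exp2l// leq_addl.
pose q k l := mesh s t (N k) l.
have qin k l : (l <= N k)%N -> q k l \in `[s, t].
  by move=> lN; rewrite /q -(prednK (N0 k)) mesh_itv// ?prednK// ltW.
have qs k l : s <= q k l by exact: mesh_ge (ltW st).
have q0 k l : 0 <= q k l := le_trans s0 (qs k l).
have qlt k l : q k l < q k l.+1 by rewrite /q -(prednK (N0 k)) mesh_ltS.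
have qS k l : q k l.+1 - q k l <= e.
  by rewrite /q -(prednK (N0 k)) meshS ltW// n0P.
have qt k l : (l < N k)%N -> q k l.+1 <= t by move=> /qin; rewrite in_itv => /andP[].
pose A k := \bigcup_(l in [set l | (l <= N k)%N]) [set w | lambda <= `|m (q k l) w| ].
have mm k l : (l <= N k)%N -> measurable_fun setT (m (q k l)).
  by move=> lN; apply: measurable_wrt_fun (mA _ (qin _ _ lN)); exact: Fm.
have mAk k : measurable (A k).
  apply: bigcup_measurable => l lN.
  rewrite (_ : [set w | _] = (fun w => `|m (q k l) w|) @^-1` `[lambda, +oo[); last first.
    by apply/seteqP; split=> w /=; rewrite in_itv/= andbT.
  rewrite -[X in measurable X]setTI; apply: measurableT_comp => //.
  by apply: measurableT_comp => //; exact: mm.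
have PA k : (P (A k) <= (12 * (V t - V s) / lambda ^+ 2)%:E)%E.
  pose dd l w := m (q k l.+1) w - m (q k l) w.
  pose vv l := 12 * (V (q k l.+1) - V (q k l)).
  have mdd l : (l < N k)%N -> measurable_wrt (F (q k l.+1)) (dd l).
    move=> lN; apply/measurable_wrtP; first exact: sG.
    apply: measurable_funB; apply/measurable_wrtP; try exact: sG.
      exact/mA/qin.
    by apply: measurable_wrt_sub (mA _ (qin _ _ (ltnW lN))); exact: FS (ltW (qlt _ _)).
  have H l (lN : (l < N k)%N) := @wiener_integral_L2 i sigma _ _ (dd l) _ (q0 k l) (qlt k l) (mdd l lN)
    (mW _ _ (qs _ _) (qlt _ _) (qt _ _ lN))
    (fun u => mV _ _ u (qs _ _) (qlt _ _) (qt _ _ lN) (qS _ _)).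
  have idd l : (l < N k)%N -> sq_integrable P (dd l) by move=> /H[].
  have vdd l : (l < N k)%N -> \int[P]_w dd l w ^+ 2 <= vv l by move=> /H[].
  have odd l Z : (l < N k)%N -> measurable_wrt (F (q k l)) Z -> sq_integrable P Z ->
    \int[P]_w (Z w * dd l w) = 0 by move=> /H[_ _]; exact.
  have := @kolmogorov_ineq _ _ _ P (fun l => F (q k l)) (fun l => sG (q0 k l))
    (fun l => Fm (q0 k l)) (fun l => FS (q0 k l) (ltW (qlt k l))) (N k) dd vv mdd idd vdd odd lambda l0.
  have -> : \sum_(j < N k) vv j = 12 * (V t - V s).
    rewrite -big_distrr/= -(big_mkord xpredT (fun j => V (q k j.+1) - V (q k j))).
    by rewrite telescope_sumr// /q mesh0 -{2}(prednK (N0 k)) -(prednK (N0 k)) meshn.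
  apply: le_trans; rewrite le_eqVlt; apply/orP; left; apply/eqP; congr (P _).
  have E l w : \sum_(j < l) dd j w = m (q k l) w.
    rewrite -(big_mkord xpredT (fun j => m (q k j.+1) w - m (q k j) w)).
    by rewrite telescope_sumr// {2}/q mesh0 m0 subr0.
  by apply/seteqP; split=> w /= [l lN ll]; exists l => //; move: ll; rewrite /= E.
have ndA : nondecreasing_seq A.
  apply/nondecreasing_seqP => k; rewrite subsetEset => w [l /= lN ll].
  exists (2 * l)%N; first by rewrite /= /N addSn expnS leq_mul2l.
  rewrite /= (_ : q k.+1 (2 * l)%N = q k l)//.
  by rewrite /q /mesh /N addSn expnS !natrM -mulf_div divff ?mul1r// pnatr_eq0.
exists (\bigcup_k A k); split.
- exact: bigcup_measurable.
- have cA : P (A k) @[k --> \oo] --> P (\bigcup_k A k).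
    by apply: nondecreasing_cvg_mu => //; exact: bigcup_measurable.
  rewrite -(cvg_lim _ cA)//; apply: lime_le; first by apply/cvg_ex; eexists; exact: cA.
  by near=> k.
move=> w nA u ust; rewrite leNgt; apply/negP => lu.
have nAk k l : (l <= N k)%N -> `|m (q k l) w| < lambda.
  by move=> lN; rewrite ltNge; apply/negP => ll; apply: nA; exists k => //; exists l.
have /within_continuous_epsP/(_ u ust (`|m u w| - lambda)) := mC w.
rewrite subr_gt0 => /(_ lu)[del d0 dP].
have [k kP] : exists k, (t - s) / (N k)%:R < del.
  have [n1 _ Hn] := near_mesh_lt s t d0; exists n1.
  have := Hn (N n1).-1; rewrite /= prednK//; apply.
  rewrite -ltnS prednK// /N; apply: leq_trans (ltn_expl n1 (ltnSn 1)) _.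
  by rewrite leq_exp2l// leq_addr.
have [l lN ul] := mesh_approx (N k).-1 st ust; rewrite prednK// in lN ul.
have := dP _ (qin _ _ lN) (le_lt_trans ul kP).
have := nAk k l lN; have := lerB_dist (m u w) (m (q k l) w); lra.
Unshelve. all: end_near. Qed.

End WienerIntegralBounds.

(** * The limit equation, solved pathwise *)

Section Calculus.
Context {R : realType}.
Implicit Types (f g F : R -> R) (a b s t u x : R).
Local Notation mu := (@lebesgue_measure R).

Lemma Rintegral_is_derive f F a b : a < b ->
  (forall x, x \in `[a, b] -> is_derive x 1 F (f x)) -> {within `[a, b], continuous f} ->
  \int[mu]_(x in `[a, b]) f x = F b - F a.
Proof.
move=> ab dF cf; have cF x : x \in `[a, b] -> {for x, continuous F}.
  by move=> /dF /is_derive_continuous.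
rewrite /Rintegral (@continuous_FTC2 _ _ F)//.
  split.
  - by move=> x /subset_itv_oo_cc /dF [].
  - by apply: cvg_at_right_filter; apply: cF; rewrite bound_itvE ltW.
  - by apply: cvg_at_left_filter; apply: cF; rewrite bound_itvE ltW.
by move=> x /subset_itv_oo_cc /dF dFx; rewrite derive1E derive_val.
Qed.

Lemma is_derive_Rintegral f a x u : a < x -> x < u -> {within `[a, u], continuous f} ->
  is_derive x 1 (fun y => \int[mu]_(v in `[a, y]) f v) (f x).
Proof.
move=> ax xu cf; have fx : {for x, continuous f}.
  have : x \in `]a, u[ by rewrite in_itv/= ax.
  by apply: within_continuous_continuous cf; exact: lt_trans xu.
have [df f'x] := continuous_FTC1_closed xu (within_continuous_integrable cf) ax fx.
by apply: DeriveDef; [exact: df|rewrite -derive1E f'x].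
Qed.

(** Composing with the absolute value makes the function continuous on the whole line, where
    products and compositions are at hand. *)
Lemma half_line_continuousP f : {within `[0, +oo[, continuous f} <->
  continuous (fun u => f `|u|).
Proof.
split=> [/within_continuous_epsP cf x|cf].
  apply/cvgrPdist_lt => e e0; have nx : `[0, +oo[%classic `|x| by rewrite /= in_itv/= normr_ge0.
  have [d d0 dP] := cf _ nx e e0; near=> y; apply: dP; first by rewrite /= in_itv/= normr_ge0.
  apply: le_lt_trans (ler_dist_dist x y) _; near: y.
  by exists d => //= y.
apply/within_continuous_epsP => x; rewrite /= in_itv/= andbT => x0 e e0.
have [d /= d0 dP] := (cvgrPdist_lt _ _).1 (cf x) e e0.
exists d => // y; rewrite /= in_itv/= andbT => y0 xy.
by have := dP y xy; rewrite /= (ger0_norm x0) (ger0_norm y0).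
Unshelve. all: end_near. Qed.

Lemma half_line_itv f a b : 0 <= a -> {within `[0, +oo[, continuous f} ->
  {within `[a, b], continuous f}.
Proof.
by move=> a0; apply: continuous_subspaceW; apply: subset_itv; rewrite bnd_simp.
Qed.

Lemma half_line_at f u : {within `[0, +oo[, continuous f} -> 0 < u -> {for u, continuous f}.
Proof.
move=> cf u0; have : u \in `]0, u + 1[ by rewrite in_itv/= u0 ltrDl/=.
apply: within_continuous_continuous (half_line_itv (lexx 0) cf).
by rewrite ltr_wpDl// ltW.
Qed.

End Calculus.

Section WeightedAverage.
Context {R : realType}.
Implicit Types (f g : R -> R) (s t u v T M L : R) (n : nat).
Local Notation mu := (@lebesgue_measure R).
Local Notation hcontinuous f := {within `[0, +oo[, continuous f}.

(** For [0 < n] and [0 < t] this is t^-n times the integral of u^(n-1) f(u) over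
    [0, t]; the form chosen here has no singularity at 0. *)
Definition wavg n f t : R := \int[mu]_(v in `[0, 1]) (v ^+ n.-1 * f (t * v)).

Lemma wavg_integrand_continuous n f t : hcontinuous f -> 0 <= t ->
  {within `[0, 1], continuous (fun v => v ^+ n.-1 * f (t * v))}.
Proof.
move=> /half_line_continuousP cf t0.
apply: (@subspace_eq_continuous _ _ _ (fun v => v ^+ n.-1 * f `|t * v|)).
  move=> v /set_mem/=; rewrite in_itv/= => /andP[v0 v1].
  by rewrite ger0_norm// mulr_ge0.
apply: continuous_subspaceT => v; apply: cvgM; first exact: exprn_continuous.
apply: (@continuous_comp _ _ _ (fun v => t * v) (fun u => f `|u|)); last exact: cf.
by apply: cvgM; [exact: cvg_cst|exact: cvg_id].
Qed.

Lemma wavg_le n f t M : hcontinuous f -> 0 <= t ->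
  (forall u, u \in `[0, t] -> `|f u| <= M) -> `|wavg n f t| <= M.
Proof.
move=> cf t0 fM; have := @Rintegral_near_cst _ _ 0 1 0 M ler01 (@wavg_integrand_continuous n _ _ cf t0).
rewrite mul0r !subr0 mulr1; apply => v; rewrite in_itv/= => /andP[v0 v1].
rewrite subr0 normrM normrX ger0_norm// -[leRHS]mul1r ler_pM ?exprn_ge0//.
  by rewrite exprn_ile1.
by apply: fM; rewrite in_itv/= mulr_ge0//= ler_piMr.
Qed.

Lemma wavgB n f g t : hcontinuous f -> hcontinuous g -> 0 <= t ->
  wavg n (fun u => f u - g u) t = wavg n f t - wavg n g t.
Proof.
move=> cf cg t0; rewrite /wavg -RintegralB//.
- by apply: eq_Rintegral => v _; rewrite mulrBr.
- exact/within_continuous_integrable/wavg_integrand_continuous.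
- exact/within_continuous_integrable/wavg_integrand_continuous.
Qed.

Lemma wavgZ n c f t : hcontinuous f -> 0 <= t ->
  wavg n (fun u => c * f u) t = c * wavg n f t.
Proof.
move=> cf t0; rewrite /wavg -RintegralZl//.
  by apply: eq_Rintegral => v _; rewrite mulrCA.
exact/within_continuous_integrable/wavg_integrand_continuous.
Qed.

(** Immediate from the form of the definition; it is what makes the solution commute with
    scaling. *)
Lemma wavg_scale n f L t : wavg n (fun u => f (L * u)) t = wavg n f (L * t).
Proof. by apply: eq_Rintegral => v _; rewrite mulrA. Qed.

Lemma eq_wavg n f g t : 0 <= t -> (forall u, 0 <= u -> f u = g u) -> wavg n f t = wavg n g t.
Proof.
move=> t0 fg; apply: eq_Rintegral => v /set_mem/=; rewrite in_itv/= => /andP[v0 _].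
by rewrite fg// mulr_ge0.
Qed.

(** The integrand is uniformly continuous in t on compact sets. *)
Lemma wavg_continuous n f : hcontinuous f -> hcontinuous (wavg n f).
Proof.
move=> cf; apply/within_continuous_epsP => t; rewrite /= in_itv/= andbT => t0 e e0.
have [d d0 dP] := within_unif_continuous (@half_line_itv _ _ _ (t + 1) (lexx 0) cf) (divr_gt0 e0 (ltr0Sn R 1)).
exists (Num.min d 1) => [|s]; first by rewrite lt_min d0 ltr01.
rewrite /= in_itv/= andbT lt_min => s0 /andP[ts t1].
have cB : {within `[0, 1], continuous (fun v => v ^+ n.-1 * f (t * v) - v ^+ n.-1 * f (s * v))}.
  by move=> v; apply: cvgB; exact: wavg_integrand_continuous.
rewrite /wavg -RintegralB//; [|exact/within_continuous_integrable/wavg_integrand_continuous..].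
have := @Rintegral_near_cst _ _ 0 1 0 (e / 2) ler01 cB.
rewrite mul0r !subr0 mulr1 => h; apply: le_lt_trans (h _) _; last by lra.
move=> v; rewrite in_itv/= => /andP[v0 v1].
rewrite subr0 -mulrBr normrM normrX ger0_norm// -[leRHS]mul1r ler_pM ?exprn_ge0//.
  by rewrite exprn_ile1.
apply/ltW/dP.
- by rewrite in_itv/= mulr_ge0//= (le_trans (ler_piMr _ v1))// lerDl.
- rewrite in_itv/= mulr_ge0//= (le_trans (ler_piMr _ v1))//.
  by move: t1; rewrite ltr_norml => /andP[]; lra.
by rewrite -mulrBl normrM [`|v|]ger0_norm// (le_lt_trans (ler_piMr _ v1)).
Qed.

Lemma wavgE n f t : (0 < n)%N -> 0 < t -> hcontinuous f ->
  wavg n f t = t ^- n * \int[mu]_(u in `[0, t]) (u ^+ n.-1 * f u).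
Proof.
move=> n0 t0 cf; have cg : hcontinuous (fun u => u ^+ n.-1 * f u).
  move=> u; apply: cvgM (cf u).
  by apply: (@continuous_subspaceT _ _ _ (fun u : R => u ^+ n.-1)); exact: exprn_continuous.
have := @Rintegral_scale _ (fun u => u ^+ n.-1 * f u) 1 t t0 ler01 (half_line_itv (lexx 0) cg).
rewrite mulr1 => ->.
under eq_Rintegral do rewrite exprMn -mulrA.
rewrite RintegralZl//; last exact/within_continuous_integrable/wavg_integrand_continuous/ltW.
rewrite -/(wavg n f t) [t * (_ * _)]mulrA -exprS prednK// mulKf//.
by rewrite expf_neq0// gt_eqF.
Qed.

(** With J the integral of u^(n-1) f(u) over [0, t], the derivative of t^-n J is
    -n t^(-n-1) J + t^-1 f(t). *)
Lemma is_derive_wavg n f t : (0 < n)%N -> 0 < t -> hcontinuous f ->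
  is_derive t 1 (wavg n f) ((f t - n%:R * wavg n f t) / t).
Proof.
move=> n0 t0 cf; have cg : hcontinuous (fun u => u ^+ n.-1 * f u).
  move=> u; apply: cvgM (cf u).
  by apply: (@continuous_subspaceT _ _ _ (fun u : R => u ^+ n.-1)); exact: exprn_continuous.
pose J u := \int[mu]_(v in `[0, u]) (v ^+ n.-1 * f v).
have dJ : is_derive t 1 J (t ^+ n.-1 * f t).
  apply: (@is_derive_Rintegral _ (fun u => u ^+ n.-1 * f u) 0 t (t + 1)) => //.
    by rewrite ltrDl.
  exact: half_line_itv cg.
have tn0 : t ^+ n != 0 by rewrite expf_neq0// gt_eqF.
have dV : is_derive t 1 (fun u => (u ^+ n)^-1) (- (t ^+ n) ^- 2 * (n%:R * t ^+ n.-1)).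
  exact: (@is_deriveV _ (fun u : R => u ^+ n) t _ 1 tn0 (pw_is_deriveX n t)).
apply: (@near_eq_is_derive _ _ _ (fun u => (u ^+ n)^-1 * J u)).
  near=> u; apply/esym; apply: wavgE => //; near: u; exact: lt_nbhsr.
refine (is_derive_eq (pw_is_deriveM dV dJ) _).
rewrite (wavgE n0 t0 cf) -/(J t); move: (J t) (f t) => j y.
case: (n) n0 tn0 => // k _ /=; rewrite !exprS mulf_eq0 negb_or => /andP[t1 t2].
by move: (t ^+ k) t2 => z z0; field; rewrite t1 z0.
Unshelve. all: end_near. Qed.

End WeightedAverage.

Section LimitSolution.
Context {R : realType}.
Implicit Types (w : nat -> nat -> R -> R) (f : R -> R) (s t u v T S L : R) (n k : nat).
Local Notation mu := (@lebesgue_measure R).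
Local Notation hcontinuous f := {within `[0, +oo[, continuous f}.

(** The solution, started from 0 at time 0, of the limiting equation driven by the path [w];
    level n is obtained from level n - 1 by variation of constants, after an integration by
    parts that removes the differential of [w], a path without bounded variation. *)
Fixpoint lim_sol w n k : R -> R :=
  if n is n'.+1 then fun t => w n k t + wavg n'
    (fun u => (k%:R - 1) * lim_sol w n' k.-1 u + (n%:R - k%:R) * lim_sol w n' k u
              - n'%:R * w n k u) t
  else fun=> 0.

Definition lim_src w n k u : R :=
  (k%:R - 1) * lim_sol w n k.-1 u + (n.+1%:R - k%:R) * lim_sol w n k u - n%:R * w n.+1 k u.

Lemma lim_solS w n k t : lim_sol w n.+1 k t = w n.+1 k t + wavg n (lim_src w n k) t.
Proof. by []. Qed.

Lemma lim_sol_continuous w n k : (forall n k, hcontinuous (w n k)) ->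
  hcontinuous (lim_sol w n k) /\ hcontinuous (lim_src w n k).
Proof.
move=> cw; elim: n k => [|n IH] k.
  have c0 : hcontinuous (fun _ : R => 0 : R) by apply: continuous_subspaceT => u; exact: cvg_cst.
  split => // u; apply: cvgB; last by apply: cvgM (cw _ _ u); exact: cvg_cst.
  by apply: cvgD; apply: cvgM (c0 u); exact: cvg_cst.
have cS j : hcontinuous (lim_sol w n.+1 j).
  by move=> u; apply: cvgD (cw _ _ u) _; apply: wavg_continuous; case: (IH j).
split => // u; apply: cvgB; last by apply: cvgM (cw _ _ u); exact: cvg_cst.
by apply: cvgD; apply: cvgM (cS _ u); exact: cvg_cst.
Qed.

Lemma lim_sol_bound n k : exists2 C, 0 <= C & forall w T S,
  (forall n k, hcontinuous (w n k)) ->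
  (forall n k u, u \in `[0, T] -> `|w n k u| <= S) ->
  forall t, t \in `[0, T] -> `|lim_sol w n k t| <= C * S.
Proof.
elim: n k => [|n IH] k.
  by exists 0 => // w T S _ _ t _; rewrite normr0 mul0r.
have [C1 C10 H1] := IH k.-1; have [C2 C20 H2] := IH k.
exists (1 + (`|k%:R - 1| * C1 + `|n.+1%:R - k%:R| * C2 + n%:R)).
  by rewrite !addr_ge0// mulr_ge0.
move=> w T S cw wS t; rewrite in_itv/= => /andP[t0 tT].
have {wS}wS m j u : u \in `[0, t] -> `|w m j u| <= S.
  by move=> ut; apply: wS; apply: subset_itvl ut; rewrite bnd_simp.
rewrite -[X in `|X|]/(w n.+1 k t + wavg n (lim_src w n k) t) mulrDl mul1r.
apply: le_trans (ler_normD _ _) _; rewrite lerD//.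
  by apply: wS; rewrite in_itv/= t0 lexx.
apply: wavg_le => //; first by case: (@lim_sol_continuous w n k cw).
move=> u ut; rewrite /lim_src [leRHS]mulrDl; apply: le_trans (ler_normB _ _) _; apply: lerD.
  rewrite [leRHS]mulrDl; apply: le_trans (ler_normD _ _) _; rewrite !normrM -!mulrA.
  by apply: lerD; rewrite ler_wpM2l//; [exact: H1 ut|exact: H2 ut].
by rewrite normrM ger0_norm// ler_wpM2l//; exact: wS.
Qed.

Lemma lim_solB w1 w2 n k t : (forall n k, hcontinuous (w1 n k)) ->
  (forall n k, hcontinuous (w2 n k)) -> 0 <= t ->
  lim_sol (fun n k u => w1 n k u - w2 n k u) n k t = lim_sol w1 n k t - lim_sol w2 n k t.
Proof.
move=> c1 c2; elim: n k t => [|n IH] k t t0; first by rewrite subr0.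
have [_ s1] := @lim_sol_continuous _ n k c1; have [_ s2] := @lim_sol_continuous _ n k c2.
rewrite !lim_solS opprD addrACA -wavgB//; congr (_ + _).
apply: eq_wavg => // u u0; rewrite /lim_src !IH//.
move: (lim_sol w1) (lim_sol w2) => y1 y2; ring.
Qed.

Lemma lim_sol_scale w c L n k t : (forall n k, hcontinuous (w n k)) -> 0 < L -> 0 <= t ->
  lim_sol (fun n k u => c * w n k (L * u)) n k t = c * lim_sol w n k (L * t).
Proof.
move=> cw L0; elim: n k t => [|n IH] k t t0; first by rewrite mulr0.
have [_ sc] := @lim_sol_continuous _ n k cw.
have Lt0 : 0 <= L * t by rewrite mulr_ge0// ltW.
rewrite !lim_solS mulrDr; congr (_ + _); rewrite -wavgZ//.
rewrite -[RHS](wavg_scale n (fun u => c * lim_src w n k u)).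
apply: eq_wavg => // u u0; rewrite /lim_src !IH//.
move: (lim_sol w n) => y; ring.
Qed.

(** The derivative of the weighted average supplies the drift. *)
Lemma lim_sol_sde w n k s t : (forall n k, hcontinuous (w n k)) -> 0 < s -> s < t ->
  lim_sol w n.+1 k t - lim_sol w n.+1 k s =
  \int[mu]_(u in `[s, t]) ((- n%:R * lim_sol w n.+1 k u + (k%:R - 1) * lim_sol w n k.-1 u
     + (n.+1%:R - k%:R) * lim_sol w n k u) / u) + (w n.+1 k t - w n.+1 k s).
Proof.
move=> cw s0 st; have [cy cs] := @lim_sol_continuous _ n k cw.
have -> : lim_sol w n.+1 k t - lim_sol w n.+1 k s =
  wavg n (lim_src w n k) t - wavg n (lim_src w n k) s + (w n.+1 k t - w n.+1 k s).
  by rewrite !lim_solS; ring.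
congr (_ + _); have ge0 u : u \in `[s, t] -> 0 < u.
  by rewrite in_itv/= => /andP[su _]; exact: lt_le_trans su.
case: n cy cs => [|n] cy cs.
  rewrite (_ : lim_src w 0 k = fun=> 0); last first.
    by apply/funext => u; rewrite /lim_src /= !mulr0 mul0r addr0 subr0.
  rewrite /wavg; under eq_Rintegral do rewrite mulr0.
  rewrite subrr; under eq_Rintegral do rewrite !mulr0 oppr0 mul0r !addr0 mul0r.
  by rewrite Rintegral_cst// mul0r.
have dF u : u \in `[s, t] -> is_derive u 1 (wavg n.+1 (lim_src w n.+1 k))
    ((lim_src w n.+1 k u - n.+1%:R * wavg n.+1 (lim_src w n.+1 k) u) / u).
  by move=> /ge0 u0; exact: is_derive_wavg.
have hs := half_line_itv (ltW s0) cs; have hw := half_line_itv (ltW s0) (@wavg_continuous _ n.+1 _ cs).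
have hi : {within `[s, t], continuous (fun u : R => u^-1)}.
  apply: continuous_in_subspaceT => u /set_mem /ge0 u0.
  by apply: inv_continuous; rewrite gt_eqF.
rewrite -(Rintegral_is_derive st dF).
  apply: eq_Rintegral => u _; rewrite lim_solS /lim_src; congr (_ / _).
  by move: (lim_sol w n.+1) => y; ring.
move=> u; apply: cvgM (hi u).
by apply: cvgB (hs t u) _; apply: cvgM (hw t u); exact: cvg_cst.
Qed.

End LimitSolution.

(** * Comparison of the two equations *)

Section Barrier.
Context {R : realType}.
Implicit Types (a b u v : R) (I : finType).

(** The first instant at which one of finitely many continuous functions reaches 0: the infimum
    of the instants at which their maximum is nonnegative. *)
Lemma first_crossing I (f : I -> R -> R) a b i0 : a <= b ->
  (forall i, {within `[a, b], continuous (f i)}) -> (forall i, f i a < 0) -> 0 <= f i0 b ->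
  exists u i, [/\ a < u <= b, 0 <= f i u, forall v j, a <= v < u -> f j v < 0 &
    forall j, f j u <= 0].
Proof.
move=> ab cf fa fb.
pose B := [set u | u \in `[a, b] /\ exists i, 0 <= f i u].
have bB : B b by split; [rewrite bound_itvE|exists i0].
have lbB : lbound B a by move=> u [+ _]; rewrite in_itv => /andP[].
have hB : has_inf B by split; [exists b|exists a].
have au : a <= inf B by apply: lb_le_inf; [exists b|].
have ub : inf B <= b by apply: ge_inf => //; exists a.
have uab : inf B \in `[a, b] by rewrite in_itv/= au.
have before v j : a <= v < inf B -> f j v < 0.
  move=> /andP[av vu]; rewrite ltNge; apply/negP => fv; have : B v.
    by split; [rewrite in_itv/= av (le_trans (ltW vu))|exists j].
  by move=> /(ge_inf (ex_intro _ a lbB)); rewrite leNgt vu.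
have [i fi] : exists i, 0 <= f i (inf B).
  apply: contrapT => nf; have fn i : f i (inf B) < 0.
    by rewrite ltNge; apply/negP => fi; apply: nf; exists i.
  have [K HK] : exists K, forall v, K <= v -> forall i, 0 < v -> forall y, y \in `[a, b] ->
      `|inf B - y| < v^-1 -> f i y < 0.
    apply: fin_eventually => i; have /within_continuous_epsP/(_ _ uab (- f i (inf B))) := cf i.
    rewrite oppr_gt0 => /(_ (fn i))[d d0 dP]; exists d^-1 => v dv v0 y yab yu.
    have yd : `|inf B - y| < d.
      by apply: lt_le_trans yu _; rewrite -[leRHS]invrK lef_pV2 ?posrE ?invr_gt0.
    by have := dP y yab yd; rewrite ltr_norml => /andP[]; lra.
  have v0 : 0 < Num.max K 1 by rewrite lt_max ltr01 orbT.
  have iv0 : 0 < (Num.max K 1)^-1 by rewrite invr_gt0.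
  have [y [yab [i fiy]] yu] := inf_adherent iv0 hB.
  have uy : inf B <= y by apply: ge_inf; [exists a|split => //; exists i].
  have : `|inf B - y| < (Num.max K 1)^-1.
    by rewrite distrC ger0_norm ?subr_ge0//; lra.
  by move=> /(HK (Num.max K 1) _ i v0 y yab); rewrite le_max lexx ltNge fiy => /(_ isT).
have au' : a < inf B.
  by rewrite lt_neqAle au andbT; apply: contraTneq (fa i) => ->; rewrite -leNgt.
exists (inf B), i; split => //; first by rewrite au'.
move=> j; rewrite leNgt; apply/negP => fj.
have /within_continuous_epsP/(_ _ uab _ fj)[d d0 dP] := cf j.
pose y := Num.max a (inf B - d / 2).
have yu : y < inf B by rewrite gt_max au' ltrBlDr ltrDl divr_gt0.
have ay : a <= y by rewrite le_max lexx.
have yab : `[a, b]%classic y by rewrite /= in_itv/= ay (le_trans (ltW yu)).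
have yd : `|inf B - y| < d.
  rewrite gtr0_norm ?subr_gt0//; have : inf B - d / 2 <= y by rewrite le_max lexx orbT.
  by lra.
have := dP y yab yd; rewrite ltr_norml => /andP[].
by have := before y j; rewrite ay yu => /(_ isT); lra.
Qed.

Lemma is_derive_lt0_left (g : R -> R) u dg d : is_derive u 1 g dg -> dg < 0 -> 0 < d ->
  exists2 y, u - d < y < u & g u < g y.
Proof.
move=> [dgu gE] dg0 d0; rewrite -gE in dg0.
have : \forall h \near 0^', h^-1 *: ((g \o shift u) (h *: 1) - g u) < 0.
  exact: (cvgr_lt _ dgu) dg0.
rewrite /dnbhs near_withinE => -[e /= e0 eP].
pose h := Num.min e d / 2; have m0 : 0 < Num.min e d by rewrite lt_min e0.
have h0 : 0 < h by rewrite divr_gt0.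
have he : h < e by apply: lt_le_trans (_ : Num.min e d <= _); rewrite ?ge_min ?lexx// /h; lra.
have hd : h < d by apply: lt_le_trans (_ : Num.min e d <= _); rewrite ?ge_min ?lexx ?orbT// /h; lra.
exists (u - h); first by apply/andP; split; lra.
have := eP (- h); rewrite /ball_/= sub0r opprK gtr0_norm// => /(_ he).
rewrite oppr_eq0 gt_eqF// => /(_ isT).
rewrite /= /GRing.scale/= mulr1 invrN mulNr oppr_lt0 pmulr_rgt0 ?invr_gt0//.
by rewrite subr_gt0 addrC.
Qed.

(** No component can be the first to reach the barrier [V], since on touching it
    a component grows more slowly than [V]. *)
Lemma barrier I (y g : I -> R -> R) (V dV : R -> R) a b : a <= b ->
  (forall i, {within `[a, b], continuous (y i)}) -> {within `[a, b], continuous V} ->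
  (forall i, `|y i a| < V a) ->
  (forall i u, a < u <= b -> is_derive u 1 (y i) (g i u)) ->
  (forall u, a < u <= b -> is_derive u 1 V (dV u)) ->
  (forall i u, a < u <= b -> (forall j, `|y j u| <= V u) ->
     (y i u = V u -> g i u < dV u) /\ (y i u = - V u -> - dV u < g i u)) ->
  forall i u, u \in `[a, b] -> `|y i u| <= V u.
Proof.
move=> ab cy cV ya dy dV' slow i u; rewrite in_itv/= => /andP[au ub].
rewrite leNgt; apply/negP => Vy.
(* The boolean is the sign, so that both sides of the barrier are treated at once. *)
pose f (k : I * bool) v := (-1) ^+ k.2 * y k.1 v - V v.
have cf k : {within `[a, u], continuous (f k)}.
  move=> v; apply: cvgB; last exact: itv_subset_continuous cV _ _ _.
  by apply: cvgM; [exact: cvg_cst|exact: itv_subset_continuous (cy _) _ _ _].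
have fa k : f k a < 0.
  have := ya k.1; rewrite /f subr_lt0 ltr_norml => /andP[].
  by case: k => j [] /=; rewrite ?expr1 ?expr0 ?mulN1r ?mul1r//; lra.
have [s fs] : exists s, 0 <= f (i, s) u.
  move: Vy; rewrite ltNge ler_norml negb_and -!ltNge /f => /orP[h|h]; [exists true|exists false];
  by rewrite /= ?expr1 ?expr0 ?mulN1r ?mul1r; lra.
have [t [[j s'] [/andP[at_ tu] fj bef ft]]] := first_crossing au cf fa fs.
have tb : a < t <= b by rewrite at_ (le_trans tu).
have yV l : `|y l t| <= V t.
  have := ft (l, true); have := ft (l, false); rewrite /f/= expr1 expr0 mulN1r mul1r ler_norml.
  by move=> ? ?; apply/andP; split; lra.
have f0 : f (j, s') t = 0 by apply/eqP; rewrite eq_le fj ft.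
have [sl1 sl2] := slow j t tb yV.
have df : is_derive t 1 (f (j, s')) ((-1) ^+ s' * g j t - dV t).
  by apply: pw_is_deriveB (dV' t tb); apply: pw_is_deriveZ; exact: dy.
have : (-1) ^+ s' * g j t - dV t < 0.
  move: f0; rewrite /f/=; case: (s') => /=; rewrite ?expr1 ?expr0 ?mulN1r ?mul1r => f0.
    by have : - dV t < g j t by [apply: sl2; lra]; lra.
  by have : g j t < dV t by [apply: sl1; lra]; lra.
have ta0 : 0 < t - a by rewrite subr_gt0.
move=> /(is_derive_lt0_left df) /(_ ta0)[v /andP[av vt]]; rewrite f0 => fv.
have := bef v (j, s'); rewrite vt andbT => /(_ _); rewrite ltNge (ltW fv) => H.
by have : false by [apply: H; lra].
Qed.

End Barrier.

Section Entries.
Context {R : realType} (N : nat).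
Implicit Types (v w : tri N -> R) (n k : nat) (i j : tri N).

Lemma tri_inj i j : level i = level j -> kpos i = kpos j -> i = j.
Proof.
rewrite /level /kpos => lij kij; apply/val_inj.
by move: (val i) (val j) lij kij => [p q] [p' q'] /= qq pp; congr pair; exact: val_inj.
Qed.

Lemma entryE v i : entry v (level i) (kpos i) = v i.
Proof.
rewrite /entry (big_pred1 i)// => j /=; apply/andP/eqP => [[/eqP lj /eqP kj]|->//].
exact: tri_inj.
Qed.

(** Outside the array all entries vanish, the convention for the boundary. *)
Lemma entry_cases n k :
  (forall v, entry v n k = 0) \/ exists j, forall v, entry v n k = v j.
Proof.
have [[j /andP[/eqP <- /eqP <-]]|nj] := pselect (exists j, (level j == n) && (kpos j == k)).
  by right; exists j => v; rewrite entryE.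
left => v; rewrite /entry big_pred0// => j; apply/negbTE/negP => h.
by apply: nj; exists j.
Qed.

Lemma entryD v w n k : entry (fun i => v i + w i) n k = entry v n k + entry w n k.
Proof. by rewrite /entry big_split. Qed.

Lemma entry_le v n k B : 0 <= B -> (forall i, `|v i| <= B) -> `|entry v n k| <= B.
Proof.
by move=> B0 vB; have [->|[j ->]] := entry_cases n k; rewrite ?normr0.
Qed.

Lemma A_matrixE T i v : \sum_(j : tri N) A_matrix T i j * v j =
  (- (level i)%:R + 1) / T * v i +
  ((kpos i)%:R - 1) / T * entry v (level i).-1 (kpos i).-1 +
  ((level i)%:R - (kpos i)%:R) / T * entry v (level i).-1 (kpos i).
Proof.
have [/andP[k1 kn] _] := tri_bounds i.
have E n k : entry v n k = \sum_(j : tri N) (if (level j == n) && (kpos j == k) then v j else 0).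
  by rewrite /entry big_mkcond.
rewrite -[v i](entryE v i) !E !big_distrr/= -!big_split/=.
apply: eq_bigr => j _; rewrite /A_matrix andbC.
have [lj|lj] := eqVneq (level j) (level i); have [kj|kj] := eqVneq (kpos j) (kpos i) => /=.
- have -> : (level j == (level i).-1) = false by apply/eqP; lia.
  by rewrite /= !mulr0 !addr0.
- have -> : (level j == (level i).-1) = false by apply/eqP; lia.
  by rewrite /= andbF !mulr0 !addr0 mul0r.
- have -> : (kpos j == (kpos i).-1) = false by apply/eqP; lia.
  by rewrite /= andbF andbT !mulr0 !add0r; case: ifP => _; rewrite ?mulr0 ?mul0r.
by rewrite /= andbF !mulr0 add0r addr0 andbC; case: ifP => _; rewrite ?mulr0 ?mul0r.
Qed.

Lemma xi_driftD (x : nat -> nat -> R -> R) v w i t :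
  xi_drift x (fun j => v j + w j) i t = xi_drift x v i t + xi_drift x w i t.
Proof. by rewrite /xi_drift !entryD; ring. Qed.

Lemma xi_driftN (x : nat -> nat -> R -> R) v i t :
  xi_drift x (fun j => - v j) i t = - xi_drift x v i t.
Proof.
have E n k : entry (fun j => - v j) n k = - entry v n k by rewrite /entry sumrN.
by rewrite /xi_drift !E; ring.
Qed.

End Entries.

Section Comparison.
Context {R : realType} (N : nat) (x : nat -> nat -> R -> R) (K : R).
Hypothesis hK : coef_bounds N x K.
Implicit Types (i j : tri N) (u t : R).

Definition lim_drift (v : tri N -> R) i t : R := \sum_(j : tri N) A_matrix t i j * v j.

Lemma lim_driftN v i t : lim_drift (fun j => - v j) i t = - lim_drift v i t.
Proof. by rewrite /lim_drift -sumrN; apply: eq_bigr => j _; rewrite mulrN. Qed.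

Definition drift_slope : R := 2 * (N%:R + 3).

(** Where the component [i] of [Y] is the largest in absolute value, the terms with the
    nonnegative coefficients a and c act downwards, and b is of order u^-2. The rest is the effect
    of [m] on a drift of order 1 / u, and the difference of the two drifts, of order u^-2, at
    [y]. *)
Lemma xi_drift_barrier (Y m y : tri N -> R) (V S : R) i u : K <= u -> 0 <= S -> 0 <= V ->
  (forall j, `|Y j| <= V) -> (forall j, `|m j| <= 1) -> (forall j, `|y j| <= S) ->
  Y i = V ->
  xi_drift x (fun j => Y j + m j + y j) i u - lim_drift y i u <=
    2 * K * V / u ^+ 2 + drift_slope / u + 6 * K * S / u ^+ 2.
Proof.
move=> Ku S0 V0 YV m1 yS YiV; have [K0 cK] := hK; have u0 : 0 < u := lt_le_trans K0 Ku.
have [[ha hb hc _] a0 c0 _] := cK i u Ku.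
have [/andP[k1 kn] nN] := tri_bounds i.
rewrite xi_driftD /lim_drift A_matrixE {1}/xi_drift !entryD !entryE /xi_drift !entryE YiV.
have := entry_le (level i).-1 (kpos i).-1 V0 YV; have := entry_le (level i) (kpos i).+1 V0 YV.
have := entry_le (level i).-1 (kpos i) V0 YV.
have := entry_le (level i).-1 (kpos i).-1 ler01 m1; have := entry_le (level i) (kpos i).+1 ler01 m1.
have := entry_le (level i).-1 (kpos i) ler01 m1.
have := entry_le (level i).-1 (kpos i).-1 S0 yS; have := entry_le (level i) (kpos i).+1 S0 yS.
have := entry_le (level i).-1 (kpos i) S0 yS; have := yS i; have := m1 i.
have nk : ((level i)%:R - 1) / u <= (N%:R) / u :> R.
  by rewrite ler_pM2r ?invr_gt0// lerBlDr ler_wpDr// ler_nat.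
have nkE : ((level i)%:R - 1) / u = ((kpos i)%:R - 1) / u + ((level i)%:R - (kpos i)%:R) / u :> R by ring.
have b1 : K / u ^+ 2 <= u^-1.
  by rewrite ler_pdivrMr ?exprn_gt0// expr2 mulKf ?gt_eqF.
have limE : (- (level i)%:R + 1) / u = - (((kpos i)%:R - 1) / u) - ((level i)%:R - (kpos i)%:R) / u :> R by ring.
rewrite {}limE.
have -> : 2 * K * V / u ^+ 2 = K / u ^+ 2 * (2 * V) by ring.
have -> : 6 * K * S / u ^+ 2 = 3 * (K / u ^+ 2 * (2 * S)) by ring.
have -> : drift_slope / u = 2 * (N%:R / u + 3 * u^-1) by rewrite /drift_slope; ring.
have lin (b c p q B : R) : `|c| <= b -> `|p| <= B -> `|q| <= B -> c * (p - q) <= b * (2 * B).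
  move=> cb pB qB; apply: le_trans (ler_norm _) _; rewrite normrM ler_pM//.
  by apply: le_trans (ler_normB _ _) _; lra.
have V1 : `|V| <= V by rewrite ger0_norm.
have aa : `|coef_a x (level i) (kpos i) u| <= ((kpos i)%:R - 1) / u + K / u ^+ 2.
  by rewrite ger0_norm//; move: ha; rewrite ler_norml => /andP[]; lra.
have cc : `|coef_c x (level i) (kpos i) u| <= ((level i)%:R - (kpos i)%:R) / u + K / u ^+ 2.
  by rewrite ger0_norm//; move: hc; rewrite ler_norml => /andP[]; lra.
move: (m i) (y i) (entry y _ _) (entry y _ _) (entry y _ _) (entry m _ _) (entry m _ _)
  (entry m _ _) (entry Y _ _) (entry Y _ _) (entry Y _ _).
move=> mi yi y3 y2 y1 f3 f2 f1 e3 e2 e1 mi1 yiS y3S y2S y1S f31 f21 f11 e3V e2V e1V.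
have p1 := lin _ _ _ _ _ hb V1 e2V.
have p2 := lin _ _ _ _ _ aa f11 mi1; have p3 := lin _ _ _ _ _ hb mi1 f21.
have p4 := lin _ _ _ _ _ cc f31 mi1.
have p5 := lin _ _ _ _ _ ha y1S yiS; have p6 := lin _ _ _ _ _ hb yiS y2S.
have p7 := lin _ _ _ _ _ hc y3S yiS.
have q1 : 0 <= coef_a x (level i) (kpos i) u * (V - e3).
  by rewrite mulr_ge0// subr_ge0; apply: le_trans (ler_norm _) _.
have q3 : 0 <= coef_c x (level i) (kpos i) u * (V - e1).
  by rewrite mulr_ge0// subr_ge0; apply: le_trans (ler_norm _) _.
move: (coef_a _ _ _ _) (coef_b _ _ _ _) (coef_c _ _ _ _) p1 p2 p3 p4 p5 p6 p7 q1 q3 nk nkE b1 {ha hb hc a0 c0 aa cc lin} => A B C.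
move: (K / u ^+ 2) (u^-1) (N%:R / u) (((level i)%:R - 1) / u) (((kpos i)%:R - 1) / u)
  (((level i)%:R - (kpos i)%:R) / u) => b ui Nu n1 k' n'.
lra.
Qed.

(** The rate of growth of the barrier of [xi_comparison] exceeds the drift allowed by
    [xi_drift_barrier]; here q^2 and r^2 are the initial and the current time, to make square
    roots rational. Each part of the barrier absorbs its own contribution to V; the first one
    also absorbs the term in S, the second one the term in al. *)
Lemma barrier_arith (q r c S al Y0 Z V : R) : 0 < K -> 0 < q -> q <= r -> 8 * K <= q ^+ 2 ->
  0 <= S -> 0 <= c -> 0 <= al ->
  Y0 = c + 1 + 24 * K * S / q ^+ 2 -> Z = 4 * al / q ->
  V = Y0 * (2 - q ^+ 2 / r ^+ 2) + Z * r ->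
  2 * K * V / (r ^+ 2) ^+ 2 + al / r ^+ 2 + 6 * K * S / (r ^+ 2) ^+ 2 <
  Y0 * (q ^+ 2 / (r ^+ 2) ^+ 2) + Z * (2 * r)^-1.
Proof.
move=> K0 q0 qr Kq S0 c0 al0 Y0E ZE VE.
have r0 : 0 < r := lt_le_trans q0 qr.
have q2 : 0 < q ^+ 2 by rewrite exprn_gt0.
have r4 : 0 < (r ^+ 2) ^+ 2 by rewrite !exprn_gt0.
have r2 : q ^+ 2 <= r ^+ 2 by rewrite lerXn2r ?nnegrE// ltW.
have Z0 : 0 <= Z by rewrite ZE divr_ge0 ?mulr_ge0// ltW.
have Y00 : 0 <= Y0.
  by rewrite Y0E !addr_ge0// divr_ge0 ?(ltW q2)// !mulr_ge0// ltW.
rewrite -(ltr_pM2r r4).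
rewrite [X in X < _](_ : _ = 2 * K * V + al * r ^+ 2 + 6 * K * S); last first.
  by field; rewrite gt_eqF.
rewrite [X in _ < X](_ : _ = Y0 * q ^+ 2 + Z / 2 * r ^+ 3); last first.
  by field; rewrite gt_eqF.
have V_le : V <= 2 * Y0 + Z * r.
  rewrite VE lerD2r [leRHS]mulrC ler_wpM2l// gerBl divr_ge0// ?ltW// exprn_gt0//.
have h1 : 2 * K * V <= Y0 * (q ^+ 2 / 2) + Z / 4 * r ^+ 3.
  apply: le_trans (_ : 2 * K * (2 * Y0 + Z * r) <= _).
    by rewrite ler_wpM2l// mulr_ge0// ltW.
  rewrite mulrDr; apply: lerD.
    by have : 0 <= Y0 * (q ^+ 2 - 8 * K) by [rewrite mulr_ge0// subr_ge0]; lra.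
  have -> : 2 * K * (Z * r) = Z / 4 * (8 * K * r) by field.
  rewrite ler_wpM2l ?divr_ge0// (exprSr r 2) ler_wpM2r ?(ltW r0)//.
  exact: le_trans Kq r2.
have h2 : al * r ^+ 2 <= Z / 4 * r ^+ 3.
  have -> : Z / 4 * r ^+ 3 = al * r ^+ 2 * (r / q) by rewrite ZE; field; rewrite gt_eqF.
  by rewrite ler_peMr ?mulr_ge0 ?exprn_ge0 ?(ltW r0)// ler_pdivlMr// mul1r.
have h3 : Y0 * (q ^+ 2 / 2) = (c + 1) * (q ^+ 2 / 2) + 12 * K * S.
  by rewrite Y0E; field; rewrite gt_eqF.
have h4 : 0 < (c + 1) * (q ^+ 2 / 2) by rewrite mulr_gt0 ?divr_gt0// ltr_wpDl.
have h5 : 0 <= K * S by rewrite mulr_ge0// ltW.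
move: h1 h2 h3 h4 h5; move: (r ^+ 3) (r ^+ 2) => r3 r2'; lra.
Qed.

Local Notation hcontinuous f := {within `[0, +oo[, continuous (f : R -> R)}.

Lemma entry_continuous (X : tri N -> R -> R) n k : (forall i, hcontinuous (X i)) ->
  hcontinuous (fun u => entry (X ^~ u) n k).
Proof.
move=> cX; have [E0|[j E]] := @entry_cases R N n k.
  rewrite (_ : (fun u => _) = fun _ : R => 0 : R); last by apply/funext => u; rewrite E0.
  by apply: continuous_subspaceT => u; exact: cvg_cst.
by rewrite (_ : (fun u => _) = X j)//; apply/funext => u; rewrite E.
Qed.

Lemma xi_drift_continuous (X : tri N -> R -> R) i t : (forall i, hcontinuous (X i)) -> K <= t ->
  continuous_at t (fun u => xi_drift x (X ^~ u) i u).
Proof.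
move=> cX Kt; have [K0 cK] := hK; have [_ _ _ [ca cb cc]] := cK i t Kt.
have t0 : 0 < t := lt_le_trans K0 Kt.
have cE n k := half_line_at (@entry_continuous X n k cX) t0.
have cD n k n' k' : continuous_at t (fun u => entry (X ^~ u) n k - entry (X ^~ u) n' k').
  exact: continuousB (cE n k) (cE n' k').
rewrite /xi_drift; apply: cvgB.
  apply: cvgD; first by apply: cvgM (cD _ _ _ _); exact: cvgN ca.
  by apply: cvgM (cD _ _ _ _); exact: cb.
by apply: cvgM (cD _ _ _ _); exact: cc.
Qed.

Lemma lim_drift_continuous (X : tri N -> R -> R) i t : (forall i, hcontinuous (X i)) -> 0 < t ->
  continuous_at t (fun u => lim_drift (X ^~ u) i u).
Proof.
move=> cX t0; have cE n k := half_line_at (@entry_continuous X n k cX) t0.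
have ci c : continuous_at t (fun u : R => c / u).
  by apply: cvgM; [exact: cvg_cst|apply: inv_continuous; rewrite gt_eqF].
rewrite (_ : (fun u => _) = fun u => (- (level i)%:R + 1) / u * X i u +
  ((kpos i)%:R - 1) / u * entry (X ^~ u) (level i).-1 (kpos i).-1 +
  ((level i)%:R - (kpos i)%:R) / u * entry (X ^~ u) (level i).-1 (kpos i)); last first.
  by apply/funext => u; rewrite /lim_drift A_matrixE.
apply: cvgD; first apply: cvgD.
- by apply: cvgM (ci _) _; exact: half_line_at (cX i) t0.
- exact: cvgM (ci _) (cE _ _).
- exact: cvgM (ci _) (cE _ _).
Qed.

End Comparison.

Section PathwiseComparison.
Context {R : realType} (N : nat) (x : nat -> nat -> R -> R) (K : R).
Hypothesis hK : coef_bounds N x K.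
Implicit Types (i j : tri N) (u t : R).
Local Notation mu := (@lebesgue_measure R).
Local Notation hcontinuous f := {within `[0, +oo[, continuous (f : R -> R)}.

Lemma within_continuous_at (f : R -> R) a b : (forall u, a <= u -> continuous_at u f) ->
  {within `[a, b], continuous f}.
Proof.
move=> cf; apply: continuous_in_subspaceT => u /set_mem/=; rewrite in_itv/= => /andP[au _].
exact: cf.
Qed.

Variables (X y m w : tri N -> R -> R) (t0 U c S : R).
Hypotheses (Kt0 : 8 * K <= t0) (t0U : t0 < U) (c0 : 0 <= c) (S0 : 0 <= S).
Hypotheses (cX : forall i, hcontinuous (X i)) (cy : forall i, hcontinuous (y i)).
Hypothesis hX : forall i u, t0 < u ->
  X i u - X i t0 = \int[mu]_(v in `[t0, u]) xi_drift x (X ^~ v) i v + (w i u - w i t0) + m i u.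
Hypothesis hy : forall i u, t0 < u ->
  y i u - y i t0 = \int[mu]_(v in `[t0, u]) lim_drift (y ^~ v) i v + (w i u - w i t0).
Hypotheses (m0 : forall i, m i t0 = 0)
  (m1 : forall i u, u \in `[t0, U] -> `|m i u| <= 1)
  (yS : forall i u, u \in `[t0, U] -> `|y i u| <= S)
  (Xy : forall i, `|X i t0 - y i t0| <= c).

(** Up to the small forcing [m], the difference of the two solutions obeys an equation whose
    drift pulls its largest component towards the others, whence the barrier. *)
Lemma xi_comparison i u : u \in `[t0, U] ->
  `|X i u - y i u| <= 2 * c + 3 + 48 * K * S / t0 + 4 * drift_slope N * Num.sqrt u / Num.sqrt t0.
Proof.
have K0 : 0 < K by case: hK.
have Klt : K < t0 by apply: lt_le_trans Kt0; rewrite ltr_pMl// ltr1n.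
have t00 : 0 < t0 := lt_trans K0 Klt.
pose g j v := xi_drift x (X ^~ v) j v - lim_drift (y ^~ v) j v.
have cxi j v : K <= v -> continuous_at v (fun v => xi_drift x (X ^~ v) j v).
  exact: xi_drift_continuous.
have clim j v : K <= v -> continuous_at v (fun v => lim_drift (y ^~ v) j v).
  by move=> Kv; apply: lim_drift_continuous => //; exact: lt_le_trans Kv.
have cg j v : K <= v -> continuous_at v (g j).
  by move=> Kv; apply: cvgB; [exact: cxi|exact: clim].
pose J j v := \int[mu]_(r in `[K, v]) g j r.
(* The difference without the forcing is differentiable, though the paths are not. *)
pose Y j v := X j t0 - y j t0 + (J j v - J j t0).
have dY j v : K < v -> is_derive v 1 (Y j) (g j v).
  move=> Kv; have dJ : is_derive v 1 (J j) (g j v).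
    apply: (@is_derive_Rintegral _ (g j) K v (v + 1)) => //; first by rewrite ltrDl.
    exact/within_continuous_at/cg.
  have := pw_is_deriveD (is_derive_cst (X j t0 - y j t0) v 1) (pw_is_deriveB dJ (is_derive_cst (J j t0) v 1)).
  by rewrite subr0 add0r.
have DE j v : v \in `[t0, U] -> X j v - y j v = Y j v + m j v.
  rewrite in_itv/= => /andP[]; rewrite le_eqVlt => /orP[/eqP <- _|t0v _].
    by rewrite /Y subrr addr0 m0 addr0.
  have JE : J j v - J j t0 = \int[mu]_(r in `[t0, v]) g j r.
    rewrite /J (@Rintegral_within_split _ (g j) K t0 v) ?ltW//; last exact/within_continuous_at/cg.
    by rewrite addrC addrA addNr add0r.
  rewrite /Y JE /g RintegralB//.
  - by have := hX j t0v; have := hy j t0v; lra.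
  - apply/within_continuous_integrable/within_continuous_at => r tr; apply: cxi.
    exact: le_trans (ltW Klt) tr.
  - apply/within_continuous_integrable/within_continuous_at => r tr; apply: clim.
    exact: le_trans (ltW Klt) tr.
pose q := Num.sqrt t0; have q0 : 0 < q by rewrite sqrtr_gt0.
have qE : q ^+ 2 = t0 by rewrite sqr_sqrtr// ltW.
pose al := drift_slope N : R.
have al0 : 0 <= al by rewrite /al /drift_slope mulr_ge0// addr_ge0.
(* The barrier: nearly constant, to hold the initial difference and the effect of y, plus a term
   growing like sqrt v, to hold the effect of m. *)
pose Y0 := c + 1 + 24 * K * S / t0; pose Z := 4 * al / q.
have KS0 : 0 <= 24 * K * S / t0 by rewrite divr_ge0 ?(ltW t00)// !mulr_ge0// ltW.
have Y00 : 0 <= Y0 by rewrite /Y0 !addr_ge0.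
have Z0 : 0 <= Z by rewrite /Z divr_ge0 ?mulr_ge0// ltW.
pose V v := Y0 * (2 - t0 / v) + Z * Num.sqrt v.
pose dV v := Y0 * (t0 / v ^+ 2) + Z * (2 * Num.sqrt v)^-1.
have dVP (v : R) : 0 < v -> is_derive v 1 V (dV v).
  move=> v0; have v0' : v != 0 by rewrite gt_eqF.
  have d1 := pw_is_deriveZ Y0 (pw_is_deriveB (is_derive_cst (2 : R) v 1)
    (pw_is_deriveZ t0 (@is_deriveV _ id v 1 1 v0' (is_derive_id v 1)))).
  refine (is_derive_eq (pw_is_deriveD d1 (pw_is_deriveZ Z (is_derive1_sqrt v0))) _).
  have -> : (- v ^- 2)%:A = - v ^- 2 :> R by rewrite /GRing.scale/= mulr1.
  by rewrite mulrN sub0r opprK.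
have V_ge0 (v : R) : t0 <= v -> 0 <= V v.
  move=> tv; have v0 := lt_le_trans t00 tv.
  rewrite /V addr_ge0// mulr_ge0// subr_ge0 ler_pdivrMr//; lra.
have YV : forall i u, u \in `[t0, U] -> `|Y i u| <= V u.
  apply: (@barrier _ (tri N) Y g V dV t0 U (ltW t0U)).
  - move=> j; apply: within_continuous_at => v tv.
    by apply: is_derive_continuous (dY j v _); exact: lt_le_trans tv.
  - apply: within_continuous_at => v tv.
    by apply: is_derive_continuous (dVP v _); exact: lt_le_trans tv.
  - move=> j; rewrite /Y subrr addr0; apply: le_lt_trans (Xy j) _.
    rewrite /V divff ?gt_eqF// /Y0; have := mulr_ge0 Z0 (ltW q0); rewrite -/q; lra.
  - by move=> j v /andP[tv _]; apply: dY; exact: lt_trans tv.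
  - by move=> v /andP[tv _]; apply: dVP; exact: lt_trans tv.
  move=> j v /andP[tv vU] YVv; have v0 := lt_trans t00 tv.
  have vU' : v \in `[t0, U] by rewrite in_itv/= vU ltW.
  have Kv : K <= v by rewrite ltW// (lt_trans Klt).
  have XE : (X ^~ v) = (fun j => Y j v + m j v + y j v).
    by apply/funext => l; rewrite -DE// subrK.
  have bar : 2 * K * V v / v ^+ 2 + drift_slope N / v + 6 * K * S / v ^+ 2 < dV v.
    have rE : Num.sqrt v ^+ 2 = v by rewrite sqr_sqrtr// ltW.
    have := @barrier_arith R K q (Num.sqrt v) c S al Y0 Z (V v) K0 q0.
    by rewrite qE rE; apply => //; rewrite ler_sqrt// ltW.
  split=> YE.
    apply: le_lt_trans bar; rewrite /g XE.
    apply: (xi_drift_barrier hK Kv S0 (V_ge0 _ (ltW tv)) YVv) YE => l; [exact: m1|exact: yS].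
  rewrite ltrNl; apply: le_lt_trans bar.
  have -> : - g j v = xi_drift x (fun l => - Y l v - m l v - y l v) j v - lim_drift (fun l => - y l v) j v.
    rewrite lim_driftN /g opprB opprK addrC XE -xi_driftN; congr (_ + _).
    by congr xi_drift; apply/funext => l; rewrite !opprD.
  apply: (@xi_drift_barrier _ N x K hK (fun l => - Y l v) (fun l => - m l v) (fun l => - y l v)) => //.
  - exact/V_ge0/ltW.
  - by move=> l; rewrite normrN.
  - by move=> l; rewrite normrN m1.
  - by move=> l; rewrite normrN yS.
  - by rewrite YE opprK.
move=> uU; rewrite DE//; apply: le_trans (ler_normD _ _) _.
have := YV i u uU; have := m1 i uU.
have u0 : t0 <= u by move: uU; rewrite in_itv/= => /andP[].
have : V u <= 2 * Y0 + Z * Num.sqrt u.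
  rewrite /V lerD2r [leRHS]mulrC ler_wpM2l// gerBl divr_ge0// ?ltW//.
  exact: lt_le_trans u0.
rewrite /Z /Y0 -/q; have -> : 4 * drift_slope N * Num.sqrt u / q = 4 * al / q * Num.sqrt u.
  by rewrite mulrAC.
have -> : 48 * K * S / t0 = 2 * (24 * K * S / t0) by field; rewrite gt_eqF.
lra.
Qed.

End PathwiseComparison.

(** * Adaptedness and events of small probability *)

Section MeasurableIntegrals.
Context {R : realType} {d : measure_display} {Omega : measurableType d}.
Implicit Types (G : set (set Omega)) (X Y : Omega -> R) (a b u t : R).
Local Notation mu := (@lebesgue_measure R).

Variable G : set (set Omega).
Hypothesis sG : sigma_algebra setT G.

Lemma measurable_wrt_cst (c : R) : measurable_wrt G (fun=> c).
Proof. by apply/measurable_wrtP => //; exact: measurable_cst. Qed.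

Lemma measurable_wrtD X Y : measurable_wrt G X -> measurable_wrt G Y ->
  measurable_wrt G (fun w => X w + Y w).
Proof.
by move=> /(measurable_wrtP _ sG) mX /(measurable_wrtP _ sG) mY; apply/measurable_wrtP => //; exact: measurable_funD.
Qed.

Lemma measurable_wrtB X Y : measurable_wrt G X -> measurable_wrt G Y ->
  measurable_wrt G (fun w => X w - Y w).
Proof.
by move=> /(measurable_wrtP _ sG) mX /(measurable_wrtP _ sG) mY; apply/measurable_wrtP => //; exact: measurable_funB.
Qed.

Lemma measurable_wrtZ c X : measurable_wrt G X -> measurable_wrt G (fun w => c * X w).
Proof.
by move=> /(measurable_wrtP _ sG) mX; apply/measurable_wrtP => //; exact: measurable_funM.
Qed.

Lemma measurable_wrt_sum (I : Type) (r : seq I) (X : I -> Omega -> R) :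
  (forall i, measurable_wrt G (X i)) -> measurable_wrt G (fun w => \sum_(i <- r) X i w).
Proof.
move=> mX; elim: r => [|i r IH].
  by under eq_fun do rewrite big_nil; exact: measurable_wrt_cst.
by under eq_fun do rewrite big_cons; exact: measurable_wrtD.
Qed.

Lemma measurable_wrt_entry N (X : tri N -> Omega -> R) n k :
  (forall i, measurable_wrt G (X i)) -> measurable_wrt G (fun w => entry (X ^~ w) n k).
Proof.
move=> mX; have [E|[j E]] := @entry_cases R N n k.
  by under eq_fun do rewrite E; exact: measurable_wrt_cst.
by rewrite (_ : (fun w => _) = X j)//; apply/funext => w; rewrite E.
Qed.

(** As a limit of Riemann sums. *)
Lemma measurable_wrt_Rintegral (f : R -> Omega -> R) a b : a <= b ->
  (forall u, u \in `[a, b] -> measurable_wrt G (f u)) ->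
  (forall w, {within `[a, b], continuous (f ^~ w)}) ->
  measurable_wrt G (fun w => \int[mu]_(u in `[a, b]) f u w).
Proof.
move=> ab mf cf; apply/measurable_wrtP => //.
apply: (measurable_fun_cvg (h := fun m (w : g_sigma_algebraType G) =>
  \sum_(j < m.+1) f (mesh a b m.+1 j) w * ((b - a) / m.+1%:R))).
  move=> m; apply/measurable_wrtP => //; apply: measurable_wrt_sum => j.
  under eq_fun do rewrite mulrC.
  by apply/measurable_wrtZ/mf/mesh_itv => //; exact: ltnW.
by move=> w _; exact: riemann_sum_cvg.
Qed.

End MeasurableIntegrals.

Section OutsideSmall.
Context {R : realType} {d : measure_display} {Omega : measurableType d}.
Variable P : probability Omega R.
Implicit Types (Q : Omega -> Prop) (e : R).

(** An inclusion rather than the probability of [Q], which need not be an event when it speaks of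
    all times of an interval. *)
Definition outside_small e Q :=
  exists A, [/\ measurable A, (P A <= e%:E)%E & forall w, ~ A w -> Q w].

Lemma outside_small_le e e' Q Q' : e <= e' -> (forall w, Q w -> Q' w) ->
  outside_small e Q -> outside_small e' Q'.
Proof.
move=> ee QQ [A [mA PA AQ]]; exists A; split => //; last by move=> w /AQ /QQ.
by apply: le_trans PA _; rewrite lee_fin.
Qed.

Lemma outside_small_and e1 e2 Q1 Q2 : outside_small e1 Q1 -> outside_small e2 Q2 ->
  outside_small (e1 + e2) (fun w => Q1 w /\ Q2 w).
Proof.
move=> [A [mA PA AQ]] [B [mB PB BQ]]; exists (A `|` B); split.
- exact: measurableU.
- by apply: le_trans (measureU2 _ mA mB) _; rewrite EFinD leeD.
by move=> w AB; split; [apply: AQ|apply: BQ] => ?; apply: AB; [left|right].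
Qed.

Lemma outside_small_all (I : finType) e (Q : I -> Omega -> Prop) :
  (forall i, outside_small e (Q i)) ->
  outside_small (#|I|%:R * e) (fun w => forall i, Q i w).
Proof.
move=> H; have : outside_small ((size (enum I))%:R * e) (fun w => forall i, i \in enum I -> Q i w).
  elim: (enum I) => [|i r IH].
    by exists set0; split; [exact: measurable0|rewrite measure0 mul0r|].
  apply: outside_small_le (outside_small_and (H i) IH).
    by rewrite /= mulrSr mulrDl mul1r addrC.
  by move=> w [Qi Qr] j; rewrite inE => /orP[/eqP ->//|]; exact: Qr.
rewrite -cardE; apply: outside_small_le => // w Qw i.
by apply: Qw; rewrite mem_enum.
Qed.

(** The events on which the absolute value exceeds n decrease to the empty set. *)
Lemma outside_small_bounded (X : Omega -> R) e : measurable_fun setT X -> 0 < e ->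
  exists2 c : R, 0 <= c & outside_small e (fun w => `|X w| <= c).
Proof.
move=> mX e0; pose A n := [set w | (n%:R < `|X w|)%R].
have mA n : measurable (A n).
  rewrite (_ : A n = (fun w => `|X w|) @^-1` `]n%:R, +oo[); last first.
    by apply/seteqP; split=> w /=; rewrite in_itv/= andbT.
  by rewrite -[X in measurable X]setTI; apply: measurableT_comp => //; exact: measurableT_comp.
have cA : P (A n) @[n --> \oo] --> P (\bigcap_n A n).
  apply: nonincreasing_cvg_mu => //.
  - by apply: le_lt_trans (probability_le1 P (mA 0%N)) _; exact: ltry.
  - exact: bigcap_measurable.
  - apply/nonincreasing_seqP => n; rewrite subsetEset => w /=.
    by apply: le_lt_trans; rewrite ler_nat.
have I0 : \bigcap_n A n = set0.
  rewrite -subset0 => w /(_ (Num.truncn `|X w|).+1 Logic.I) /=.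
  by have /andP[_ h] := truncn_itv (normr_ge0 (X w)); rewrite /A /= ltNge (ltW h).
rewrite I0 measure0 in cA.
have [n _ Hn] : \forall n \near \oo, (P (A n) < e%:E)%E.
  apply: (cA [set y | (y < e%:E)%E]); apply: open_nbhs_nbhs; split; first exact: open_ereal_lt_ereal.
  by rewrite /= lte_fin.
exists n%:R => //; exists (A n); split => //; first exact/ltW/Hn/leqnn.
by move=> w /negP; rewrite -leNgt.
Qed.

End OutsideSmall.

(** * The limit process *)

Section PathSolution.
Context {R : realType} (N : nat).
Implicit Types (h : tri N -> R -> R) (i j : tri N) (t u T S L c : R).
Local Notation hcontinuous f := {within `[0, +oo[, continuous (f : R -> R)}.

Definition path_sol h i t : R :=
  lim_sol (fun n k u => entry (fun j => h j u) n k) (level i) (kpos i) t.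

Lemma path_entry_continuous h : (forall j, hcontinuous (h j)) ->
  forall n k, hcontinuous (fun u => entry (fun j => h j u) n k).
Proof. by move=> ch n k; exact: (@entry_continuous _ N h n k). Qed.

Lemma path_sol_continuous h i : (forall j, hcontinuous (h j)) -> hcontinuous (path_sol h i).
Proof.
by move=> /path_entry_continuous ch; case: (@lim_sol_continuous _ _ (level i) (kpos i) ch).
Qed.

(** Linear in the driving path and bounded, the solution is a Lipschitz function of it for the
    uniform distance. *)
Lemma path_sol_bound : exists2 C : R, 0 <= C & forall h T S, (forall j, hcontinuous (h j)) ->
  0 <= S -> (forall j u, u \in `[0, T] -> `|h j u| <= S) ->
  forall i u, u \in `[0, T] -> `|path_sol h i u| <= C * S.
Proof.
have [C HC] : exists C, forall v, C <= v -> forall i, forall h T S, (forall j, hcontinuous (h j)) ->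
    0 <= S -> (forall j u, u \in `[0, T] -> `|h j u| <= S) ->
    forall u, u \in `[0, T] -> `|path_sol h i u| <= v * S.
  apply: fin_eventually => i.
  have [C C0 HC] := @lim_sol_bound R (level i) (kpos i); exists C => v Cv h T S ch S0 hS u uT.
  apply: le_trans (_ : C * S <= _); last by rewrite ler_wpM2r.
  apply: HC uT; first by move=> n k; exact: path_entry_continuous.
  by move=> n k r rT; apply: entry_le => // j; exact: hS.
exists (Num.max C 0); first by rewrite le_max lexx orbT.
by move=> h T S ch S0 hS i; apply: HC => //; rewrite le_max lexx.
Qed.

Lemma path_solB h1 h2 i t : (forall j, hcontinuous (h1 j)) -> (forall j, hcontinuous (h2 j)) ->
  0 <= t -> path_sol (fun j u => h1 j u - h2 j u) i t = path_sol h1 i t - path_sol h2 i t.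
Proof.
move=> c1 c2 t0; rewrite /path_sol -lim_solB//; try exact: path_entry_continuous.
congr (lim_sol _ _ _ _); apply/funext => n; apply/funext => k; apply/funext => u.
have := @entryD R N (fun j => h1 j u) (fun j => - h2 j u) n k; rewrite /entry => ->.
by rewrite -sumrN.
Qed.

Lemma path_sol_scale h c L i t : (forall j, hcontinuous (h j)) -> 0 < L -> 0 <= t ->
  path_sol (fun j u => c * h j (L * u)) i t = c * path_sol h i (L * t).
Proof.
move=> ch L0 t0; rewrite /path_sol -lim_sol_scale//; last exact: path_entry_continuous.
congr (lim_sol _ _ _ _); apply/funext => n; apply/funext => k; apply/funext => u.
by rewrite /entry mulr_sumr.
Qed.

End PathSolution.

Section LimitProcess.
Context {R : realType} {d : measure_display} {Omega : measurableType d} (N : nat).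
Variables (P : probability Omega R) (F : R -> set (set Omega)) (W : tri N -> R -> Omega -> R).
Hypothesis hW : brownian_motions P F W.
Implicit Types (i j : tri N) (s t u : R) (n k : nat) (w : Omega).
Local Notation mu := (@lebesgue_measure R).
Local Notation hcontinuous f := {within `[0, +oo[, continuous (f : R -> R)}.

Lemma tri_index n k : (1 <= k <= n)%N -> (n <= N)%N ->
  exists i : tri N, level i = n /\ kpos i = k.
Proof.
move=> kn nN; have kN : (k <= N)%N by lia.
have h : (1 <= ((inord k : 'I_N.+1), (inord n : 'I_N.+1)).1 <=
           ((inord k : 'I_N.+1), (inord n : 'I_N.+1)).2)%N by rewrite /= !inordK.
by exists (exist _ (inord k, inord n) h); rewrite /level /kpos /= !inordK.
Qed.

Definition driver w n k u : R := entry (fun j => W j u w) n k.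

Definition zeta_process i t w : R := path_sol (fun j u => W j u w) i t.

Lemma brownian_continuous i w : hcontinuous (W i ^~ w).
Proof. by have [_ _ _ h _] := hW; exact: h. Qed.

Lemma driver_continuous w n k : hcontinuous (driver w n k).
Proof.
by apply: (@entry_continuous _ N (fun j u => W j u w)) => j; exact: brownian_continuous.
Qed.

Lemma zeta_continuous i w : hcontinuous (zeta_process i ^~ w).
Proof. by apply: path_sol_continuous => j; exact: brownian_continuous. Qed.

Lemma entry_zeta n k u w : (1 <= k <= n)%N -> (n <= N)%N ->
  entry (fun j => zeta_process j u w) n k = lim_sol (driver w) n k u.
Proof. by move=> kn nN; have [i [<- <-]] := tri_index kn nN; rewrite entryE. Qed.

(** Terms of the recursion with an index outside the array carry the factor k - 1 = 0 or
    n - k = 0. *)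
Lemma zeta_sde i s t w : 0 < s -> s < t ->
  zeta_process i t w - zeta_process i s w =
  \int[mu]_(u in `[s, t]) lim_drift (fun j => zeta_process j u w) i u + (W i t w - W i s w).
Proof.
move=> s0 st; have [/andP[k1 kn] nN] := tri_bounds i.
have nS : level i = (level i).-1.+1 by rewrite prednK// (leq_trans k1).
have WE u : W i u w = driver w (level i).-1.+1 (kpos i) u by rewrite -nS /driver entryE.
have zE u : zeta_process i u w = lim_sol (driver w) (level i) (kpos i) u by [].
rewrite !WE !zE nS lim_sol_sde//; last exact: driver_continuous.
congr (_ + _); apply: eq_Rintegral => u _; rewrite /lim_drift A_matrixE.
rewrite -nS mulrDl mulrDl zE; congr (_ + _ + _).
- rewrite mulrAC; congr (_ / _ * _).
  by rewrite {2}nS -natr1; ring.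
- have [k2|k2] := leqP (kpos i) 1.
    have -> : kpos i = 1%N by lia.
    by rewrite subrr !mul0r.
  by rewrite mulrAC; congr (_ * _); apply/esym/entry_zeta; lia.
have [k2|k2] := leqP (level i) (kpos i).
  have -> : kpos i = level i by lia.
  by rewrite subrr !mul0r.
by rewrite mulrAC; congr (_ * _); apply/esym/entry_zeta; lia.
Qed.

Let sG t : 0 <= t -> sigma_algebra setT (F t). Proof. by have [[h _ _] _ _ _ _] := hW; exact: h. Qed.
Let FS s t : 0 <= s -> s <= t -> F s `<=` F t. Proof. by have [[_ _ h] _ _ _ _] := hW; exact: h. Qed.

Lemma lim_sol_adapted n k t : 0 <= t -> measurable_wrt (F t) (fun w => lim_sol (driver w) n k t).
Proof.
have mW (m j : nat) (u : R) : 0 <= u -> measurable_wrt (F u) (fun w => driver w m j u).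
  move=> u0; apply: (measurable_wrt_entry (sG u0) (X := fun j => W j u)) => l.
  exact: (brownian_adapted hW).
elim: n k t => [|n IH] k t t0; first exact: (measurable_wrt_cst (sG t0) 0).
apply: measurable_wrtD => //; [exact: sG|exact: mW|].
apply: measurable_wrt_Rintegral => //; [exact: sG| |].
  move=> v; rewrite in_itv/= => /andP[v0 v1]; have tv0 : 0 <= t * v by exact: mulr_ge0.
  apply: measurable_wrtZ; first exact: sG.
  apply: (@measurable_wrt_sub _ _ _ (F (t * v))); first by apply: FS => //; rewrite ler_piMr.
  have sGv := sG tv0.
  apply: measurable_wrtB => //; last by apply: measurable_wrtZ => //; exact: mW.
  by apply: measurable_wrtD => //; apply: measurable_wrtZ => //; exact: IH.
move=> w; have [_ cs] := @lim_sol_continuous _ (driver w) n k (@driver_continuous w).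
exact: (@wavg_integrand_continuous _ n (lim_src (driver w) n k) t cs t0).
Qed.

Lemma zeta_adapted i t : 0 <= t -> measurable_wrt (F t) (zeta_process i t).
Proof. exact: lim_sol_adapted. Qed.

End LimitProcess.

(** * Closeness in probability *)

Lemma telescope_mesh (R : realType) (f : R -> R) (a b : R) m :
  \sum_(l < m.+1) (f (mesh a b m.+1 l.+1) - f (mesh a b m.+1 l)) = f b - f a.
Proof.
rewrite -(big_mkord xpredT (fun l => f (mesh a b m.+1 l.+1) - f (mesh a b m.+1 l))).
by rewrite telescope_sumr// meshn mesh0.
Qed.

(** Every Riemann sum is exact. *)
Lemma wiener_integral1 {R : realType} {d : measure_display} {Omega : measurableType d}
    (P : probability Omega R) (w0 : R -> Omega -> R) s t X :
  (forall w, X w = w0 t w - w0 s w) -> is_wiener_integral P w0 (fun=> 1) s t X.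
Proof.
move=> XE; rewrite /is_wiener_integral (_ : (fun m => _) = fun=> 0%E); first exact: cvg_cst.
apply/funext => m; rewrite unlock.
rewrite (eq_integral (fun=> 0%E)) ?integral0// => w _.
have -> : \sum_(j < m.+1) 1 * (w0 (s + (t - s) * (j.+1%:R / m.+1%:R)) w -
    w0 (s + (t - s) * (j%:R / m.+1%:R)) w) = w0 t w - w0 s w.
  under eq_bigr do rewrite mul1r.
  exact: (telescope_mesh (fun u => w0 u w)).
by rewrite XE subrr expr0n.
Qed.

Section Approximation.
Context {R : realType} {d : measure_display} {Omega : measurableType d} (N : nat).
Variables (P : probability Omega R) (F : R -> set (set Omega)) (W xi : tri N -> R -> Omega -> R).
Variables (x : nat -> nat -> R -> R) (K : R).
Hypotheses (hW : brownian_motions P F W) (hK : coef_bounds N x K).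
Hypothesis xi_continuous : forall i w, {within `[0, +oo[, continuous (fun t => xi i t w)}.
Hypothesis xi_sde : solves_sde P F W `]0, +oo[ (fun v i tau => xi_drift x v i tau)
  (fun i => coef_sigma x (level i) (kpos i)) xi.
Implicit Types (i j : tri N) (s t u : R) (n k : nat) (w : Omega).
Local Notation mu := (@lebesgue_measure R).

Let sG t : 0 <= t -> sigma_algebra setT (F t). Proof. by have [[h _ _] _ _ _ _] := hW; exact: h. Qed.
Let FS s t : 0 <= s -> s <= t -> F s `<=` F t. Proof. by have [[_ _ h] _ _ _ _] := hW; exact: h. Qed.

(** A Brownian motion is the stochastic integral of 1. *)
Lemma sup_brownian_le i T lambda : 0 < T -> 0 < lambda ->
  outside_small P (12 * T / lambda ^+ 2) (fun w => forall u, u \in `[0, T] -> `|W i u w| <= lambda).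
Proof.
move=> T0 l0; have [_ mW W0 _ _] := hW.
have [] := @wiener_max_ineq _ _ _ P _ F W hW i (fun=> 1) id (W i) 0 T 1 lambda (lexx 0) T0 ltr01 l0.
- by move=> w; exact: W0.
- by move=> w; apply: half_line_itv; [exact: lexx|exact: (brownian_continuous hW)].
- by move=> u; rewrite in_itv/= => /andP[u0 _]; exact: mW.
- by move=> a b a0 ab bT; exact: wiener_integral1.
- by move=> a b u _ _ _ _ _; rewrite expr1n mul1r.
move=> A [mA PA AQ]; exists A; split => //.
by move: PA; rewrite subr0.
Qed.

(** The stochastic integral of sigma - 1 over [t0, u], written without the integral. *)
Definition forcing t0 i u w : R := xi i u w - xi i t0 w -
  \int[mu]_(v in `[t0, u]) xi_drift x (fun j => xi j v w) i v - (W i u w - W i t0 w).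

Lemma xi_drift_integral_split t0 i w a b : K <= t0 -> t0 <= a -> a <= b ->
  \int[mu]_(v in `[t0, b]) xi_drift x (fun j => xi j v w) i v =
  \int[mu]_(v in `[t0, a]) xi_drift x (fun j => xi j v w) i v +
  \int[mu]_(v in `[a, b]) xi_drift x (fun j => xi j v w) i v.
Proof.
move=> Kt0 ta ab; apply: Rintegral_within_split => //.
apply: within_continuous_at => u tu.
by apply: (xi_drift_continuous hK) => [j|]; [exact: xi_continuous|exact: le_trans tu].
Qed.

Lemma forcing_continuous t0 U i w : K < t0 -> {within `[t0, U], continuous (forcing t0 i ^~ w)}.
Proof.
move=> Kt0; have K0 : 0 < K by case: hK.
have t00 := lt_trans K0 Kt0.
have cd v : K <= v -> continuous_at v (fun v => xi_drift x (fun j => xi j v w) i v).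
  by move=> Kv; apply: (xi_drift_continuous hK) => // j; exact: xi_continuous.
pose J v := \int[mu]_(r in `[K, v]) xi_drift x (fun j => xi j r w) i r.
have cJ v : t0 <= v -> continuous_at v J.
  move=> tv; apply: is_derive_continuous.
  apply: (@is_derive_Rintegral _ (fun r => xi_drift x (fun j => xi j r w) i r) K v (v + 1)).
  - exact: lt_le_trans tv.
  - by rewrite ltrDl.
  - exact/within_continuous_at/cd.
apply: (@subspace_eq_continuous _ _ _ (fun u => xi i u w - xi i t0 w - (J u - J t0) - (W i u w - W i t0 w))).
  move=> u /set_mem/=; rewrite in_itv/= => /andP[tu _].
  rewrite /forcing; congr (_ - _ - _); rewrite /J (@xi_drift_integral_split K i w t0 u)//.
    by rewrite addrC addrA addNr add0r.
  exact: ltW.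
apply: within_continuous_at => u tu; have u0 := lt_le_trans t00 tu.
have cx := half_line_at (@xi_continuous i w) u0.
have cw := half_line_at (@brownian_continuous _ _ _ _ _ _ _ hW i w) u0.
apply: cvgB; first apply: cvgB.
- by apply: cvgB cx _; exact: cvg_cst.
- by apply: cvgB (cJ _ tu) _; exact: cvg_cst.
by apply: cvgB cw _; exact: cvg_cst.
Qed.

Lemma forcing_adapted t0 i u : K < t0 -> t0 <= u -> measurable_wrt (F u) (forcing t0 i u).
Proof.
move=> Kt0 tu; have K0 : 0 < K by case: hK.
have t00 := lt_trans K0 Kt0; have u0 := lt_le_trans t00 tu.
have [mxi _] := xi_sde; have Gu := sG (ltW u0).
have mx j v : t0 <= v -> v <= u -> measurable_wrt (F u) (xi j v).
  move=> tv vu; have v0 := lt_le_trans t00 tv.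
  apply: measurable_wrt_sub (mxi j v _); first exact: FS (ltW v0) vu.
  by rewrite /= in_itv/= v0.
have mw j v : t0 <= v -> v <= u -> measurable_wrt (F u) (W j v).
  move=> tv vu; have v0 := lt_le_trans t00 tv.
  apply: measurable_wrt_sub (brownian_adapted hW _ (ltW v0)); exact: FS (ltW v0) vu.
apply: measurable_wrtB => //; last by apply: measurable_wrtB => //; exact: mw.
apply: measurable_wrtB => //; first by apply: measurable_wrtB => //; exact: mx.
apply: measurable_wrt_Rintegral => //.
  move=> v; rewrite in_itv/= => /andP[tv vu].
  have mE n k : measurable_wrt (F u) (fun w => entry (fun j => xi j v w) n k).
    by apply: (measurable_wrt_entry Gu (X := fun j => xi j v)) => j; exact: mx.
  by rewrite /xi_drift; do !(apply: measurable_wrtB => // || apply: measurable_wrtD => // || apply: measurable_wrtZ => //).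
move=> w; apply: within_continuous_at => v tv.
apply: (xi_drift_continuous hK) => [j|]; first exact: xi_continuous.
exact: le_trans (ltW Kt0) tv.
Qed.

(** As sigma - 1 is at most K / u, the variance is bounded by the integral of K^2 / u^2 over
    [t0, +oo[, that is K^2 / t0: uniform in the end point, and small for large t0. *)
Lemma forcing_small t0 U i : K < t0 -> t0 < U ->
  outside_small P (24 * K ^+ 2 / t0) (fun w => forall u, u \in `[t0, U] -> `|forcing t0 i u w| <= 1).
Proof.
move=> Kt0 t0U; have [K0 cK] := hK; have t00 : 0 < t0 := lt_trans K0 Kt0.
pose sg u := coef_sigma x (level i) (kpos i) u - 1.
(* On a cell [a, b] with b - a <= t0 one has b <= 2 a, whence the factor 2 in the variance bound. *)
have [] := @wiener_max_ineq _ _ _ P _ F W hW i sg (fun u => - (2 * K ^+ 2) / u) (forcing t0 i) t0 U t0 1 (ltW t00) t0U t00 ltr01.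
- by move=> w; rewrite /forcing !subrr set_itv1 Rintegral_set1 !subr0.
- by move=> w; exact: forcing_continuous.
- by move=> u; rewrite in_itv/= => /andP[tu _]; exact: forcing_adapted.
- move=> a b ta ab bU; have [_ wxi] := xi_sde.
  have a0 := lt_le_trans t00 ta; have b0 := lt_trans a0 ab.
  have : is_wiener_integral P (W i) (coef_sigma x (level i) (kpos i)) a b (fun w => xi i b w - xi i a w -
      \int[mu]_(u in `[a, b]) xi_drift x (fun j => xi j u w) i u).
    by apply: wxi => //; rewrite /= in_itv/= ?a0 ?b0.
  rewrite /is_wiener_integral; apply: cvg_trans; apply: near_eq_cvg; near=> m.
  congr expectation; apply/funext => w; congr (_ ^+ 2).
  have -> : \sum_(j < m.+1) sg (a + (b - a) * (j%:R / m.+1%:R)) *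
      (W i (a + (b - a) * (j.+1%:R / m.+1%:R)) w - W i (a + (b - a) * (j%:R / m.+1%:R)) w) =
    \sum_(j < m.+1) coef_sigma x (level i) (kpos i) (a + (b - a) * (j%:R / m.+1%:R)) *
      (W i (a + (b - a) * (j.+1%:R / m.+1%:R)) w - W i (a + (b - a) * (j%:R / m.+1%:R)) w)
    - (W i b w - W i a w).
    have -> : W i b w - W i a w = \sum_(j < m.+1) (W i (mesh a b m.+1 j.+1) w - W i (mesh a b m.+1 j) w).
      by rewrite (telescope_mesh (fun u => W i u w)).
    by rewrite -sumrB; apply: eq_bigr => j _; rewrite /sg mulrBl mul1r.
  rewrite /forcing (@xi_drift_integral_split t0 i w a b) ?(ltW Kt0) ?(ltW ab)//.
  by ring.
- move=> a b u ta ab bU bat; rewrite in_itv/= => /andP[au ub].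
  have a0 := lt_le_trans t00 ta; have b0 := lt_trans a0 ab; have u0 := lt_le_trans a0 au.
  have Ku : K <= u by rewrite (le_trans (ltW Kt0))// (le_trans ta).
  have [[_ _ _ hs] _ _ _] := cK i u Ku.
  have s2 : sg u ^+ 2 <= K ^+ 2 / a ^+ 2.
    rewrite -(real_normK (num_real (sg u))) -expr_div_n lerXn2r ?nnegrE ?divr_ge0 ?(ltW K0) ?(ltW a0)//.
    apply: le_trans hs _; rewrite ler_pM2l// lef_pV2 ?posrE//.
  apply: le_trans (_ : K ^+ 2 / a ^+ 2 * (b - a) <= _).
    by rewrite ler_wpM2r// subr_ge0 ltW.
  have b2a : b <= 2 * a by lra.
  have -> : - (2 * K ^+ 2) / b - - (2 * K ^+ 2) / a = K ^+ 2 / a ^+ 2 * (b - a) * (2 * a / b).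
    by field; rewrite !gt_eqF.
  apply: ler_peMr; last by rewrite ler_pdivlMr// mul1r.
  by apply: mulr_ge0; [rewrite divr_ge0// sqr_ge0|rewrite subr_ge0 ltW].
move=> A [mA PA AQ]; exists A; split => //; apply: le_trans PA _.
rewrite lee_fin expr1n divr1.
have U0 : 0 < U := lt_trans t00 t0U.
have : 0 <= 2 * K ^+ 2 / U by rewrite divr_ge0 ?mulr_ge0 ?sqr_ge0// ltW.
by rewrite !mulNr opprK -mulrA; lra.
Unshelve. all: end_near. Qed.

End Approximation.

Section Closeness.
Context {R : realType} {d : measure_display} {Omega : measurableType d} (N : nat).
Variables (P : probability Omega R) (F : R -> set (set Omega)) (W xi : tri N -> R -> Omega -> R).
Variables (x : nat -> nat -> R -> R) (K : R).
Hypotheses (hW : brownian_motions P F W) (hK : coef_bounds N x K).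
Hypothesis xi_continuous : forall i w, {within `[0, +oo[, continuous (fun t => xi i t w)}.
Hypothesis xi_sde : solves_sde P F W `]0, +oo[ (fun v i tau => xi_drift x v i tau)
  (fun i => coef_sigma x (level i) (kpos i)) xi.
Implicit Types (i j : tri N) (s t u S T L e : R) (n k : nat) (w : Omega).
Local Notation zeta := (zeta_process W).

Lemma zeta_bound : exists2 C : R, 0 <= C & forall w T S, 0 <= S ->
  (forall i u, u \in `[0, T] -> `|W i u w| <= S) ->
  forall i u, u \in `[0, T] -> `|zeta i u w| <= C * S.
Proof.
have [C C0 HC] := @path_sol_bound R N; exists C => // w T S S0 WS.
by apply: HC => // j; exact: (brownian_continuous hW).
Qed.

(** The threshold t0 has to be large for the forcing, the differences of order u^-2 between the
    coefficients and the growth 1 / sqrt t0 of the barrier to be harmless; it does not depend on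
    L. The difference at t0 is then a fixed random variable, negligible after division by
    sqrt L. *)
Lemma xi_close_zeta e T0 T1 : 0 < e -> 0 < T0 -> T0 < T1 ->
  exists L0, forall L, L0 <= L -> 0 < L /\ outside_small P e (fun w =>
    forall i T, T \in `[T0, T1] ->
      `|(Num.sqrt L)^-1 * xi i (L * T) w - (Num.sqrt L)^-1 * zeta i (L * T) w| <= e).
Proof.
move=> e0 T00 T01; have T10 := lt_trans T00 T01; have K0 : 0 < K by case: hK.
have [C C0 HC] := zeta_bound.
(* An event of probability e / 3 is discarded for each of the size of W on [0, L T1], the forcing
   past t0 and the difference at t0. The terms of t0 answer one by one to the estimates p2, q2
   and q3 below, and lambda to p1. *)
pose n : R := #|{: tri N}|%:R; have n0 : 0 <= n by exact: ler0n.
pose lambda := 36 * n * T1 / e + 1.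
have l1 : 1 <= lambda by rewrite lerDr divr_ge0 ?mulr_ge0// ltW.
have l0 : 0 < lambda := lt_le_trans ltr01 l1.
pose sl := drift_slope N : R.
have sl0 : 0 <= sl by rewrite /sl /drift_slope mulr_ge0// addr_ge0.
pose a2 := 72 * n * K ^+ 2 / e; pose a3 := 192 * K * C * lambda / e.
pose a4 := (16 * sl / e) ^+ 2 * T1; pose t0 := 8 * K + 1 + a2 + a3 + a4.
have a20 : 0 <= a2 by rewrite divr_ge0 ?(ltW e0)// !mulr_ge0// ltW.
have a30 : 0 <= a3 by rewrite divr_ge0 ?(ltW e0)// !mulr_ge0// ltW.
have a40 : 0 <= a4 by rewrite mulr_ge0 ?sqr_ge0// ltW.
have Kt : K < t0 by rewrite /t0; lra.
have Kt8 : 8 * K <= t0 by rewrite /t0; lra.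
have t00 : 0 < t0 := lt_trans K0 Kt.
have /boolp.choice[c /all_and2[c0 Hc]] : forall i, exists c : R, 0 <= c /\
    outside_small P (e / (3 * (n + 1))) (fun w => `|xi i t0 w - zeta i t0 w| <= c).
  move=> i.
  have mD : measurable_fun setT (fun w => xi i t0 w - zeta i t0 w).
    have [[Fs Fm _] _ _ _ _] := hW; have [mx _] := xi_sde.
    apply: measurable_funB; apply: measurable_wrt_fun; try exact: Fm (ltW t00).
      by apply: mx; rewrite /= in_itv/= t00.
    exact: (zeta_adapted hW) (ltW t00).
  have e'0 : 0 < e / (3 * (n + 1)) by rewrite divr_gt0// mulr_gt0// ltr_wpDl.
  by have [ci ci0 Hci] := outside_small_bounded P mD e'0; exists ci.
pose cc := \sum_i c i; have cc0 : 0 <= cc by rewrite sumr_ge0.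
have c_cc i : c i <= cc by rewrite /cc (bigD1 i)//= lerDl sumr_ge0.
exists (t0 / T0 + (2 * (2 * cc + 3) / e) ^+ 2 + 1) => L LL.
have tT0 : 0 <= t0 / T0 by rewrite divr_ge0 ?ltW.
have sq0 := sqr_ge0 (2 * (2 * cc + 3) / e).
have L0 : 0 < L by apply: lt_le_trans LL; lra.
split => //; pose r := Num.sqrt L; have r0 : 0 < r by rewrite sqrtr_gt0.
have rE : r ^+ 2 = L by rewrite sqr_sqrtr// ltW.
have LT0 : t0 <= L * T0 by rewrite -ler_pdivrMr//; apply: le_trans LL; lra.
have LT1 : t0 < L * T1 by apply: le_lt_trans LT0 _; rewrite ltr_pM2l.
have U0 := lt_trans t00 LT1.
have h1 := outside_small_all (fun i => sup_brownian_le hW i U0 (mulr_gt0 l0 r0)).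
have h2 := outside_small_all (fun i => forcing_small hW hK xi_continuous xi_sde i Kt LT1).
have h3 := outside_small_all Hc.
have := outside_small_and h1 (outside_small_and h2 h3); rewrite -/n.
apply: outside_small_le.
  have p1 : n * (12 * (L * T1) / (lambda * r) ^+ 2) <= e / 3.
    have -> : n * (12 * (L * T1) / (lambda * r) ^+ 2) = 12 * n * T1 / lambda ^+ 2.
      by rewrite exprMn rE; field; rewrite !gt_eqF.
    rewrite ler_pdivrMr ?exprn_gt0//; apply: le_trans (_ : e / 3 * lambda <= _); last first.
      by rewrite ler_wpM2l ?divr_ge0 ?(ltW e0)// expr2 ler_peMr// ltW.
    rewrite /lambda mulrDr mulr1.
    have -> : e / 3 * (36 * n * T1 / e) = 12 * n * T1 by field; rewrite gt_eqF.
    by rewrite lerDl divr_ge0// ltW.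
  have p2 : n * (24 * K ^+ 2 / t0) <= e / 3.
    have -> : n * (24 * K ^+ 2 / t0) = (n * (24 * K ^+ 2)) / t0 by rewrite mulrA.
    rewrite ler_pdivrMr//; apply: le_trans (_ : e / 3 * a2 <= _); last first.
      by rewrite ler_wpM2l ?divr_ge0 ?(ltW e0)// /t0; lra.
    rewrite le_eqVlt; apply/orP; left; apply/eqP; rewrite /a2; field; rewrite gt_eqF//.
  have p3 : n * (e / (3 * (n + 1))) <= e / 3.
    have n1 : 0 < n + 1 by rewrite ltr_wpDl.
    have -> : n * (e / (3 * (n + 1))) = e / 3 * (n / (n + 1)).
      by field; rewrite gt_eqF.
    by rewrite ler_piMr ?divr_ge0 ?(ltW e0)// ler_pdivrMr// mul1r lerDl.
  by lra.
move=> w [HW [Hm Hx]] i T TT.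
have LTin : L * T \in `[t0, L * T1].
  move: TT; rewrite !in_itv/= => /andP[TT0 TT1]; rewrite (le_trans LT0) ?ler_pM2l//.
have S0 : 0 <= lambda * r by rewrite mulr_ge0 ?ltW.
have zS j u : u \in `[t0, L * T1] -> `|zeta j u w| <= C * (lambda * r).
  move=> ut; apply: (HC w (L * T1)) => //; move: ut; rewrite !in_itv/= => /andP[tu ->].
  by rewrite (le_trans (ltW t00)).
have H : `|xi i (L * T) w - zeta i (L * T) w| <= 2 * cc + 3 + 48 * K * (C * (lambda * r)) / t0
    + 4 * drift_slope N * Num.sqrt (L * T) / Num.sqrt t0.
  apply: (@xi_comparison _ N x K hK (fun j u => xi j u w) (fun j u => zeta j u w)
    (fun j u => forcing W xi x t0 j u w) (fun j u => W j u w) t0 (L * T1)) => //.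
  - by rewrite mulr_ge0.
  - by move=> j; exact: (zeta_continuous hW).
  - by move=> j u tu; rewrite /forcing; ring.
  - by move=> j u tu; exact: (zeta_sde hW).
  - by move=> j; rewrite /forcing !subrr set_itv1 Rintegral_set1 !subr0.
  - by move=> j; exact: le_trans (Hx j) (c_cc j).
rewrite -mulrBr normrM gtr0_norm ?invr_gt0// ler_pdivrMl//.
apply: le_trans H _.
have q0 : 0 < Num.sqrt t0 by rewrite sqrtr_gt0.
have q1 : 2 * cc + 3 <= e / 2 * r.
  have : 2 * (2 * cc + 3) / e <= r.
    have y0 : 0 <= 2 * (2 * cc + 3) / e by rewrite divr_ge0 ?(ltW e0)// mulr_ge0// addr_ge0// mulr_ge0.
    by rewrite -(@ler_pXn2r _ 2)// ?nnegrE ?(ltW r0)// rE; apply: le_trans LL; lra.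
  by rewrite ler_pdivrMr//; lra.
have q2 : 48 * K * (C * (lambda * r)) / t0 <= e / 4 * r.
  rewrite ler_pdivrMr//; apply: le_trans (_ : e / 4 * r * a3 <= _); last first.
    by rewrite ler_wpM2l ?mulr_ge0 ?divr_ge0 ?(ltW e0) ?(ltW r0)// /t0; lra.
  rewrite le_eqVlt; apply/orP; left; apply/eqP; rewrite /a3; field; rewrite gt_eqF//.
have q3 : 4 * drift_slope N * Num.sqrt (L * T) / Num.sqrt t0 <= e / 4 * r.
  rewrite ler_pdivrMr//; apply: le_trans (_ : 4 * sl * (r * Num.sqrt T1) <= _).
    rewrite -/sl ler_wpM2l ?mulr_ge0// -sqrtrM ?(ltW L0)// ler_sqrt ?(ltW U0)//.
    by move: LTin; rewrite in_itv/= => /andP[].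
  have : 16 * sl / e * Num.sqrt T1 <= Num.sqrt t0.
    have -> : 16 * sl / e * Num.sqrt T1 = Num.sqrt a4.
      rewrite /a4 sqrtrM ?sqr_ge0// sqrtr_sqr ger0_norm// divr_ge0 ?(ltW e0)// mulr_ge0//.
    by rewrite ler_sqrt//; rewrite /t0; lra.
  move=> h; have := ler_wpM2l (mulr_ge0 (divr_ge0 (ltW e0) (ler0n R 4)) (ltW r0)) h.
  apply: le_trans; rewrite le_eqVlt; apply/orP; left; apply/eqP; field; rewrite gt_eqF//.
apply: le_trans (lerD (lerD q1 q2) q3) _; rewrite -/r.
by rewrite le_eqVlt; apply/orP; left; apply/eqP; field.
Qed.

End Closeness.

(** * Laws of random vectors and Brownian scaling *)

Section FiniteVectors.
Context {R : realType} {d : measure_display} {Omega : measurableType d}.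
Variable P : probability Omega R.
Implicit Types (x y : R) (n : nat).

(** A measurable map to a finite type that determines [x] up to 1/n when [x] is in [-n, n]. *)
Definition cell n x : 'I_(2 * n * n).+1 := inord (Num.truncn ((x + n%:R) * n%:R)).

Definition cell_pt n (c : 'I_(2 * n * n).+1) : R := c%:R / n%:R - n%:R.

Lemma cell_ptP n x : (0 < n)%N -> `|x| <= n%:R -> `|cell_pt (cell n x) - x| <= n%:R^-1.
Proof.
move=> n0; rewrite ler_norml => /andP[x1 x2]; have n0' : 0 < n%:R :> R by rewrite ltr0n.
have xn : 0 <= x + n%:R by lra.
pose y := (x + n%:R) * n%:R; have y0 : 0 <= y := mulr_ge0 xn (ltW n0').
have /andP[t1 t2] := truncn_itv y0.
have tn : (Num.truncn y < (2 * n * n).+1)%N.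
  by rewrite ltnS -(ler_nat R) (le_trans t1)// /y !natrM ler_pM2r//; lra.
rewrite /cell_pt /cell inordK// -/y.
have -> : (Num.truncn y)%:R / n%:R - n%:R - x = - ((y - (Num.truncn y)%:R) / n%:R) :> R.
  by move: ((Num.truncn y)%:R : R) => z; rewrite /y; field; rewrite gt_eqF.
rewrite normrN ger0_norm ?divr_ge0 ?subr_ge0 ?(ltW n0')//.
by rewrite -[leRHS]mul1r ler_pM2r ?invr_gt0// lerBlDr addrC natr1 ltW.
Qed.

Lemma measurable_cell n (c : 'I_(2 * n * n).+1) : measurable [set x | cell n x = c].
Proof.
have mt k : measurable [set x : R | Num.truncn ((x + n%:R) * n%:R) = k].
  pose f (x : R) := (x + n%:R) * n%:R.
  have mf : measurable_fun setT f by apply: measurable_funM => //; exact: measurable_funD.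
  have mS (Y : set R) : measurable Y -> measurable (f @^-1` Y).
    by move=> mY; rewrite -[X in measurable X]setTI; exact: mf.
  case: k => [|k].
    rewrite (_ : [set x | _] = f @^-1` `]-oo, 1%:R[); first exact: mS.
    by apply/seteqP; split=> x /=; rewrite in_itv/= -/(f x) -truncn_le_nat leqn0 => /eqP.
  rewrite (_ : [set x | _] = f @^-1` `[k.+1%:R, k.+2%:R[); first exact: mS.
  apply/seteqP; split=> x /=; rewrite in_itv/= -/(f x) -truncn_le_nat -truncn_gt_nat.
    by move=> h; apply/andP; rewrite h.
  by move=> /andP[h1 h2]; apply/eqP; rewrite eqn_leq h2 h1.
rewrite (_ : [set x | _] = \bigcup_(k in [set k | inord k = c])
    [set x | Num.truncn ((x + n%:R) * n%:R) = k]).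
  exact: bigcup_measurable.
apply/seteqP; split=> x /=; first by move=> cx; exists (Num.truncn ((x + n%:R) * n%:R)).
by move=> [k /= kc xk]; rewrite /cell xk.
Qed.

Lemma bounded_integrable (X : Omega -> R) M : measurable_fun setT X -> (forall w, `|X w| <= M) ->
  P.-integrable setT (EFin \o X).
Proof.
move=> mX XM; apply: (@le_integrable_EFin _ _ _ _ _ (cst M)) => //.
by apply: finite_measure_integrable_cst; rewrite ?probability_setT.
Qed.

Lemma integrableB_EFin (X Y : Omega -> R) : P.-integrable setT (EFin \o X) ->
  P.-integrable setT (EFin \o Y) -> P.-integrable setT (fun w => (X w - Y w)%:E).
Proof. by move=> iX iY; apply: eq_integrable (integrableB _ iX iY). Qed.

Lemma bounded_convergence (Xn : nat -> Omega -> R) (X : Omega -> R) M :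
  (forall n, measurable_fun setT (Xn n)) -> (forall n w, `|Xn n w| <= M) ->
  (forall w, Xn n w @[n --> \oo] --> X w) ->
  measurable_fun setT X /\ \int[P]_w Xn n w @[n --> \oo] --> \int[P]_w X w.
Proof.
move=> mX XM Xcv; have mX' : measurable_fun setT X by exact: (measurable_fun_cvg (h := Xn)).
split => //; have iM : P.-integrable setT (EFin \o cst M).
  by apply: finite_measure_integrable_cst; rewrite ?probability_setT.
have [iX _ h] : [/\ P.-integrable setT (EFin \o X),
    (\int[P]_(w in setT) `|(Xn n w)%:E - (X w)%:E|)%E @[n --> \oo] --> 0%E &
    (\int[P]_(w in setT) (Xn n w)%:E)%E @[n --> \oo] --> (\int[P]_(w in setT) (X w)%:E)%E].
  apply: (@dominated_convergence _ _ _ P setT measurableT (fun n w => (Xn n w)%:E)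
      (EFin \o X) (EFin \o cst M)) => //.
  - by move=> n; exact/measurable_EFinP.
  - exact/measurable_EFinP.
  - by apply: aeW => w _; apply: cvg_EFin; [near=> n|exact: Xcv].
  - by apply: aeW => w n _; rewrite lee_fin.
apply: fine_cvg; rewrite fineK//; exact: integrable_fin_num.
Unshelve. all: by end_near. Qed.

Variable J : finType.

Definition sup_lip (C : R) (g : (J -> R) -> R) :=
  forall (v v' : J -> R) r, 0 <= r -> (forall j, `|v j - v' j| <= r) -> `|g v - g v'| <= C * r.

Definition cell_vec n (v : J -> R) : {ffun J -> 'I_(2 * n * n).+1} := [ffun j => cell n (v j)].

Definition cell_val n (c : {ffun J -> 'I_(2 * n * n).+1}) : J -> R := fun j => cell_pt (c j).

Lemma cell_cvg C (g : (J -> R) -> R) v : 0 <= C -> sup_lip C g -> g (cell_val (cell_vec n v)) @[n --> \oo] --> g v.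
Proof.
move=> C0 gC; apply/cvgrPdist_le => e e0.
near=> n; rewrite distrC; apply: (le_trans (gC _ _ (n%:R^-1) _ _)).
- by rewrite invr_ge0.
- move=> j; rewrite /cell_val ffunE; apply: cell_ptP; first by near: n; exact: nbhs_infty_gt.
  apply: (@le_trans _ _ (\sum_j `|v j|)).
    by rewrite (bigD1 j)//= lerDl sumr_ge0.
  by near: n; exact: nbhs_infty_ger.
- rewrite ler_pdivrMr; last by rewrite ltr0n; near: n; exact: nbhs_infty_gt.
  by rewrite mulrC -ler_pdivrMr//; near: n; exact: nbhs_infty_ger.
Unshelve. all: by end_near. Qed.

Variables (g : (J -> R) -> R) (C M : R).
Hypotheses (C0 : 0 <= C) (gC : sup_lip C g) (gM : forall v, `|g v| <= M).

Let cellE n (X : J -> Omega -> R) w : g (cell_val (cell_vec n (X ^~ w))) =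
  \sum_(c : {ffun J -> 'I_(2 * n * n).+1})
    g (cell_val c) * \1_(\bigcap_(j in [set: J]) (X j @^-1` [set x | cell n x = c j])) w :> R.
Proof.
rewrite (bigD1 (cell_vec n (X ^~ w)))//= big1 ?addr0.
  rewrite indicE mem_set ?mulr1// => j _ /=; by rewrite ffunE.
move=> c cX; rewrite indicE memNset ?mulr0// => H; move/eqP: cX; apply.
by apply/ffunP => j; rewrite ffunE; have /= -> := H j I.
Qed.

Let rect_measurable n (X : J -> Omega -> R) (c : {ffun J -> 'I_(2 * n * n).+1}) :
  (forall j, measurable_fun setT (X j)) ->
  measurable (\bigcap_(j in [set: J]) (X j @^-1` [set x | cell n x = c j])).
Proof.
move=> mX; apply: fin_bigcap_measurable; first exact: finite_finset.
by move=> j _; rewrite -[X in measurable X]setTI; apply: mX => //; exact: measurable_cell.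
Qed.

Lemma vec_convergence (X : J -> Omega -> R) : (forall j, measurable_fun setT (X j)) ->
  measurable_fun setT (fun w => g (X ^~ w)) /\
  \int[P]_w g (cell_val (cell_vec n (X ^~ w))) @[n --> \oo] --> \int[P]_w g (X ^~ w).
Proof.
move=> mX; apply: bounded_convergence => [n|n w|w]; last exact: cell_cvg gC.
  under eq_fun do rewrite cellE.
  apply: measurable_sum => c; apply: measurable_funM => //.
  by apply: measurable_indic; exact: rect_measurable.
exact: gM.
Qed.

Lemma vec_measurable (X : J -> Omega -> R) : (forall j, measurable_fun setT (X j)) ->
  measurable_fun setT (fun w => g (X ^~ w)).
Proof. by move=> /vec_convergence[]. Qed.

(** Cells are boxes, so that the discretised vectors have the same law; the discretisation is
    then removed by bounded convergence. *)
Lemma vec_law (X Y : J -> Omega -> R) :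
  (forall j, measurable_fun setT (X j)) -> (forall j, measurable_fun setT (Y j)) ->
  (forall B : J -> set R, (forall j, measurable (B j)) ->
    P (\bigcap_(j in [set: J]) (X j @^-1` B j)) = P (\bigcap_(j in [set: J]) (Y j @^-1` B j))) ->
  \int[P]_w g (X ^~ w) = \int[P]_w g (Y ^~ w).
Proof.
move=> mX mY XY.
have [_ cX] := vec_convergence mX; have [_ cY] := vec_convergence mY.
have intE n (Z : J -> Omega -> R) : (forall j, measurable_fun setT (Z j)) ->
    \int[P]_w g (cell_val (cell_vec n (Z ^~ w))) = fine (
    \sum_(c : {ffun J -> 'I_(2 * n * n).+1}) ((g (cell_val c))%:E *
      P (\bigcap_(j in [set: J]) (Z j @^-1` [set x | cell n x = c j])))%E).
  move=> mZ; rewrite /Rintegral; congr fine.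
  under eq_integral do rewrite cellE -sumEFin.
  rewrite integral_sum//; last first.
    move=> c; apply: integrableZl_EFin; apply: (@bounded_integrable _ 1).
      by apply: measurable_indic; exact: rect_measurable.
    by move=> w; rewrite indicE; case: (_ \in _); rewrite ?normr1 ?normr0.
  apply: eq_bigr => c _; under eq_integral do rewrite EFinM.
  rewrite integralZl//; last first.
    apply: (@bounded_integrable _ 1); first by apply: measurable_indic; exact: rect_measurable.
    by move=> w; rewrite indicE; case: (_ \in _); rewrite ?normr1 ?normr0.
  by rewrite integral_indic ?setIT//; exact: rect_measurable.
apply: cvg_unique cX _ => //; apply: cvg_trans cY; apply: near_eq_cvg; apply: nearW => n.
by rewrite !intE//; congr fine; apply: eq_bigr => c _; rewrite XY// => j; exact: measurable_cell.
Qed.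

End FiniteVectors.

Section BrownianGrid.
Context {R : realType} {d : measure_display} {Omega : measurableType d}.
Variables (P : probability Omega R) (I : finType) (F : R -> set (set Omega))
  (W : I -> R -> Omega -> R).
Hypothesis hW : brownian_motions P F W.
Implicit Types (i : I) (t : nat -> R) (B : nat -> I -> set R).

Let sG u : 0 <= u -> sigma_algebra setT (F u). Proof. by have [[h _ _] _ _ _ _] := hW; exact: h. Qed.
Let FS u v : 0 <= u -> u <= v -> F u `<=` F v. Proof. by have [[_ _ h] _ _ _ _] := hW; exact: h. Qed.

Definition step_event t B l : set Omega := \bigcap_(i in [set: I])
  ((fun w => W i (t l.+1) w - W i (t l) w) @^-1` B l i).

Fixpoint grid_event t B K : set Omega :=
  if K is l.+1 then grid_event t B l `&` step_event t B l else setT.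

(** By induction on the number of steps: the past of the last step is an event of the filtration,
    which the last increments are independent of. *)
Lemma grid_law t B K : 0 <= t 0%N -> (forall l, t l < t l.+1) -> (forall l i, measurable (B l i)) ->
  F (t K) (grid_event t B K) /\
  P (grid_event t B K) =
  (\prod_(l < K) \prod_(i : I) normal_prob 0%R (Num.sqrt (t l.+1 - t l)%R) (B l i))%E.
Proof.
move=> t0 tS mB; have tpos l : 0 <= t l.
  by elim: l => // l IH; exact: le_trans IH (ltW (tS l)).
elim: K => [|K [FK PK]] /=.
  rewrite big_ord0 probability_setT; split => //.
  by case: (sG (tpos 0%N)) => F0 FC _; rewrite -(setD0 setT); exact: FC.
split; last first.
  have [_ _ _ _ H] := hW.
  by rewrite big_ord_recr/= -PK; exact: H.
have sK := sG (tpos K.+1).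
rewrite -(sigma_algebra_id sK).
have mF A : F (t K.+1) A -> measurable (A : set (g_sigma_algebraType (F (t K.+1)))).
  by rewrite /measurable/= sigma_algebra_id.
apply: (@measurableI _ (g_sigma_algebraType (F (t K.+1)))).
  by apply: mF; apply: FS FK => //; exact: ltW.
apply: fin_bigcap_measurable; first exact: finite_finset.
by move=> i _; apply: mF; apply: (increment_adapted hW i (tpos K) (ltW (tS K))).
Qed.

End BrownianGrid.

Section BrownianScaling.
Context {R : realType} {d : measure_display} {Omega : measurableType d}.
Variables (P : probability Omega R) (I : finType) (F : R -> set (set Omega))
  (W : I -> R -> Omega -> R).
Hypothesis hW : brownian_motions P F W.
Implicit Types (i : I) (L b : R).

Definition scaled_increment L b m (p : 'I_m.+1 * I) w : R :=
  (Num.sqrt L)^-1 * W p.2 (L * mesh 0 b m.+1 p.1.+1) w - (Num.sqrt L)^-1 * W p.2 (L * mesh 0 b m.+1 p.1) w.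

Lemma scaled_increment_measurable L b m (p : 'I_m.+1 * I) : 0 < L -> 0 < b ->
  measurable_fun setT (scaled_increment L b p).
Proof.
move=> L0 b0; rewrite /scaled_increment.
under eq_fun do rewrite -mulrBr.
apply: measurable_funM => //; apply: (increment_measurable hW).
  by apply: mulr_ge0; [exact: ltW|rewrite -[X in X <= _](mesh0 0 b m.+1) le_mesh// ltW].
by rewrite ler_pM2l// le_mesh// ltW.
Qed.

(** The factor [L] in the variances cancels the square of the normalisation, so that the right
    hand side does not depend on [L]. *)
Lemma scaled_increment_law L b m (B : 'I_m.+1 * I -> set R) : 0 < L -> 0 < b ->
  (forall p, measurable (B p)) ->
  P (\bigcap_(p in [set: 'I_m.+1 * I]) (scaled_increment L b p @^-1` B p)) =
  (\prod_(l < m.+1) \prod_(i : I) normal_prob 0%R (Num.sqrt (b / m.+1%:R)) (B (l, i)))%E.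
Proof.
move=> L0 b0 mB; have r0 : 0 < (Num.sqrt L)^-1 by rewrite invr_gt0 sqrtr_gt0.
pose t l := L * mesh 0 b m.+1 l.
pose B' l i : set R := [set y | B (inord l, i) ((Num.sqrt L)^-1 * y)].
have tS l : t l < t l.+1.
  by rewrite ltr_pM2l// -subr_gt0 meshS divr_gt0// subr_gt0.
have t0 : 0 <= t 0%N by rewrite /t mesh0 mulr0.
have mB' l i : measurable (B' l i).
  have mf : measurable_fun setT (fun y : R => (Num.sqrt L)^-1 * y) by exact: measurable_funM.
  by rewrite -[X in measurable X]setTI; exact: mf.
have -> : \bigcap_(p in [set: 'I_m.+1 * I]) (scaled_increment L b p @^-1` B p) =
    grid_event W t B' m.+1.
  have gridP K w : grid_event W t B' K w <-> forall l, (l < K)%N -> step_event W t B' l w.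
    elim: K => [|K IH] /=; first by split.
    split=> [[/IH h1 h2] l|h]; first by rewrite ltnS leq_eqVlt => /predU1P[->//|]; exact: h1.
    by split; [apply/IH => l lK; apply: h; exact: ltnW|exact: h].
  apply/seteqP; split=> w; rewrite gridP.
    by move=> H l lm i _ /=; have := H (inord l, i) Logic.I; rewrite /scaled_increment/= inordK// -mulrBr.
  move=> H [l i] _ /=; have := H l (ltn_ord l) i Logic.I.
  by rewrite /B'/= inord_val /scaled_increment/= -mulrBr.
have [_ ->] := grid_law hW m.+1 t0 tS mB'.
apply: eq_bigr => l _; apply: eq_bigr => i _.
have -> : t l.+1 - t l = L * (b / m.+1%:R) by rewrite -mulrBr meshS subr0.
rewrite sqrtrM ?(ltW L0)//.
have bm : 0 < Num.sqrt (b / m.+1%:R) :> R by rewrite sqrtr_gt0 divr_gt0.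
rewrite -[RHS](_ : normal_prob 0 ((Num.sqrt L)^-1 * (Num.sqrt L * Num.sqrt (b / m.+1%:R))) (B (l, i)) = _).
  have r0' : Num.sqrt L * Num.sqrt (b / m.+1%:R) != 0 by rewrite gt_eqF// mulr_gt0// sqrtr_gt0.
  have k0 : (Num.sqrt L)^-1 != 0 by rewrite gt_eqF.
  by have -> := normal_prob_scale k0 r0' (mB (l, i)); rewrite /B' inord_val.
by rewrite mulKf// gt_eqF// sqrtr_gt0.
Qed.

Lemma scaled_increment_expectation L b m C M (g : ('I_m.+1 * I -> R) -> R) : 0 < L -> 0 < b ->
  0 <= C -> sup_lip C g -> (forall v, `|g v| <= M) ->
  \int[P]_w g (fun p => scaled_increment L b p w) = \int[P]_w g (fun p => scaled_increment 1 b p w).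
Proof.
move=> L0 b0 C0 gC gM.
apply: (vec_law C0 gC gM) => [p|p|B mB]; [exact: scaled_increment_measurable..|].
by rewrite !scaled_increment_law.
Qed.

End BrownianScaling.

Section Interpolation.
Context {R : realType} (I : finType).
Variables (b : R) (m : nat).
Hypothesis b0 : 0 < b.
Implicit Types (u r e : R) (h : I -> R -> R) (v : 'I_m.+1 * I -> R) (i : I).
Local Notation pt := (mesh 0 b m.+1).

Definition ramp l u : R := Num.min 1 (Num.max 0 ((u - pt l) / (b / m.+1%:R))).

(** Interpolation by broken lines rather than by steps, because the equation is solved for
    continuous driving paths. *)
Definition broken_line v i u : R := \sum_(l < m.+1) ramp l u * v (l, i).

Definition mesh_increments h : 'I_m.+1 * I -> R := fun p => h p.2 (pt p.1.+1) - h p.2 (pt p.1).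

Let step0 : 0 < b / m.+1%:R. Proof. exact: divr_gt0. Qed.

Let stepE l : b / m.+1%:R = pt l.+1 - pt l. Proof. by rewrite meshS subr0. Qed.

Lemma ramp_ge0 l u : 0 <= ramp l u.
Proof. by rewrite le_min ler01 le_max lexx. Qed.

Lemma ramp_le1 l u : ramp l u <= 1.
Proof. by rewrite ge_min lexx. Qed.

Lemma ramp0 l u : u <= pt l -> ramp l u = 0.
Proof.
move=> ul; rewrite /ramp max_l ?min_r//.
by rewrite ler_pdivrMr// mul0r subr_le0.
Qed.

Lemma ramp1 l u : pt l.+1 <= u -> ramp l u = 1.
Proof.
move=> lu; have h : 1 <= (u - pt l) / (b / m.+1%:R).
  by rewrite ler_pdivlMr// mul1r (stepE l) lerB.
by rewrite /ramp max_r ?min_l// (le_trans ler01).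
Qed.

Lemma broken_line_continuous v i : continuous (broken_line v i).
Proof.
move=> u; rewrite /broken_line.
have cr l : {for u, continuous (ramp l)}.
  have c1 : {for u, continuous (fun u => (u - pt l) / (b / m.+1%:R))}.
    by apply: cvgM; [apply: cvgB; [exact: cvg_id|exact: cvg_cst]|exact: cvg_cst].
  apply: (@continuous_min _ _ (cst 1) (fun u => Num.max 0 ((u - pt l) / (b / m.+1%:R)))).
    exact: cvg_cst.
  by apply: (@continuous_max _ _ (cst 0) (fun u => (u - pt l) / (b / m.+1%:R))) => //; exact: cvg_cst.
elim: (index_enum _) => [|l s IH].
  by rewrite (_ : (fun u => _) = cst 0); [exact: cvg_cst|apply/funext => y; rewrite big_nil].
rewrite (_ : (fun u => _) = (fun u => ramp l u * v (l, i) + \sum_(j <- s) ramp j u * v (j, i))).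
  by apply: cvgD IH; apply: cvgM; [exact: cr|exact: cvg_cst].
by apply/funext => y; rewrite big_cons.
Qed.

Lemma broken_line_lip v v' r i u : (forall p, `|v p - v' p| <= r) ->
  `|broken_line v i u - broken_line v' i u| <= m.+1%:R * r.
Proof.
move=> vr; rewrite /broken_line -sumrB; apply: le_trans (ler_norm_sum _ _ _) _.
rewrite mulr_natl -[X in _ *+ X]card_ord -sumr_const; apply: ler_sum => l _.
rewrite -mulrBr normrM ger0_norm ?ramp_ge0//.
by apply: le_trans (vr (l, i)); rewrite ler_piMl ?ramp_le1.
Qed.

Lemma mesh_cell u K : 0 <= u -> u <= pt K.+1 ->
  exists p, [/\ (p <= K)%N, pt p <= u & u <= pt p.+1].
Proof.
move=> u0; elim: K => [|K IH] uK; first by exists 0%N; rewrite mesh0.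
have [/IH[p [pK h1 h2]]|/ltW h] := leP u (pt K.+1); last by exists K.+1.
by exists p; split => //; exact: leqW.
Qed.

(** At u the ramps of the cells before that of u have value 1, those of the later cells 0, so that
    the interpolation lies between the values at the ends of the cell of u. *)
Lemma broken_line_approx h i u r : h i 0 = 0 -> u \in `[0, b] ->
  (forall s t, s \in `[0, b] -> t \in `[0, b] -> `|s - t| <= b / m.+1%:R -> `|h i s - h i t| <= r) ->
  `|broken_line (mesh_increments h) i u - h i u| <= r + r.
Proof.
rewrite in_itv/= => h0 /andP[u0 ub] osc.
have [p [pm pu up]] : exists p, [/\ (p <= m)%N, pt p <= u & u <= pt p.+1].
  by apply: mesh_cell; rewrite ?meshn.
have lt1 : (p < m.+1)%N by [].
have -> : broken_line (mesh_increments h) i u = h i (pt p) + ramp p u * (h i (pt p.+1) - h i (pt p)).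
  rewrite /broken_line /mesh_increments /= -(big_mkord xpredT (fun l => ramp l u * (h i (pt l.+1) - h i (pt l)))).
  rewrite (big_cat_nat (leq0n p) (ltnW lt1))/= (big_cat_nat (leqnSn p) lt1)/= big_nat1.
  rewrite [X in X + _](_ : _ = h i (pt p)); last first.
    rewrite (@eq_big_nat _ _ _ _ _ _ (fun l => h i (pt l.+1) - h i (pt l))).
      by rewrite telescope_sumr// mesh0 h0 subr0.
    move=> l /= lp; rewrite ramp1 ?mul1r//; apply: le_trans pu; apply: le_mesh => //; exact: ltW.
  rewrite [X in _ + (_ + X)]big1_seq ?addr0// => l /andP[_]; rewrite mem_index_iota => /andP[pl _].
  by rewrite ramp0 ?mul0r//; apply: le_trans up _; apply: le_mesh => //; exact: ltW.
have uI : u \in `[0, b] by rewrite in_itv/= u0.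
have pI : pt p \in `[0, b] by apply: mesh_itv; rewrite ?ltW//; exact: ltnW.
have pSI : pt p.+1 \in `[0, b] by apply: mesh_itv; rewrite ?ltW.
rewrite addrAC; apply: le_trans (ler_normD _ _) _; apply: lerD.
  by apply: osc => //; rewrite (stepE p) distrC ger0_norm ?subr_ge0// lerB.
rewrite normrM ger0_norm ?ramp_ge0//; apply: le_trans (_ : `|h i (pt p.+1) - h i (pt p)| <= _).
  by rewrite ler_piMl ?ramp_le1.
by apply: osc => //; rewrite -(stepE p) ger0_norm// ltW.
Qed.

End Interpolation.

(** * Lipschitz functionals of paths *)

Lemma rescaled_continuous {R : realType} (h : R -> R) (c L : R) : 0 < L ->
  {within `[0, +oo[, continuous h} -> {within `[0, +oo[, continuous (fun u => c * h (L * u))}.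
Proof.
move=> L0 /half_line_continuousP ch; apply/half_line_continuousP => u; apply: cvgM; first exact: cvg_cst.
have -> : (fun v : R => h (L * `|v|)) = (fun v : R => h `|v|) \o (fun v : R => L * v).
  by apply/funext => v /=; rewrite normrM gtr0_norm.
have -> : h (L * `|u|) = ((fun v : R => h `|v|) \o (fun v : R => L * v)) u.
  by rewrite /= normrM gtr0_norm.
have c1 : {for u, continuous (fun v : R => L * v)} by apply: cvgM; [exact: cvg_cst|exact: cvg_id].
by apply: (continuous_comp c1); exact: ch.
Qed.

Section LipschitzFunctionals.
Context {R : realType} {N : nat} (T0 T1 : R).
Hypotheses (T00 : 0 < T0) (T01 : T0 < T1).
Implicit Types (f g : R -> tri N -> R) (Psi : (R -> tri N -> R) -> R) (k r L t u e M : R) (i j : tri N).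
Local Notation hcontinuous f := {within `[0, +oo[, continuous (f : R -> R)}.

Definition paths_within r f g := forall t i, t \in `[T0, T1] -> `|f t i - g t i| <= r.

(** Lipschitz for the uniform distance on [T0, T1], on all paths and not only on the continuous
    ones, so that step functions and broken lines may be inserted. *)
Definition path_lip k Psi := forall f g r, 0 <= r -> paths_within r f g -> `|Psi f - Psi g| <= k * r.

Context {d : measure_display} {Omega : measurableType d} (P : probability Omega R).

Lemma lip_cvg k Psi (fn : nat -> R -> tri N -> R) f : path_lip k Psi ->
  (forall e, 0 < e -> \forall n \near \oo, paths_within e (fn n) f) ->
  Psi (fn n) @[n --> \oo] --> Psi f.
Proof.
move=> kP fnf; apply/cvgrPdist_le => e e0.
have k1 : 0 < `|k| + 1 by rewrite ltr_wpDl.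
have e'0 : 0 < e / (`|k| + 1) by rewrite divr_gt0.
near=> n; have fw : paths_within (e / (`|k| + 1)) (fn n) f by near: n; exact: fnf.
rewrite distrC; apply: le_trans (kP _ _ _ (ltW e'0) fw) _.
rewrite mulrCA ler_piMr ?(ltW e0)// ler_pdivrMr// mul1r.
by apply: le_trans (ler_norm k) _; rewrite lerDl.
Unshelve. all: by end_near. Qed.

Lemma uniform_osc (h : tri N -> R -> R) a b e : a < b ->
  (forall j, {within `[a, b], continuous (h j)}) -> 0 < e ->
  \forall m \near \oo, forall j s t, s \in `[a, b] -> t \in `[a, b] ->
    `|s - t| <= (b - a) / m.+1%:R -> `|h j s - h j t| <= e.
Proof.
move=> ab ch e0; apply: filter_forall => j.
have [dl d0 H] := within_unif_continuous (ch j) e0.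
near=> m => s t sI tI st; apply: ltW; apply: H => //; apply: le_lt_trans st _.
by near: m; exact: near_mesh_lt.
Unshelve. all: by end_near. Qed.

(** The functional is the limit of its values on the step functions that follow the process at the
    points of a mesh, and these depend on finitely many random variables. *)
Lemma path_lip_measurable k M Psi (Z : tri N -> R -> Omega -> R) :
  0 <= k -> path_lip k Psi -> (forall f, `|Psi f| <= M) ->
  (forall i t, t \in `[T0, T1] -> measurable_fun setT (Z i t)) ->
  (forall i w, {within `[T0, T1], continuous (Z i ^~ w)}) ->
  measurable_fun setT (fun w => Psi (fun t i => Z i t w)).
Proof.
move=> k0 kP PM mZ cZ.
have h m t : exists p : nat, t \in `[T0, T1] ->
    (p <= m.+1)%N /\ `|t - mesh T0 T1 m.+1 p| <= (T1 - T0) / m.+1%:R.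
  have [tI|tI] := boolP (t \in `[T0, T1]); last by exists 0%N.
  by have [l lm tl] := mesh_approx m T01 tI; exists l.
pose p m := projT1 (boolp.choice (h m)); have pP m t := projT2 (boolp.choice (h m)) t.
pose Zm m w t i := Z i (mesh T0 T1 m.+1 (inord (p m t) : 'I_m.+2)) w.
apply: (measurable_fun_cvg (h := fun m w => Psi (Zm m w))) => [m|w _].
  pose g (v : 'I_m.+2 * tri N -> R) := Psi (fun t i => v (inord (p m t), i)).
  have gl : sup_lip k g by move=> v v' r r0 vr; apply: kP => // t i _; exact: vr.
  apply: (@vec_measurable _ _ _ P _ g k M k0 gl (fun v => PM _)
    (fun q => Z q.2 (mesh T0 T1 m.+1 q.1))) => q.
  by apply: mZ; apply: mesh_itv; [exact: ltW|rewrite -ltnS].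
apply: lip_cvg kP _ => e e0; near=> m => t i tI; have [pm tp] := pP m t tI.
have osc : forall j s t, s \in `[T0, T1] -> t \in `[T0, T1] ->
    `|s - t| <= (T1 - T0) / m.+1%:R -> `|Z j s w - Z j t w| <= e.
  by near: m; exact: (uniform_osc T01 (fun j => cZ j w) e0).
rewrite /Zm inordK//; apply: osc => //; first by apply: mesh_itv => //; exact: ltW.
by rewrite distrC.
Unshelve. all: by end_near. Qed.

Variables (F : R -> set (set Omega)) (W : tri N -> R -> Omega -> R).
Hypothesis hW : brownian_motions P F W.

Definition scaled_brownian L w j u : R := (Num.sqrt L)^-1 * W j (L * u) w.

Lemma scaled_brownian_continuous L w j : 0 < L -> hcontinuous (scaled_brownian L w j).
Proof.
by move=> L0; apply: (@rescaled_continuous _ (W j ^~ w)) => //; exact: (brownian_continuous hW).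
Qed.

Lemma path_sol_lip : exists2 C : R, 0 <= C & forall h1 h2 r,
  (forall j, hcontinuous (h1 j)) -> (forall j, hcontinuous (h2 j)) -> 0 <= r ->
  (forall j u, u \in `[0, T1] -> `|h1 j u - h2 j u| <= r) ->
  paths_within (C * r) (fun t i => path_sol h1 i t) (fun t i => path_sol h2 i t).
Proof.
have [C C0 HC] := @path_sol_bound R N; exists C => // h1 h2 r c1 c2 r0 hr t i.
rewrite in_itv/= => /andP[t0 t1]; have t0' := le_trans (ltW T00) t0.
rewrite -path_solB//; apply: (HC (fun j u => h1 j u - h2 j u) T1) => //.
  by move=> j u; apply: cvgB; [exact: c1|exact: c2].
by rewrite in_itv/= t0'.
Qed.

(** A Lipschitz functional of the solution of the limit equation is, up to a small error, a
    function of the increments of the driving path over a mesh, and these scale. *)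
Lemma path_lip_expectation k M Psi L : 0 <= k -> path_lip k Psi -> (forall f, `|Psi f| <= M) -> 0 < L ->
  measurable_fun setT (fun w => Psi (fun t i => path_sol (scaled_brownian L w) i t)) /\
  \int[P]_w Psi (fun t i => path_sol (scaled_brownian L w) i t) =
  \int[P]_w Psi (fun t i => zeta_process W i t w).
Proof.
move=> k0 kP PM; have [C C0 HC] := path_sol_lip; have T10 := lt_trans T00 T01.
pose g m (v : 'I_m.+1 * tri N -> R) := Psi (fun t i => path_sol (broken_line T1 v) i t).
have cb m (v : 'I_m.+1 * tri N -> R) j : hcontinuous (broken_line T1 v j).
  by apply: continuous_subspaceT; exact: broken_line_continuous.
have gl m : sup_lip (k * C * m.+1%:R) (@g m).
  move=> v v' r r0 vr; rewrite -!mulrA; apply: kP; first by rewrite !mulr_ge0.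
  by apply: HC => // [|j u _]; [rewrite mulr_ge0|exact: broken_line_lip].
have gl0 m : 0 <= k * C * m.+1%:R by rewrite !mulr_ge0.
have conv K : 0 < K ->
    measurable_fun setT (fun w => Psi (fun t i => path_sol (scaled_brownian K w) i t)) /\
    \int[P]_w g m (fun p => scaled_increment W K T1 p w) @[m --> \oo] -->
    \int[P]_w Psi (fun t i => path_sol (scaled_brownian K w) i t).
  move=> K0; apply: bounded_convergence => [m|m w|w]; last 1 first.
  - apply: lip_cvg kP _ => e e0; have C1 : 0 < 2 * (C + 1) by rewrite mulr_gt0// ltr_wpDl.
    have e'0 : 0 < e / (2 * (C + 1)) by rewrite divr_gt0.
    have cw j : hcontinuous (scaled_brownian K w j) by exact: scaled_brownian_continuous.
    near=> m; have osc : forall j s t, s \in `[0, T1] -> t \in `[0, T1] ->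
        `|s - t| <= (T1 - 0) / m.+1%:R -> `|scaled_brownian K w j s - scaled_brownian K w j t| <= e / (2 * (C + 1)).
      by near: m; apply: uniform_osc => // j; exact: half_line_itv.
    have H : paths_within (C * (e / (2 * (C + 1)) + e / (2 * (C + 1))))
      (fun t i => path_sol (@broken_line _ _ T1 m (fun p => scaled_increment W K T1 p w)) i t)
      (fun t i => path_sol (scaled_brownian K w) i t).
      apply: HC => // [|j u uI]; first by rewrite addr_ge0// ltW.
      apply: (broken_line_approx T10 (h := scaled_brownian K w)) => // [|s t sI tI st].
        by rewrite /scaled_brownian mulr0; have [_ _ -> _ _] := hW; rewrite mulr0.
      by apply: osc => //; rewrite subr0.
    move=> t i tI; apply: le_trans (H t i tI) _.
    have -> : C * (e / (2 * (C + 1)) + e / (2 * (C + 1))) = C / (C + 1) * e.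
      by field; rewrite !gt_eqF// ltr_wpDl.
    by rewrite ler_piMl ?(ltW e0)// ler_pdivrMr ?ltr_wpDl// mul1r lerDl.
  - by apply: (@vec_measurable _ _ _ P _ (@g m) _ M (gl0 m) (gl m) (fun _ => PM _)
      (fun p => scaled_increment W K T1 p)) => p; exact: (scaled_increment_measurable hW).
  - exact: PM.
move=> L0; have [mL cL] := conv _ L0; have [_ c1] := conv 1 ltr01; split => //.
have -> : (fun w => Psi (fun t i => zeta_process W i t w)) =
    (fun w => Psi (fun t i => path_sol (scaled_brownian 1 w) i t)).
  apply/funext => w; congr Psi; apply/funext => t; apply/funext => i.
  rewrite /zeta_process; congr path_sol; apply/funext => j; apply/funext => u.
  by rewrite /scaled_brownian sqrtr1 invr1 !mul1r.
apply: cvg_unique cL _ => //; apply: cvg_trans c1; apply: near_eq_cvg; apply: nearW => m.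
by rewrite (scaled_increment_expectation hW L0 T10 (gl0 m) (gl m) (fun=> PM _)).
Unshelve. all: by end_near. Qed.

Lemma path_sol_scaled_brownian L w i t : 0 < L -> 0 <= t ->
  path_sol (scaled_brownian L w) i t = (Num.sqrt L)^-1 * zeta_process W i (L * t) w.
Proof. by move=> L0 t0; apply: path_sol_scale => // j; exact: (brownian_continuous hW). Qed.

End LipschitzFunctionals.

(** * Convergence in law *)

Section Minorants.
Context {R : realType} {N : nat} (T0 T1 : R).
Implicit Types (f g : R -> tri N -> R) (k r e : R).
Local Notation within := (@paths_within R N T0 T1).

Definition cont_path f := forall i, {within `[T0, T1], continuous (f ^~ i)}.

Definition path_cont (Phi : (R -> tri N -> R) -> R) := forall f, cont_path f -> forall e, 0 < e ->
  exists2 dl, 0 < dl & forall g, cont_path g -> within dl f g -> `|Phi f - Phi g| <= e.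

Variables (Phi : (R -> tri N -> R) -> R) (M : R).
Hypotheses (PhiM : forall f, `|Phi f| <= M) (cPhi : path_cont Phi).

(** The value [M] is there for paths at infinite distance from the continuous ones, for which the
    infimum would otherwise be over the empty set. *)
Definition minorant_set k f : set R := [set v | v = M \/ exists g r,
  [/\ cont_path g, 0 <= r, within r f g & v = Phi g + k * r]].

(** The inf-convolution of [Phi] with k times the uniform distance: the largest k-Lipschitz
    functional below [Phi] on continuous paths. *)
Definition minorant k f := inf (minorant_set k f).

Let M0 : 0 <= M. Proof. exact: le_trans (PhiM (fun _ _ => 0)). Qed.

Let Phi_ge f : - M <= Phi f. Proof. by have := PhiM f; rewrite ler_norml => /andP[]. Qed.

Let Phi_le f : Phi f <= M. Proof. by have := PhiM f; rewrite ler_norml => /andP[]. Qed.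

Lemma within_refl f : within 0 f f. Proof. by move=> t i _; rewrite subrr normr0. Qed.

Lemma within_trans r r' f g h : within r f g -> within r' g h -> within (r + r') f h.
Proof.
move=> fg gh t i tI; rewrite -(subrK (g t i) (f t i)) -addrA.
by apply: le_trans (ler_normD _ _) _; rewrite lerD ?fg ?gh.
Qed.

Lemma minorant_setM k f : minorant_set k f M. Proof. by left. Qed.

Lemma minorant_set_ge k f v : 0 <= k -> minorant_set k f v -> - M <= v.
Proof.
move=> k0 [->|[g [r [_ r0 _ ->]]]]; first by have := M0; lra.
by apply: le_trans (Phi_ge g) _; rewrite lerDl mulr_ge0.
Qed.

Let lb k f v : 0 <= k -> minorant_set k f v -> minorant k f <= v.
Proof. by move=> k0 vS; apply: ge_inf => //; exists (- M) => u /(minorant_set_ge k0). Qed.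

Let glb k f b : (forall v, minorant_set k f v -> b <= v) -> b <= minorant k f.
Proof. by move=> H; apply: lb_le_inf => //; exists M; exact: minorant_setM. Qed.

Lemma minorant_bound k f : 0 <= k -> `|minorant k f| <= M.
Proof.
move=> k0; rewrite ler_norml (lb k0 (minorant_setM k f)) andbT.
by apply: glb => v; exact: minorant_set_ge.
Qed.

Lemma minorant_lip k : 0 <= k -> path_lip T0 T1 k (minorant k).
Proof.
move=> k0 f g r r0 fg.
have H f1 f2 : within r f1 f2 -> minorant k f1 - k * r <= minorant k f2.
  move=> f12; apply: glb => v [->|[h [r' [ch r'0 gh ->]]]].
    rewrite lerBlDr; apply: le_trans (lb k0 (minorant_setM k f1)) _.
    by rewrite lerDl mulr_ge0.
  rewrite lerBlDr -addrA -mulrDr; apply: lb => //; right; exists h, (r' + r).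
  by split => //; [exact: addr_ge0|rewrite addrC; exact: within_trans gh].
have gf : within r g f by move=> t i tI; rewrite distrC; exact: fg.
by rewrite ler_norml; have := H _ _ fg; have := H _ _ gf; lra.
Qed.

Lemma minorant_le k f : 0 <= k -> cont_path f -> minorant k f <= Phi f.
Proof.
move=> k0 cf; apply: lb => //; right; exists f, 0; split => //; first exact: within_refl.
by rewrite mulr0 addr0.
Qed.

(** When k exceeds 2 M / dl, only the paths within dl of [f] compete in the infimum, and at these
    continuity controls [Phi]. *)
Lemma minorant_cvg f : cont_path f -> minorant n%:R f @[n --> \oo] --> Phi f.
Proof.
move=> cf; apply/cvgrPdist_le => e e0; have [dl d0 H] := cPhi cf e0.
near=> n; rewrite ger0_norm ?subr_ge0 ?minorant_le// lerBlDl -lerBlDr.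
apply: glb => v [->|[g [r [cg r0 fg ->]]]]; first by have := Phi_le f; lra.
have [rd|dr] := leP r dl.
  have := H g cg (fun t i tI => le_trans (fg t i tI) rd); rewrite ler_norml => /andP[_ h].
  by rewrite lerBlDr; apply: le_trans (_ : Phi g + e <= _); [lra|rewrite lerD2r lerDl mulr_ge0].
have nd : 2 * M <= n%:R * dl.
  by rewrite -ler_pdivrMr//; near: n; exact: nbhs_infty_ger.
have nr : n%:R * dl <= n%:R * r by rewrite ler_wpM2l// ltW.
by have := Phi_ge g; have := Phi_le f; lra.
Unshelve. all: by end_near. Qed.

Context {d : measure_display} {Omega : measurableType d} (P : probability Omega R).

Lemma path_cont_measurable (Z : tri N -> R -> Omega -> R) : T0 < T1 ->
  (forall i t, t \in `[T0, T1] -> measurable_fun setT (Z i t)) ->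
  (forall i w, {within `[T0, T1], continuous (Z i ^~ w)}) ->
  measurable_fun setT (fun w => Phi (fun t i => Z i t w)) /\
  \int[P]_w minorant n%:R (fun t i => Z i t w) @[n --> \oo] --> \int[P]_w Phi (fun t i => Z i t w).
Proof.
move=> T01 mZ cZ.
apply: (@bounded_convergence _ _ _ P _ _ M) => [n|n w|w]; last by apply: minorant_cvg => i; exact: cZ.
  by apply: (path_lip_measurable T01 P (ler0n R n) (minorant_lip (ler0n R n)) (M := M)) => // f; exact: minorant_bound.
exact: minorant_bound.
Qed.

End Minorants.

Section LawConvergence.
Context {R : realType} {d : measure_display} {Omega : measurableType d} (N : nat).
Variables (P : probability Omega R) (F : R -> set (set Omega)) (W xi : tri N -> R -> Omega -> R).
Variables (x : nat -> nat -> R -> R) (K : R).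
Hypotheses (hW : brownian_motions P F W) (hK : coef_bounds N x K).
Hypothesis xi_continuous : forall i w, {within `[0, +oo[, continuous (fun t => xi i t w)}.
Hypothesis xi_sde : solves_sde P F W `]0, +oo[ (fun v i tau => xi_drift x v i tau)
  (fun i => coef_sigma x (level i) (kpos i)) xi.
Variables (T0 T1 : R).
Hypotheses (T00 : 0 < T0) (T01 : T0 < T1).
Implicit Types (i j : tri N) (t L e : R) (w : Omega) (Phi : (R -> tri N -> R) -> R).

Let Z L i t w : R := (Num.sqrt L)^-1 * xi i (L * t) w.

Lemma rescaled_xi_continuous L i w : 0 < L -> {within `[T0, T1], continuous (fun t => Z L i t w)}.
Proof.
by move=> L0; apply: half_line_itv (ltW T00) _; apply: (@rescaled_continuous _ (xi i ^~ w)).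
Qed.

Lemma rescaled_xi_measurable L i t : 0 < L -> t \in `[T0, T1] -> measurable_fun setT (Z L i t).
Proof.
rewrite in_itv/= => L0 /andP[t0 _]; have Lt : 0 < L * t by rewrite mulr_gt0// (lt_le_trans T00).
have [[_ Fm _] _ _ _ _] := hW; have [mx _] := xi_sde.
apply: measurable_funM => //; apply: (measurable_wrt_fun (Fm _ (ltW Lt))).
by apply: mx; rewrite /= in_itv/= Lt.
Qed.

Lemma zeta_measurable i t : t \in `[T0, T1] -> measurable_fun setT (zeta_process W i t).
Proof.
rewrite in_itv/= => /andP[t0 _]; have t0' := le_trans (ltW T00) t0.
have [[_ Fm _] _ _ _ _] := hW; apply: (measurable_wrt_fun (Fm _ t0')).
exact: (zeta_adapted hW).
Qed.

Lemma zeta_within_continuous i w : {within `[T0, T1], continuous (zeta_process W i ^~ w)}.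
Proof. by apply: half_line_itv; [exact: ltW|exact: (zeta_continuous hW)]. Qed.

(** [Phi] is replaced by a Lipschitz minorant with nearly the same expectation at the limit
    process; that minorant hardly changes between the two processes, and its expectation at the
    rescaled limit process does not depend on [L]. *)
Lemma expectation_ge Phi (M : R) e : path_cont T0 T1 Phi -> (forall f, `|Phi f| <= M) -> 0 < e ->
  exists L0, forall L, L0 <= L -> 0 < L /\
    \int[P]_w Phi (fun t i => zeta_process W i t w) - e <= \int[P]_w Phi (fun t i => Z L i t w).
Proof.
move=> cPhi PhiM e0; have M0 : 0 <= M by exact: le_trans (PhiM (fun _ _ => 0)).
have [mPz cvz] := path_cont_measurable PhiM cPhi P T01 zeta_measurable zeta_within_continuous.
have e20 : 0 < e / 2 by rewrite divr_gt0.
have [n Hn] : exists n, \int[P]_w Phi (fun t i => zeta_process W i t w) - e / 2 <=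
    \int[P]_w minorant T0 T1 Phi M n%:R (fun t i => zeta_process W i t w).
  have /cvgrPdist_le/(_ _ e20)[n _ H] := cvz; exists n.
  by have := H n (leqnn n); rewrite ler_norml => /andP[_]; lra.
set k : R := n%:R in Hn; have k0 : 0 <= k := ler0n R n.
have kM : 0 < 2 * (k + 2 * M + 1) by rewrite mulr_gt0// ltr_wpDl// addr_ge0// mulr_ge0.
pose e' := e / (2 * (k + 2 * M + 1)); have e'0 : 0 < e' by rewrite divr_gt0.
have [L0 HL] := xi_close_zeta hW hK xi_continuous xi_sde e'0 T00 T01.
exists L0 => L /HL[Lgt0 [A [mA PA HA]]]; split => //.
have lipm : path_lip T0 T1 k (minorant T0 T1 Phi M k) by exact: minorant_lip.
have bm f : `|minorant T0 T1 Phi M k f| <= M by exact: minorant_bound.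
have [mY EY] := (path_lip_expectation T00 T01 hW k0 lipm bm Lgt0).
set Y := fun w => minorant T0 T1 Phi M k (fun t i => path_sol (scaled_brownian W L w) i t) in mY EY.
pose X w := minorant T0 T1 Phi M k (fun t i => Z L i t w).
have [mPZ _] := path_cont_measurable PhiM cPhi P T01 (fun i t => @rescaled_xi_measurable L i t Lgt0)
  (fun i w => @rescaled_xi_continuous L i w Lgt0).
(* On the small event A the minorants are only known to differ by at most 2 M. *)
have YX w : Y w - k * e' - 2 * M * \1_A w <= Phi (fun t i => Z L i t w).
  have XP : X w <= Phi (fun t i => Z L i t w).
    by apply: minorant_le => // i; exact: rescaled_xi_continuous.
  have ke : 0 <= k * e' by rewrite mulr_ge0// ltW.
  have := bm (fun t i => path_sol (scaled_brownian W L w) i t).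
  rewrite ler_norml => /andP[_ YM].
  have [wA|wA] := pselect (A w).
    rewrite indicE mem_set// mulr1.
    have : - M <= Phi (fun t i => Z L i t w) by have := PhiM (fun t i => Z L i t w); rewrite ler_norml => /andP[].
    by move: YM; rewrite -/(Y w); lra.
  rewrite indicE memNset// mulr0 subr0; apply: le_trans XP.
  have := lipm (fun t i => path_sol (scaled_brownian W L w) i t) (fun t i => Z L i t w) e' (ltW e'0).
  rewrite -/(X w) -/(Y w) => H; have : `|Y w - X w| <= k * e'.
    apply: H => t i tI; rewrite distrC (path_sol_scaled_brownian hW)//; first exact: HA.
    by move: tI; rewrite in_itv/= => /andP[t0 _]; exact: le_trans (ltW T00) t0.
  by rewrite ler_norml => /andP[_]; lra.
have iY : P.-integrable setT (EFin \o Y).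
  by apply: (@bounded_integrable _ _ _ P Y M mY) => w; exact: bm.
have iP : P.-integrable setT (EFin \o (fun w => Phi (fun t i => Z L i t w))).
  by apply: (@bounded_integrable _ _ _ P _ M mPZ) => w; exact: PhiM.
have iA : P.-integrable setT (EFin \o (\1_A : Omega -> R)).
  apply: (@bounded_integrable _ _ _ P _ 1) => [|w]; first exact: measurable_indic.
  by rewrite indicE; case: (_ \in _); rewrite ?normr1 ?normr0.
have ic : P.-integrable setT (EFin \o cst (k * e')).
  by apply: finite_measure_integrable_cst.
have iYk : P.-integrable setT (fun w => (Y w - k * e')%:E) by exact: (integrableB_EFin iY ic).
have i2A : P.-integrable setT (fun w => (2 * M * \1_A w)%:E) by exact: integrableZl_EFin.
have : \int[P]_w (Y w - k * e' - 2 * M * \1_A w) <= \int[P]_w Phi (fun t i => Z L i t w).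
  by apply: le_Rintegral => //; exact: (integrableB_EFin iYk i2A).
have intc : \int[P]_w (k * e') = k * e'.
  transitivity (k * e' * fine (P setT)); first exact: Rintegral_cst.
  by rewrite probability_setT mulr1.
have -> : \int[P]_w (Y w - k * e' - 2 * M * \1_A w) =
    \int[P]_w (Y w - k * e') - \int[P]_w (2 * M * \1_A w) by exact: RintegralB.
have -> : \int[P]_w (Y w - k * e') = \int[P]_w Y w - \int[P]_w (k * e') by exact: RintegralB.
rewrite intc EY RintegralZl//.
have -> : \int[P]_w \1_A w = fine (P A) by rewrite /Rintegral integral_indic// setIT.
have PA' : fine (P A) <= e' by rewrite -lee_fin fineK// fin_num_measure.
have h1 : 2 * M * fine (P A) <= 2 * M * e' by rewrite ler_wpM2l ?mulr_ge0.
have h2 : k * e' + 2 * M * e' <= e / 2.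
  have -> : e / 2 = (k + 2 * M + 1) * e'.
    by rewrite /e'; field; rewrite gt_eqF// ltr_wpDl// addr_ge0// mulr_ge0.
  by rewrite -mulrDl ler_wpM2r ?(ltW e'0)// lerDl.
by move: Hn; lra.
Qed.

End LawConvergence.

Section PathTopology.
Context {R : realType} (I : finType).

(** An entourage of the product constrains finitely many coordinates. *)
Lemma ptws_entourage (E : set ({ptws I -> R} * {ptws I -> R})) : entourage E ->
  exists2 dl : R, 0 < dl & forall a b : I -> R, (forall i, `|a i - b i| <= dl) -> E (a, b).
Proof.
case=> B [D _ <-] BE.
suff [dl d0 Hdl] : exists2 dl : R, 0 < dl & forall a b : I -> R, (forall i, `|a i - b i| <= dl) ->
    forall p, p \in finmap.enum_fset D -> (projT1 p).2 (a, b).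
  by exists dl => // a b ab; apply: BE => p pD; exact: Hdl pD.
elim: (finmap.enum_fset D) => [|p s [dl d0 IH]]; first by exists 1.
have [e e0 He] : exists2 e : R, 0 < e & forall a b : I -> R,
    (forall i, `|a i - b i| <= e) -> (projT1 p).2 (a, b).
  case: p => [[i V] /= /asboolP[U Uent UV]].
  have [e /= e0 eU] : entourage_ ball U by rewrite entourage_ballE.
  exists (e / 2); first by rewrite divr_gt0.
  move=> a b ab; apply: UV; apply: eU => /=; rewrite /ball/=.
  by apply: le_lt_trans (ab i) _; rewrite ltr_pdivrMr// ltr_pMr// ltr1n.
exists (Num.min e dl); first by rewrite lt_min e0.
move=> a b ab q; rewrite inE => /predU1P[->|]; last first.
  by apply: IH => i; apply: le_trans (ab i) _; rewrite ge_min lexx orbT.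
by apply: He => i; apply: le_trans (ab i) _; rewrite ge_min lexx.
Qed.

End PathTopology.

Section PathTopologyTri.
Context {R : realType} (N : nat) (T0 T1 : R).

Lemma cont_path_ptws (f : R -> tri N -> R) : cont_path T0 T1 f ->
  {within `[T0, T1], continuous (f : R -> {ptws tri N -> R})}.
Proof.
move=> cf; apply/subspace_continuousP => t tI; apply/cvg_sup => i V [_ [[B oB <-] Bf BV]].
have /subspace_continuousP/(_ t tI) ci := cf i.
by apply: filterS BV _; apply: ci; exact: open_nbhs_nbhs.
Qed.

Lemma path_cont_uniform (Phi : {uniform` `[T0, T1] -> {ptws tri N -> R}} -> R) :
  {within [set f : {uniform` `[T0, T1] -> {ptws tri N -> R}} |
     {within `[T0, T1], continuous (f : R -> {ptws tri N -> R})}], continuous Phi} ->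
  path_cont T0 T1 (Phi : (R -> tri N -> R) -> R).
Proof.
move=> /subspace_continuousP cPhi f cf e e0.
have /cvgrPdist_le/(_ e e0) := cPhi f (cont_path_ptws cf).
rewrite near_withinE => /uniform_nbhs[E [entE EP]].
have [dl d0 dlE] := ptws_entourage entE.
exists dl => // g cg fg; apply: EP; last exact: cont_path_ptws.
by move=> t tI; apply: dlE => i; exact: fg.
Qed.

End PathTopologyTri.

Section Convergence.
Context {R : realType} {d : measure_display} {Omega : measurableType d} (N : nat).
Variables (P : probability Omega R) (F : R -> set (set Omega)) (W xi : tri N -> R -> Omega -> R).
Variables (x : nat -> nat -> R -> R) (K : R).
Hypotheses (hW : brownian_motions P F W) (hK : coef_bounds N x K).
Hypothesis xi_continuous : forall i w, {within `[0, +oo[, continuous (fun t => xi i t w)}.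
Hypothesis xi_sde : solves_sde P F W `]0, +oo[ (fun v i tau => xi_drift x v i tau)
  (fun i => coef_sigma x (level i) (kpos i)) xi.
Variables (T0 T1 : R).
Hypotheses (T00 : 0 < T0) (T01 : T0 < T1).

Let expectationE (X : Omega -> R) M : measurable_fun setT X -> (forall w, `|X w| <= M) ->
  ('E_P[X] = (\int[P]_w X w)%:E)%E.
Proof.
move=> mX XM; rewrite unlock /Rintegral fineK//.
by apply: integrable_fin_num => //; exact: bounded_integrable XM.
Qed.

(** The lower bound for [Phi] and for its opposite enclose the expectation. *)
Lemma xi_cvg_in_law :
  cvg_in_law_paths T0 T1 P (fun L i T w => (Num.sqrt L)^-1 * xi i (L * T) w) P (zeta_process W).
Proof.
move=> Phi /path_cont_uniform cPhi [M PhiM].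
have mz : measurable_fun setT (fun w => Phi (fun t i => zeta_process W i t w)).
  apply: (path_cont_measurable PhiM cPhi P T01 (Z := zeta_process W) _ _).1.
    exact: (zeta_measurable hW T00).
  exact: (zeta_within_continuous hW T00).
have mZ L : 0 < L -> measurable_fun setT (fun w => Phi (fun t i => (Num.sqrt L)^-1 * xi i (L * t) w)).
  move=> L0; apply: (path_cont_measurable PhiM cPhi P T01 (Z := fun i t w => (Num.sqrt L)^-1 * xi i (L * t) w) _ _).1.
    by move=> i t; exact: (rescaled_xi_measurable hW xi_sde T00).
  by move=> i w; exact: (rescaled_xi_continuous xi_continuous T00).
rewrite (expectationE mz (fun=> PhiM _)).
apply: (@cvg_trans _ ((fun L => (\int[P]_w Phi (fun t i => (Num.sqrt L)^-1 * xi i (L * t) w))%:E) @ +oo)).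
  apply: near_eq_cvg; near=> L; rewrite (expectationE (M := M))//; apply: mZ.
  by near: L; exact: nbhs_pinfty_gt.
suff c1 : (fun L => \int[P]_w Phi (fun t i => (Num.sqrt L)^-1 * xi i (L * t) w)) @ +oo -->
    \int[P]_w Phi (fun t i => zeta_process W i t w).
  by apply: cvg_EFin; [exact: nearW|exact: c1].
apply/cvgrPdist_le => e e0.
have [L1 H1] := expectation_ge hW hK xi_continuous xi_sde T00 T01 cPhi PhiM e0.
have cN : path_cont T0 T1 (fun f => - Phi f).
  move=> f cf r r0; have [dl d0 H] := cPhi f cf r r0; exists dl => // g cg fg.
  by rewrite -opprD normrN; exact: H.
have PN f : `|- Phi f| <= M by rewrite normrN.
have [L2 H2] := expectation_ge hW hK xi_continuous xi_sde T00 T01 cN PN e0.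
near=> L.
have [L0 h1] : 0 < L /\ \int[P]_w Phi (fun t i => zeta_process W i t w) - e <=
    \int[P]_w Phi (fun t i => (Num.sqrt L)^-1 * xi i (L * t) w).
  by apply: H1; near: L; exact: nbhs_pinfty_ge (num_real _).
have [_ h2] : 0 < L /\ \int[P]_w - Phi (fun t i => zeta_process W i t w) - e <=
    \int[P]_w - Phi (fun t i => (Num.sqrt L)^-1 * xi i (L * t) w).
  by apply: H2; near: L; exact: nbhs_pinfty_ge (num_real _).
have intN (X : Omega -> R) : measurable_fun setT X -> (forall w, `|X w| <= M) ->
    \int[P]_w - X w = - \int[P]_w X w.
  move=> mX XM; under eq_Rintegral do rewrite -mulN1r.
  by rewrite RintegralZl ?mulN1r//; exact: bounded_integrable XM.
move: h1 h2; rewrite (intN _ mz (fun=> PhiM _)) (intN _ (mZ _ L0) (fun=> PhiM _)) ler_norml.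
by move: (\int[P]_w _) (\int[P]_w _) => u v h1 h2; lra.
Unshelve. all: by end_near. Qed.

End Convergence.

Theorem proposition5p5 (R : realType) (N : nat) (hN : (1 <= N)%N)
    (rho rho1 rho2 : R) (hrho : 0 < rho < 1)
    (hrho2 : 0 < rho2) (hrho12 : rho2 < rho1) (hrho1 : rho1 < 1)
    (x : nat -> nat -> R -> R) (hx : determines_x N rho x)
    (d : measure_display) (Omega : measurableType d) (P : probability Omega R)
    (F : R -> set (set Omega)) (W xi : tri N -> R -> Omega -> R)
    (hxi : xi_process P x rho1 rho2 F W xi)
    (T0 T1 : R) (hT0 : 0 < T0) (hT1 : T0 < T1) :
  exists (d' : measure_display) (Omega' : measurableType d')
    (P' : probability Omega' R) (F' : R -> set (set Omega'))
    (W' zeta : tri N -> R -> Omega' -> R),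
    [/\ forall i w, {within `[T0, T1], continuous (fun T => zeta i T w)},
        cvg_in_law_paths T0 T1
          P (fun L i T w => (Num.sqrt L)^-1 * xi i (L * T) w)
          P' zeta,
        brownian_motions P' F' W' &
        solves_sde P' F' W' `[T0, T1]
          (fun v i T => \sum_(j : tri N) A_matrix T i j * v j)
          (fun _ _ => 1) zeta].
Proof.
have [K hK] := coef_boundsP hrho hx.
case: hxi => [[_ xi_continuous] _ hW xi_sde _].
exists d, Omega, P, F, W, (zeta_process W); split.
- exact: (zeta_within_continuous hW hT0).
- exact: (xi_cvg_in_law hW hK xi_continuous xi_sde hT0 hT1).
- exact: hW.
split=> [i t|i s t].
  rewrite /= in_itv/= => /andP[t0 _]; apply: (zeta_adapted hW).
  exact: le_trans (ltW hT0) t0.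
rewrite /= !in_itv/= => /andP[s0 _] _ st; apply: wiener_integral1 => w.
rewrite (zeta_sde hW i w (lt_le_trans hT0 s0) st) addrC.
exact: addKr.
Qed.
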